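(* Let $(X,T,\Omega,P,\theta)$ be a random countable topological Markov chain with the b.i.p.-property and let $\varphi$ be a potential such that $(\hat{\mathrm{H}})$ holds and $\mathcal{L}_\omega(1)=1$ a.s. Then there exist constants $t\in(0,1)$, $c\in(0,\infty)$ and random sequences $(k_n(\omega):n\in\mathbb{N})$ and $(l_n(\omega):n\in\mathbb{N})$ in $\mathbb{N}$ such that, for a.e. $\omega\in\Omega$: (i) for random probability measures $\mu,\nu$ and $n\in\mathbb{N}$, with $\mu^n_\omega:=(\mathcal{L}^n_\omega)^\ast(\mu_{\theta^n\omega})$ and $\nu^n_\omega:=(\mathcal{L}^n_\omega)^\ast(\nu_{\theta^n\omega})$, $$W\big(\mu^{k_n(\omega)}_{\theta^{-k_n(\omega)}\omega},\nu^{k_n(\omega)}_{\theta^{-k_n(\omega)}\omega}\big)\le2B_\omega\,t^n\,W(\mu_\omega,\nu_\omega),$$ $$W\big(\mu^{l_n(\omega)}_\omega,\nu^{l_n(\omega)}_\omega\big)\le c\,t^n\,W(\mu_{\theta^{l_n(\omega)}\omega},\nu_{\theta^{l_n(\omega)}\omega});$$ (ii) for a fibrewise Lipschitz continuous function $f$ and $n\in\mathbb{N}$, $$D\big(\mathcal{L}^{k_n(\omega)}_{\theta^{-k_n(\omega)}\omega}(f)\big)\le2B_\omega\,t^n\,D(f_{\theta^{-k_n(\omega)}\omega}),\qquad D\big(\mathcal{L}^{l_n(\omega)}_\omega(f)\big)\le c\,t^n\,D(f_\omega).$$ If $B_\omega$ is (essentially) uniformly bounded, then there exist $t\in(0,1)$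 and random sequences $(k_n(\omega))$, $(l_n(\omega))$ such that, for a.e. $\omega\in\Omega$, the four inequalities in (i) and (ii) are satisfied with $c:=2\,\mathrm{ess\,sup}_{\omega\in\Omega}B_\omega$.
   Context: **Random countable topological Markov chain.** $\theta$ is an ergodic automorphism (invertible, bimeasurable, probability preserving, ergodic) of a probability space $(\Omega,\mathcal{F},P)$; $\{\mathcal{W}^1_\omega\}$ is a measurable family of subsets of $\mathbb{N}$; for a.e. $\omega$, $A_\omega=(\alpha^\omega_{ij}:i\in\mathcal{W}^1_\omega,j\in\mathcal{W}^1_{\theta\omega})$ is a matrix with entries in $\{0,1\}$, measurable in $\omega$, with $\sum_{j\in\mathcal{W}^1_{\theta\omega}}\alpha^\omega_{ij}>0$ and $\sum_{j\in\mathcal{W}^1_{\theta^{-1}\omega}}\alpha^{\theta^{-1}\omega}_{ji}>0$ for all $i\in\mathcal{W}^1_\omega$. Put $X_\omega=\{(x_0,x_1,\dots):\alpha^{\theta^i\omega}_{x_ix_{i+1}}=1\ \forall i\ge0\}$, $T_\omega:X_\omega\to X_{\theta\omega}$ the shift, $X=\{(\omega,x):x\in X_\omega\}$ (measurable structure induced from $\mathbb{N}^{\mathbb{N}}\times\Omega$), $T(\omega,x)=(\theta\omega,T_\omega x)$, $T^n_\omega=T_{\theta^{n-1}\omega}\circ\cdots\circ T_\omega$. $\mathcal{W}^n_\omega$ is the set of $\omega$-admissible words $(x_0,\dots,x_{n-1})$, i.e. $x_i\in\mathcal{W}^1_{\theta^i\omega}$ and $\alpha^{\theta^i\omega}_{x_ix_{i+1}}=1$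 for consecutive letters; $[a]_\omega=\{x\in X_\omega:x_i=a_i,\ 0\le i<n\}$; $\Omega_a=\{\omega:[a]_\omega\neq\emptyset\}$; $\mathcal{W}^n$ is the set of words $a$ of length $n$ with $P(\Omega_a)>0$. For $r\in(0,1)$, $d_r(x,y)=r^{\min\{i:x_i\ne y_i\}}$. **Random probability measure** $\mu=\{\mu_\omega\}$: a map $(B,\omega)\mapsto\mu_\omega(B)\in[0,1]$ on (Borel sets of $\mathbb{N}^{\mathbb{N}}$)$\times\Omega$ which is measurable in $\omega$ for each $B$ and such that, for a.e. $\omega$, $\mu_\omega$ is a probability measure with support $X_\omega$. **b.i.p.-property.** $(X,T)$ is topologically mixing if for all $a,b\in\mathcal{W}^1$ there is an $\mathbb{N}$-valued random variable $N_{ab}$ such that $[a]_\omega\cap(T^n_\omega)^{-1}[b]_{\theta^n\omega}\neq\emptyset$ whenever $n\ge N_{ab}(\omega)$, $a\in\mathcal{W}^1_\omega$ and $\theta^n\omega\in\Omega_b$. $(X,T)$ has the b.i.p.-property if it is topologically mixing and there are $\Omega_{\rm bi},\Omega_{\rm bp}\subset\Omega$ of positive measure and a finite $\mathcal{I}\subset\mathbb{N}$ such that (1) for $\omega\in\Omega_{\rm bi}$, $a\in\mathcal{W}^1_{\theta^{-1}\omega}$ there is $b\in\mathcal{I}$ with $ab\in\mathcal{W}^2_{\theta^{-1}\omega}$; (2) for $\omega\in\Omega_{\rm bp}$, $a\in\mathcal{W}^1_\omega$ there is $b\in\mathcal{I}$ with $ba\in\mathcal{W}^2_{\theta^{-1}\omega}$.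 **Hölder continuity.** For $f:X\to\mathbb{R}$, $f_\omega=f|_{X_\omega}$, $V^\omega_n(f)=\sup\{|f_\omega(x)-f_\omega(y)|:x_i=y_i,\ 0\le i<n\}$. $f$ is locally Hölder continuous with parameter $r$ and index $k$ if there is a random variable $\kappa\ge0$ with $\int\log\kappa\,dP<\infty$ and $V^\omega_n(f)\le\kappa(\omega)r^n$ for all $n\ge k$. For a function $g$ on a fibre $X_\omega$, $D(g)=\sup_{x\ne y}|g(x)-g(y)|/d_r(x,y)$; $f$ is fibrewise Lipschitz continuous if $D(f_\omega)<\infty$ a.s. ($r$ being the Hölder parameter of $\varphi$). **Ruelle operator.** For measurable $\varphi:X\to\mathbb{R}$, $\mathcal{L}_\omega(f)(x)=\sum_{y\in X_\omega:T_\omega y=x}e^{\varphi_\omega(y)}f(y)$ ($x\in X_{\theta\omega}$), $\mathcal{L}^n_\omega=\mathcal{L}_{\theta^{n-1}\omega}\circ\cdots\circ\mathcal{L}_\omega$, $\int f\,d(\mathcal{L}^n_\omega)^\ast(\mu)=\int\mathcal{L}^n_\omega(f)\,d\mu$. $(\hat{\mathrm{H}})$: $\varphi$ is locally Hölder continuous with index $2$ (with parameter $r$ and random variable $\kappa$) and $V^\omega_1(\varphi)<\infty$ for a.e. $\omega\in\theta^{-1}(\Omega_{\rm bi}\cup\Omega_{\rm bp})$. $B_\omega:=\exp\sum_{k=1}^\infty\kappa(\theta^{-k}\omega)r^k$ (a.s. finite). **Vasershtein distance.** $W(\mu,\nu)=\inf\int d_r\,dm$ over all couplings $m$ of the probability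 measures $\mu,\nu$ on the same fibre (i.e. with marginals $\mu,\nu$). A random sequence is a sequence of measurable $\mathbb{N}$-valued functions of $\omega$. *)

(* Defs.v *)
From HB Require Import structures.
From mathcomp Require Import all_boot all_order all_algebra.
From mathcomp Require Import all_classical all_reals all_analysis.

Set Implicit Arguments.
Unset Strict Implicit.
Unset Printing Implicit Defensive.
Import Order.TTheory GRing.Theory Num.Theory.
Import numFieldNormedType.Exports.
Local Open Scope classical_set_scope.
Local Open Scope ring_scope.
Local Open Scope ereal_scope.

(** The space N^N with the Borel sigma-algebra of the product of the discrete
    topologies. *)
Notation NN := (g_sigma_algebraType (@open {ptws nat -> nat})).

Definition shift (x : NN) : NN := fun i => x i.+1.

(** [d_r(x, y) = r ^ min {i | x_i <> y_i}], and 0 when [x = y]. *)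
Definition word_dist (R : realType) (r : R) (x y : NN) : R :=
  match pselect (exists i, x i != y i) with
  | left neq_xy => (r ^+ ex_minn neq_xy)%R
  | right _ => 0%R
  end.

(** The smallest Lipschitz constant of [g] on [A]; adding 0 to the set gives
    the supremum in [0, +oo], so that it is 0 if [A] has at most one point. *)
Definition lip_const (R : realType) (r : R) (A : set NN) (g : NN -> R) : \bar R :=
  ereal_sup [set e | e = 0 \/ exists x y, [/\ A x, A y, x <> y &
    e = (`|g x - g y| / word_dist r x y)%:E]].

(** Sum of a real family over an arbitrary index set; it is the usual value
    whenever the family is absolutely summable. *)
Definition set_sum (R : realType) (D : set NN) (g : NN -> R) : R :=
  (fine (\esum_(y in D) (Num.max (g y) 0)%:E) -
   fine (\esum_(y in D) (Num.max (- g y) 0)%:E))%R.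

Definition msupport (R : realType) (m : set NN -> \bar R) : set NN :=
  [set x | forall U : set {ptws nat -> nat}, open U -> U x -> 0 < m U].

(** [m] is a coupling of [mu] and [nu], all three living on the fibre [A]. *)
Definition is_coupling (R : realType) (A : set NN) (mu nu : set NN -> \bar R)
    (m : probability (NN * NN)%type R) : Prop :=
  [/\ m (A `*` A) = 1,
      forall B, measurable B -> m (B `*` setT) = mu B &
      forall B, measurable B -> m (setT `*` B) = nu B].

Definition vasershtein (R : realType) (r : R) (A : set NN)
    (mu nu : set NN -> \bar R) : \bar R :=
  ereal_inf [set \int[m]_z (word_dist r z.1 z.2)%:E |
             m in [set m | is_coupling A mu nu m]].

Record ergodic_automorphism (R : realType) (d : measure_display)
    (Omega : measurableType d) (P : probability Omega R)
    (th thV : Omega -> Omega) : Prop := {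
  auto_measurable : measurable_fun setT th ;
  auto_measurableV : measurable_fun setT thV ;
  auto_K : cancel th thV ;
  auto_VK : cancel thV th ;
  auto_preserving : forall B, measurable B -> P (th @^-1` B) = P B ;
  auto_ergodic : forall B, measurable B -> th @^-1` B = B -> P B = 0 \/ P B = 1
}.

(** [alpha w i j] is the matrix entry; it is only meaningful for [i] in
    [alphabet w] and [j] in [alphabet (theta w)]. *)
Record random_tmc (R : realType) (d : measure_display)
    (Omega : measurableType d) (P : probability Omega R) := RandomTMC {
  theta : Omega -> Omega ;
  thetaV : Omega -> Omega ;
  theta_auto : ergodic_automorphism P theta thetaV ;
  alphabet : Omega -> set nat ;
  alpha : Omega -> nat -> nat -> bool ;
  alphabet_measurable : forall i, measurable [set w | alphabet w i] ;
  alpha_measurable : forall i j, measurable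
    [set w | [/\ alphabet w i, alphabet (theta w) j & alpha w i j]] ;
  alpha_row : {ae P, forall w, forall i, alphabet w i ->
    exists2 j, alphabet (theta w) j & alpha w i j} ;
  alpha_col : {ae P, forall w, forall i, alphabet w i ->
    exists2 j, alphabet (thetaV w) j & alpha (thetaV w) j i}
}.

Section RandomTMC.
Context (R : realType) (d : measure_display) (Omega : measurableType d)
  (P : probability Omega R) (S : random_tmc P).
Implicit Types (w : Omega) (u : seq nat) (phi f : Omega * NN -> R) (r : R).

Notation th := (theta S).
Notation thV := (thetaV S).

Definition transition w (i j : nat) : Prop :=
  [/\ alphabet S w i, alphabet S (th w) j & alpha S w i j].

Definition fibre w : set NN :=
  [set x | forall i, transition (iter i th w) (x i) (x i.+1)].

Definition total_space : set (Omega * NN) := [set z | fibre z.1 z.2].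

Definition admissible w u : Prop :=
  (forall i, (i < size u)%N -> alphabet S (iter i th w) (nth 0%N u i)) /\
  (forall i, (i.+1 < size u)%N ->
     alpha S (iter i th w) (nth 0%N u i) (nth 0%N u i.+1)).

Definition cylinder w u : set NN :=
  [set x | fibre w x /\ forall i, (i < size u)%N -> x i = nth 0%N u i].

Definition Omega_word u : set Omega := [set w | cylinder w u !=set0].

(** [P (Omega_word u) > 0]. As the positivity of the row and column sums is
    only almost sure, [Omega_word u] is measurable only up to a null set. *)
Definition possible_word u : Prop := ~ P.-negligible (Omega_word u).

Definition top_mixing : Prop :=
  forall a b : nat, possible_word [:: a] -> possible_word [:: b] ->
  exists N : Omega -> nat, measurable_fun setT N /\
  {ae P, forall w, forall n, (N w <= n)%N -> alphabet S w a ->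
    Omega_word [:: b] (iter n th w) ->
    (cylinder w [:: a] `&`
       iter n shift @^-1` cylinder (iter n th w) [:: b]) !=set0}.

(** The b.i.p.-property, as witnessed by the sets [Obi] and [Obp]. *)
Definition bip (Obi Obp : set Omega) : Prop :=
  [/\ top_mixing,
      measurable Obi /\ 0 < P Obi,
      measurable Obp /\ 0 < P Obp &
      exists2 I : set nat, finite_set I &
        (forall w a, Obi w -> alphabet S (thV w) a ->
           exists2 b, I b & admissible (thV w) [:: a; b]) /\
        (forall w a, Obp w -> alphabet S w a ->
           exists2 b, I b & admissible (thV w) [:: b; a])].

Definition on_fibre f w : NN -> R := fun x => f (w, x).

Definition variation f w (n : nat) : \bar R :=
  ereal_sup [set e | exists x y, [/\ fibre w x, fibre w y,
    forall i, (i < n)%N -> x i = y i &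
    e = `|on_fibre f w x - on_fibre f w y|%:E]].

(** The condition [\int log kappa < +oo] presupposes that the integral exists,
    and hence says that the positive part of [log kappa] is integrable. *)
Definition locally_hoelder f r (kappa : Omega -> R) (k : nat) : Prop :=
  [/\ measurable_fun setT kappa,
      forall w, (0 <= kappa w)%R,
      \int[P]_w maxe (lne (kappa w)%:E) 0 < +oo &
      {ae P, forall w, forall n, (k <= n)%N ->
        variation f w n <= (kappa w * r ^+ n)%:E}].

Definition fibrewise_lipschitz f r : Prop :=
  {ae P, forall w, lip_const r (fibre w) (on_fibre f w) < +oo}.

Definition ruelle phi w (g : NN -> R) : NN -> R := fun x =>
  set_sum [set y | fibre w y /\ shift y = x]
          (fun y => (expR (on_fibre phi w y) * g y)%R).

(** [ruelle_iter phi n w] is L_(theta^(n-1) w) \o ... \o L_w. *)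
Fixpoint ruelle_iter phi (n : nat) w (g : NN -> R) : NN -> R :=
  if n is n'.+1 then ruelle phi (iter n' th w) (ruelle_iter phi n' w g) else g.

(** The dual operator, given by its values on indicator functions; it maps
    measures on the fibre over [theta^n w] to measures on the fibre over [w]. *)
Definition ruelle_dual phi (n : nat) w (mu : set NN -> \bar R) :
    set NN -> \bar R := fun B =>
  \int[mu]_(x in fibre (iter n th w)) (ruelle_iter phi n w (\1_B) x)%:E.

Definition hypothesis_H phi r (kappa : Omega -> R) (Obi Obp : set Omega) : Prop :=
  [/\ (0 < r < 1)%R,
      locally_hoelder phi r kappa 2 &
      {ae P, forall w, (th @^-1` (Obi `|` Obp)) w -> variation phi w 1 < +oo}].

Definition ruelle_normalized phi : Prop :=
  {ae P, forall w, forall x, fibre (th w) x -> ruelle phi w (cst 1%R) x = 1%R}.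

Definition Bsum r (kappa : Omega -> R) w : \bar R :=
  expeR (\sum_(1 <= k <oo) (kappa (iter k thV w) * r ^+ k)%:E).

Definition random_probability (mu : R.-spker Omega ~> NN) : Prop :=
  {ae P, forall w, mu w setT = 1 /\ msupport (mu w) = fibre w}.

(** The measure mu^n_w = (L^n_w)^* (mu_(theta^n w)). *)
Definition pullback phi (mu : R.-spker Omega ~> NN) (n : nat) w :
    set NN -> \bar R := ruelle_dual phi n w (mu (iter n th w)).

Definition vas r w : (set NN -> \bar R) -> (set NN -> \bar R) -> \bar R :=
  vasershtein r (fibre w).

(** The contraction inequalities at the point [w], with
    [w_ n = theta^(- k_n w) w] and [w' n = theta^(l_n w) w]. *)
Definition measure_contraction phi r (kappa : Omega -> R) (t : R) (c : \bar R)
    (k l : nat -> Omega -> nat) w : Prop :=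
  let w_ n := iter (k n w) thV w in
  let w' n := iter (l n w) th w in
  forall mu nu : R.-spker Omega ~> NN,
    random_probability mu -> random_probability nu -> forall n : nat,
  vas r (w_ n) (pullback phi mu (k n w) (w_ n)) (pullback phi nu (k n w) (w_ n))
    <= 2%:E * Bsum r kappa w * (t ^+ n)%:E * vas r w (mu w) (nu w) /\
  vas r w (pullback phi mu (l n w) w) (pullback phi nu (l n w) w)
    <= c * (t ^+ n)%:E * vas r (w' n) (mu (w' n)) (nu (w' n)).

Definition lipschitz_contraction phi r (kappa : Omega -> R) (t : R) (c : \bar R)
    (k l : nat -> Omega -> nat) w : Prop :=
  let w_ n := iter (k n w) thV w in
  let w' n := iter (l n w) th w in
  forall f : Omega * NN -> R, fibrewise_lipschitz f r -> forall n : nat,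
  lip_const r (fibre w) (ruelle_iter phi (k n w) (w_ n) (on_fibre f (w_ n)))
    <= 2%:E * Bsum r kappa w * (t ^+ n)%:E *
       lip_const r (fibre (w_ n)) (on_fibre f (w_ n)) /\
  lip_const r (fibre (w' n)) (ruelle_iter phi (l n w) w (on_fibre f w))
    <= c * (t ^+ n)%:E * lip_const r (fibre w) (on_fibre f w).

End RandomTMC.

Definition random_sequence (d : measure_display) (Omega : measurableType d)
    (k : nat -> Omega -> nat) : Prop :=
  forall n, measurable_fun setT (k n).

(* Main.v *)
(**
  A coupling argument. By [L(1) = 1] the inverse branches of the shift carry
  probabilities: a point [x] of the fibre over [w] jumps to [b x], in the fibre
  over [theta^-1 w], with probability [exp(phi(b x))]. Two points with the same
  first letter are moved by the maximal coupling of their letter distributions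
  (common part on the diagonal, independent residual), two points with different
  first letters independently. Iterating gives operators [C^n] on functions of
  two points such that an estimate [C^n d <= K d] yields both the Lipschitz and
  the Vasershtein inequality with constant [K].

  Let [D = min(1, beta d)]. If [x] and [y] share the first letter, the Hoelder
  condition bounds the probability that the coupled letters ever differ by
  [d(x, y) log B_w], so that [C^n] contracts [D] for [beta] large. If they do not,
  big preimages followed by topological mixing bring both points to a fixed
  letter with a probability bounded below as long as [w] stays in a set [G] of
  positive measure. Hence [C^n D <= t D] on the fibre over [w] in [G] for all large
  [n], and [k_n], [l_n] are obtained by summing successive return times of
  [theta^-1] and [theta] to [G], which exist by ergodicity. The first step from a
  general [w] costs the factor [beta B_w], whose [beta] is absorbed by a few extra
  returns.
*)

Require Import Defs.
From HB Require Import structures.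
From mathcomp Require Import all_boot all_order all_algebra.
From mathcomp Require Import all_classical all_reals all_analysis ess_sup_inf.
From mathcomp Require Import measurable_realfun giry ring lra.

Set Implicit Arguments.
Unset Strict Implicit.
Unset Printing Implicit Defensive.
Import Order.TTheory GRing.Theory Num.Theory.
Import numFieldNormedType.Exports.
Local Open Scope classical_set_scope.
Local Open Scope ring_scope.
Local Open Scope ereal_scope.

(** * Measurability of countable conditions *)

Section countable_measurability.
Context d (T : measurableType d).

(** One null set must serve all measures, all functions and all [n]. Hence the estimates are
    pointwise, on a set [A] invariant under [theta] and its inverse; the coupling acts on arbitrary
    functions with values in [0, +oo], and measurability matters only where a coupling measure is
    pushed forward and where the sets to be visited and the times of the visits are formed. The
    function [s] of the estimates is [log B_w]. Its recursion
    [s w = kappa (thV w) * r + r * s (thV w)] is the balance of one step: branch weights of two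
    points with a common head differ at most by the factor [exp(kappa r d)], and [d] shrinks by [r].
    So the factor [exp(- s d)] passes through every induction without loss. The weight [beta] makes
    the cost [s d] of a close pair small against [beta d]; this needs a bound on [s], one reason for
    starting each stage in [G]. The obstacle in finding [G] is that the path provided by mixing
    starts in the past, at [theta^-n w], and the mixing time is a random variable at that very
    point, hence varies with [n]. Recurrence of [theta^-1] to a set with bounded mixing times
    settles this. *)

Lemma measurable_set_ex (I : countType) (A : I -> T -> Prop) :
  (forall i, measurable [set t | A i t]) -> measurable [set t | exists i, A i t].
Proof.
move=> mA; rewrite (_ : [set _ | _] = \bigcup_i [set t | A i t]).
  exact: countable_bigcupT_measurable.
by apply/seteqP; split => [t [i Ait]|t [i _ Ait]]; exists i.
Qed.

Lemma measurable_set_not (A : T -> Prop) :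
  measurable [set t | A t] -> measurable [set t | ~ A t].
Proof. exact: measurableC. Qed.

Lemma measurable_set_all (I : countType) (A : I -> T -> Prop) :
  (forall i, measurable [set t | A i t]) -> measurable [set t | forall i, A i t].
Proof.
move=> mA; rewrite (_ : [set _ | _] = ~` [set t | exists i, ~ A i t]).
  by apply: measurableC; apply: measurable_set_ex => i; exact: measurable_set_not.
apply/seteqP; split => [t At [i nA]|t /forallNP Ant i]; first exact/nA/At.
by apply: contrapT; exact: Ant.
Qed.

Lemma measurable_set_and (A B : T -> Prop) : measurable [set t | A t] ->
  measurable [set t | B t] -> measurable [set t | A t /\ B t].
Proof. exact: measurableI. Qed.

Lemma measurable_set_imply (A B : T -> Prop) : measurable [set t | A t] ->
  measurable [set t | B t] -> measurable [set t | A t -> B t].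
Proof.
move=> mA mB; rewrite (_ : [set _ | _] = ~` [set t | A t] `|` [set t | B t]).
  by apply: measurableU => //; exact: measurableC.
apply/seteqP; split => [t /= AB|t /= [nA|//]//].
by have [/AB|] := pselect (A t); [right|left].
Qed.

Lemma measurable_set_cst (A : Prop) : measurable [set t : T | A].
Proof.
have [a|na] := pselect A.
  by rewrite (_ : [set _ | _] = setT)//; apply/seteqP; split.
by rewrite (_ : [set _ | _] = set0)//; apply/seteqP; split.
Qed.

Lemma measurable_fun_nat (f : T -> nat) :
  (forall k, measurable [set t | f t = k]) -> measurable_fun setT f.
Proof.
move=> mf _ Y _; rewrite setTI (_ : _ @^-1` _ = [set t | exists k, Y k /\ f t = k]).
  by apply: measurable_set_ex => k; apply: measurable_set_and => //; exact: measurable_set_cst.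
by apply/seteqP; split => [t Yt|t [k [Yk fk]]]; [exists (f t)|rewrite /= fk].
Qed.

Lemma measurable_eq_nat (f : T -> nat) k : measurable_fun setT f ->
  measurable [set t | f t = k].
Proof. by move=> mf; rewrite -[X in measurable X]setTI; exact: (mf measurableT [set k]). Qed.

Lemma measurable_fun_countable_case d' (T' : measurableType d') (f : T -> nat)
    (g : nat -> T -> T') : measurable_fun setT f ->
  (forall k, measurable_fun setT (g k)) -> measurable_fun setT (fun t => g (f t) t).
Proof.
move=> mf mg _ Y mY; rewrite setTI.
rewrite (_ : _ @^-1` _ = [set t | exists k, f t = k /\ Y (g k t)]).
  apply: measurable_set_ex => k; apply: measurable_set_and; first exact: measurable_eq_nat.
  by rewrite -[X in measurable X]setTI; exact: mg.
by apply/seteqP; split => [t Yt|t [k [<- ?]]]; [exists (f t)|].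
Qed.

Lemma measurable_fun_iter (f : T -> T) n :
  measurable_fun setT f -> measurable_fun setT (iter n f).
Proof.
move=> mf; elim: n => [|n IH]; first exact: measurable_id.
exact: measurableT_comp mf IH.
Qed.

End countable_measurability.

(** * First occurrence of a random event *)

Section first_index.

(** Total by classical choice, with value 0 when [A] never holds: random times are then defined
    everywhere and measurable, and existence of a visit matters only where the time is used. *)
Definition first_nat (A : nat -> Prop) : nat :=
  xget 0%N [set k | A k /\ forall j, (j < k)%N -> ~ A j].

Lemma first_nat_spec (A : nat -> Prop) : (exists k, A k) ->
  A (first_nat A) /\ forall j, (j < first_nat A)%N -> ~ A j.
Proof.
move=> [k Ak]; rewrite /first_nat; case: xgetP => [m _ mP|nA]; first exact: mP.
have exA : exists k, `[< A k >] by exists k; exact/asboolP.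
case: (ex_minnP exA) => m /asboolP Am mmin; exfalso; apply: (nA m); split => // j jm Aj.
by have := mmin j; rewrite leqNgt jm => /(_ (introT (asboolP _) Aj)).
Qed.

Lemma first_natP (A : nat -> Prop) : (exists k, A k) -> A (first_nat A).
Proof. by move=> /first_nat_spec[]. Qed.

Lemma first_nat_eq (A : nat -> Prop) k : A k -> (forall j, (j < k)%N -> ~ A j) ->
  first_nat A = k.
Proof.
move=> Ak kmin; have [Am mmin] := first_nat_spec (ex_intro _ k Ak).
have [lt|lt|//] := ltngtP (first_nat A) k; first by have := kmin _ lt Am.
by have := mmin _ lt Ak.
Qed.

Lemma first_nat0 (A : nat -> Prop) : ~ (exists k, A k) -> first_nat A = 0%N.
Proof.
move=> nA; rewrite /first_nat; case: xgetP => [m _ [Am _]|]; last by [].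
by exfalso; apply: nA; exists m.
Qed.

Lemma measurable_first_nat d (T : measurableType d) (A : T -> nat -> Prop) :
  (forall k, measurable [set t | A t k]) ->
  measurable_fun setT (fun t => first_nat (A t)).
Proof.
move=> mA; apply: measurable_fun_nat => k.
have mM j : measurable [set t | A t j /\ forall i : 'I_j, ~ A t i].
  apply: measurable_set_and => //; apply: measurable_set_all => i.
  exact: measurable_set_not.
(* The default value 0 adds the points where [A t] never holds to the level set of [k = 0]. *)
rewrite (_ : [set _ | _] = [set t | (A t k /\ forall i : 'I_k, ~ A t i) \/
   (k = 0%N /\ ~ exists j, A t j)]).
  apply: measurableU; first exact: mM.
  apply: measurable_set_and; first exact: measurable_set_cst.
  by apply: measurable_set_not; exact: measurable_set_ex.
apply/seteqP; split => t /=; last first.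
  case=> [[Ak kmin]|[-> nex]]; last exact: first_nat0.
  by apply: first_nat_eq => // j jk; exact: (kmin (Ordinal jk)).
have [ex_k|nex_k] := pselect (exists j, A t j) => fk.
  have [Ak kmin] := first_nat_spec ex_k; left; rewrite -fk.
  by split => // i; exact: kmin.
by right; rewrite -fk first_nat0.
Qed.

End first_index.

(** * The sequence space *)

Section sequence_space.

Lemma continuous_coord (i : nat) : continuous (fun x : {ptws nat -> nat} => x i).
Proof. exact: (@proj_continuous nat (fun=> nat) i). Qed.

Lemma open_coord (i k : nat) : open [set x : {ptws nat -> nat} | x i = k].
Proof.
rewrite (_ : [set _ | _] = (fun x : {ptws nat -> nat} => x i) @^-1` [set k]) //.
apply: open_comp; first by move=> x _; exact: continuous_coord.
exact: discrete_open.
Qed.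

Lemma measurable_coord (i : nat) : measurable_fun setT (fun x : NN => x i).
Proof.
move=> _ Y _; rewrite setTI.
have -> : (fun x : NN => x i) @^-1` Y =
  \bigcup_(k in Y) [set x : NN | x i = k].
  by apply/seteqP; split => [x /= Yx|x [k /= Yk] /= xik]; [exists (x i)|rewrite /= xik].
apply: bigcup_measurable => k _; apply: sub_sigma_algebra; exact: open_coord.
Qed.

Definition word_cyl (u : seq nat) : set NN :=
  [set x | forall i, (i < size u)%N -> x i = nth 0%N u i].

(** If no cylinder around [x] were contained in [U], points outside [U] agreeing with [x] on longer
    and longer prefixes would converge to [x]. Since words are countable, measurability into [NN]
    can be tested on coordinates. *)
Lemma open_bigcup_word_cyl (U : set {ptws nat -> nat}) : open U ->
  U = \bigcup_(u in [set u | word_cyl u `<=` U]) word_cyl u.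
Proof.
move=> oU; apply/seteqP; split; last by move=> x [u /= + ux]; exact.
move=> x Ux.
suff [n Hn] : exists n, forall y : NN, (forall i, (i < n)%N -> x i = y i) -> U y.
  exists (mkseq x n) => /=.
    move=> y; rewrite /word_cyl/= size_mkseq => yx; apply: Hn => i ni.
    by rewrite yx // nth_mkseq.
  by move=> i; rewrite size_mkseq => ni; rewrite nth_mkseq.
apply: contrapT => /forallNP Hn.
have /choice[f Hf] : forall n, exists y : NN,
    (forall i, (i < n)%N -> x i = y i) /\ ~ U y.
  move=> n; have := Hn n; move/existsNP => [y] /not_implyP[y1 y2].
  by exists y.
have cvgf : (f : nat -> {ptws nat -> nat}) @ \oo --> (x : {ptws nat -> nat}).
  apply/cvg_sup => i; apply/cvg_image => //.
    by apply/seteqP; split => // a _; exists (fun=> a).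
  move=> V /= /nbhs_singleton Vx.
  exists ((fun g : nat -> nat => g i) @^-1` V).
    exists i.+1 => // n /= ni.
    by have <- := proj1 (Hf n) i ni.
  by apply/seteqP; split => [a [g /= Vg <-]//|a Va]; exists (fun=> a).
have [N _ HN] := cvgf U (open_nbhs_nbhs (conj oU Ux)).
exact: (proj2 (Hf N) (HN N (leqnn N))).
Qed.

Lemma measurable_funNN d (T : measurableType d) (D : set T) (f : T -> NN) :
  (forall i, measurable_fun D (fun t => f t i)) -> measurable_fun D f.
Proof.
move=> mf mD; apply: (@measurability _ _ T NN D f (@open {ptws nat -> nat})) => //.
move=> _ [U oU <-]; rewrite (open_bigcup_word_cyl oU).
rewrite (_ : _ `&` _ = [set t | exists u, word_cyl u `<=` U /\
    (D t /\ forall i : 'I_(size u), (D `&` (fun t => f t i) @^-1` [set nth 0%N u i]) t)]).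
  apply: measurable_set_ex => u. apply: measurable_set_and; first exact: measurable_set_cst.
  apply: measurable_set_and => //; apply: measurable_set_all => i; exact: mf.
apply/seteqP; split => [t [Dt [u /= uU ut]]|t [u [uU [Dt ut]]]].
  by exists u; split => //; split => // i; split => //=; exact: ut.
by split => //; exists u => //= i iu; have [_] := ut (Ordinal iu).
Qed.

Definition push (b : nat) (x : NN) : NN := fun i => if i is j.+1 then x j else b.

Lemma push_shift (x : NN) : push (x 0%N) (Defs.shift x) = x.
Proof. by apply/funext => -[]. Qed.

Lemma measurable_push b : measurable_fun setT (push b).
Proof.
apply: measurable_funNN => -[|i]; first exact: measurable_cst.
exact: measurable_coord.
Qed.

End sequence_space.

(** * The metric on sequences *)

Section word_distance.
Context (R : realType) (r : R).
Hypothesis r01 : (0 < r < 1)%R.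
Local Open Scope ring_scope.
Implicit Types x y : NN.

Let r_ge0 : 0 <= r. Proof. by case/andP: r01 => /ltW. Qed.
Let r_le1 : r <= 1. Proof. by case/andP: r01 => _ /ltW. Qed.

Lemma word_dist_first x y k : (forall i, (i < k)%N -> x i = y i) -> x k <> y k ->
  word_dist r x y = r ^+ k.
Proof.
move=> xy xyk; rewrite /word_dist; case: pselect => [ne|[]]; last first.
  by exists k; exact/eqP.
case: ex_minnP => m xym mmin; congr (_ ^+ _).
apply/eqP; rewrite eqn_leq mmin ?andbT; last exact/eqP.
by rewrite leqNgt; apply/negP => /xy /eqP; rewrite (negbTE xym).
Qed.

Lemma word_dist_cases x y :
  x = y \/ exists k, [/\ forall i, (i < k)%N -> x i = y i, x k <> y k &
    word_dist r x y = r ^+ k].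
Proof.
have [ne|ne] := pselect (exists i, x i != y i); last first.
  left; apply/funext => i; apply/eqP; apply: contrapT => /negP xyi.
  by apply: ne; exists i.
right; case: (ex_minnP ne) => k xyk kmin; exists k.
have xy i : (i < k)%N -> x i = y i.
  move=> ik; apply/eqP; apply: contraT => /kmin; by rewrite leqNgt ik.
have xyk' : x k <> y k by exact/eqP.
by split => //; exact: word_dist_first.
Qed.

Lemma word_dist_refl x : word_dist r x x = 0.
Proof.
rewrite /word_dist; case: pselect => // ne; exfalso.
by have [i] := ne; rewrite eqxx.
Qed.

Lemma word_dist_ge0 x y : 0 <= word_dist r x y.
Proof.
by have [->|[k [_ _ ->]]] := word_dist_cases x y;
  [rewrite word_dist_refl|rewrite exprn_ge0].
Qed.

Lemma word_dist_gt0 x y : x <> y -> 0 < word_dist r x y.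
Proof.
have [->//|[k [_ _ -> _]]] := word_dist_cases x y.
by rewrite exprn_gt0//; case/andP: r01.
Qed.

Lemma word_dist_le1 x y : word_dist r x y <= 1.
Proof.
by have [->|[k [_ _ ->]]] := word_dist_cases x y;
  [rewrite word_dist_refl|rewrite exprn_ile1].
Qed.

Lemma word_dist_head x y : x 0%N != y 0%N -> word_dist r x y = 1.
Proof. by move=> /eqP xy; rewrite (@word_dist_first _ _ 0%N)// expr0. Qed.

Lemma word_dist_push b x y : word_dist r (push b x) (push b y) = r * word_dist r x y.
Proof.
have [->|[k [xy xyk ->]]] := word_dist_cases x y.
  by rewrite !word_dist_refl mulr0.
by rewrite (@word_dist_first _ _ k.+1) ?exprS// => -[|i]//=; exact: xy.
Qed.

Lemma measurable_word_dist :
  measurable_fun setT (fun z : (NN * NN)%type => word_dist r z.1 z.2).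
Proof.
have mne i : measurable [set z : (NN * NN)%type | z.1 i != z.2 i].
  rewrite (_ : [set _ | _] = [set z | exists k : nat, ~ (z.1 i = k -> z.2 i = k)]).
    apply: measurable_set_ex => k; apply: measurable_set_not.
    apply: measurable_set_imply; apply: measurable_eq_nat.
      exact: (measurableT_comp (measurable_coord i) measurable_fst).
    exact: (measurableT_comp (measurable_coord i) measurable_snd).
  apply/seteqP; split => [z /eqP ne|z [k /not_implyP[<- ne]]].
    by exists (z.1 i) => /(_ erefl)/esym.
  by apply/eqP => /esym.
rewrite (_ : (fun z => _) = fun z : (NN * NN)%type =>
   if `[< exists i, z.1 i != z.2 i >] then
     r ^+ first_nat (fun i => z.1 i != z.2 i) else 0).
  apply: measurable_fun_ifT => //.
    apply: (measurable_fun_bool true); rewrite setTI.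
    rewrite (_ : _ @^-1` _ = [set z | exists i, z.1 i != z.2 i]).
      exact: measurable_set_ex.
    by apply/seteqP; split => z /=; [move/asboolP|move=> ?; exact/asboolP].
  apply: (measurable_fun_countable_case (g := fun k _ => r ^+ k)) => //.
  exact: measurable_first_nat.
apply/funext => -[x y] /=; case: asboolP => [ne|ne].
  have [eq_xy|[k [xy xyk ->]]] := word_dist_cases x y.
    by case: ne => i; rewrite eq_xy eqxx.
  congr (_ ^+ _); apply/esym/first_nat_eq; first exact/eqP.
  by move=> j /xy ->; rewrite eqxx.
by rewrite /word_dist; case: pselect.
Qed.

End word_distance.

(** * The transfer operator and the coupled chain *)

Section one_step.
Context (R : realType) (d : measure_display) (Omega : measurableType d)
  (P : probability Omega R) (S : random_tmc P) (phi : Omega * NN -> R).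
Implicit Types (w : Omega) (x y : NN) (b : nat).
Local Notation th := (theta S).
Local Notation thV := (thetaV S).

Lemma thK : cancel th thV. Proof. exact: auto_K (theta_auto S). Qed.

Lemma thVK : cancel thV th. Proof. exact: auto_VK (theta_auto S). Qed.

Lemma iter_thVK n w : iter n th (iter n thV w) = w.
Proof. by elim: n w => [//|n IH] w; rewrite iterSr [iter n.+1 thV w]iterS thVK IH. Qed.

Lemma iter_thK n w : iter n thV (iter n th w) = w.
Proof. by elim: n w => [//|n IH] w; rewrite iterSr [iter n.+1 th w]iterS thK IH. Qed.

Lemma fibre_push w b x :
  fibre S (thV w) (push b x) <-> transition S (thV w) b (x 0%N) /\ fibre S w x.
Proof.
split=> [fx|[t0 fx] [|i]]; last 2 first.
- exact: t0.
- by rewrite iterSr thVK; exact: fx.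
split; first exact: (fx 0%N).
by move=> i; have := fx i.+1; rewrite iterSr thVK.
Qed.

Lemma fibre_shift w x : fibre S w x -> fibre S (th w) (Defs.shift x).
Proof. by move=> fx i; rewrite -iterSr; exact: fx. Qed.

Lemma measurable_total_space : measurable (total_space S).
Proof.
rewrite (_ : total_space S = [set z | forall i, exists k l : nat,
   transition S (iter i th z.1) k l /\ (z.2 i = k /\ z.2 i.+1 = l)]).
  apply: measurable_set_all => i; apply: measurable_set_ex => k.
  apply: measurable_set_ex => l; apply: measurable_set_and.
    have mi : measurable_fun setT (fun z : Omega * NN => iter i th z.1).
      apply: (measurableT_comp _ measurable_fst).
      exact/measurable_fun_iter/(auto_measurable (theta_auto S)).
    by have := mi measurableT _ (alpha_measurable S k l); rewrite setTI.
  by apply: measurable_set_and; apply: measurable_eq_nat;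
    [exact: (measurableT_comp (measurable_coord i) measurable_snd)|
     exact: (measurableT_comp (measurable_coord i.+1) measurable_snd)].
apply/seteqP; split => [z fz i|z fz i].
  by exists (z.2 i), (z.2 i.+1).
by have [k [l [? [-> ->]]]] := fz i.
Qed.

Lemma measurable_fibre w : measurable (fibre S w).
Proof.
rewrite (_ : fibre S w = (fun x => (w, x)) @^-1` total_space S)//.
rewrite -[X in measurable X]setTI.
exact: (measurable_pair1 w measurableT measurable_total_space).
Qed.

(* Operators are indexed by the target: at [w] they map functions on the fibre
   over [thetaV w] to functions on the fibre over [w]. *)
Definition tprob w b x : R :=
  if `[< fibre S (thV w) (push b x) >] then expR (phi (thV w, push b x)) else 0%R.

Lemma tprob_ge0 w b x : (0 <= tprob w b x)%R.
Proof. by rewrite /tprob; case: ifP => // _; exact: expR_ge0. Qed.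

Lemma tprob_off w b x : ~ fibre S (thV w) (push b x) -> tprob w b x = 0%R.
Proof. by rewrite /tprob => nf; case: asboolP. Qed.

Lemma tprob_on w b x : fibre S (thV w) (push b x) ->
  tprob w b x = expR (phi (thV w, push b x)).
Proof. by rewrite /tprob => nf; case: asboolP. Qed.

Lemma measurable_tprob_prod b : measurable_fun (total_space S) phi ->
  measurable_fun setT (fun z : Omega * NN => tprob z.1 b z.2).
Proof.
move=> mphi.
pose psi (z : Omega * NN) := if `[< total_space S z >] then expR (phi z) else 0%R.
have mpsi : measurable_fun setT psi.
  have -> : psi = (expR \o phi) \_ (total_space S).
    apply/funext => z; rewrite patchE /psi.
    have [fz|fz] := pselect (total_space S z).
      by rewrite mem_set// asboolT.
    by rewrite memNset// asboolF.
  apply/(measurable_restrictT _ measurable_total_space).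
  exact: (measurableT_comp (@measurable_expR R) mphi).
have mg : measurable_fun setT (fun z : Omega * NN => (thV z.1, push b z.2)).
  apply: measurable_fun_pair.
    exact: (measurableT_comp (auto_measurableV (theta_auto S)) measurable_fst).
  exact: (measurableT_comp (measurable_push b) measurable_snd).
exact: (measurableT_comp mpsi mg).
Qed.

Lemma measurable_tprob w b : measurable_fun (total_space S) phi ->
  measurable_fun setT (tprob w b).
Proof.
move=> mphi; exact: (measurableT_comp (measurable_tprob_prod b mphi) (measurable_pair1 w)).
Qed.

Definition transfer w (F : NN -> \bar R) x : \bar R :=
  \sum_(b <oo) (tprob w b x)%:E * F (push b x).

(** The value 0 for different first letters turns the residual into the product law, so that
    [couple] covers both coupling rules by one formula. *)
Definition common w b x y : R :=
  if x 0%N == y 0%N then Num.min (tprob w b x) (tprob w b y) else 0%R.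

Definition common_mass w x y : R := fine (\sum_(b <oo) (common w b x y)%:E).

(* The absolute value only serves to make the residual nonnegative off the fibres. *)
Definition residual w b b' x y : R :=
  ((tprob w b x - common w b x y) * (tprob w b' y - common w b' x y) /
   `|1 - common_mass w x y|)%R.

(** The coupling kernel as an operator. With values in [0, +oo] its series make sense for every
    nonnegative function, measurable or not. *)
Definition couple w (F : NN * NN -> \bar R) (z : NN * NN) : \bar R :=
  \sum_(b <oo) ((common w b z.1 z.2)%:E * F (push b z.1, push b z.2) +
    \sum_(b' <oo) (residual w b b' z.1 z.2)%:E * F (push b z.1, push b' z.2)).

Lemma common_ge0 w b x y : (0 <= common w b x y)%R.
Proof. by rewrite /common; case: ifP => // _; rewrite le_min !tprob_ge0. Qed.

Lemma common_lel w b x y : (common w b x y <= tprob w b x)%R.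
Proof. by rewrite /common; case: ifP => _; rewrite ?tprob_ge0// ge_min lexx. Qed.

Lemma common_ler w b x y : (common w b x y <= tprob w b y)%R.
Proof. by rewrite /common; case: ifP => _; rewrite ?tprob_ge0// ge_min lexx orbT. Qed.

Lemma residual_ge0 w b b' x y : (0 <= residual w b b' x y)%R.
Proof.
by rewrite /residual divr_ge0// mulr_ge0// subr_ge0 ?common_lel// common_ler.
Qed.

Lemma common_off w b x y :
  ~ (fibre S (thV w) (push b x) /\ fibre S (thV w) (push b y)) -> common w b x y = 0%R.
Proof.
move=> nf; apply/eqP; rewrite eq_le common_ge0 andbT.
have [fx|fx] := pselect (fibre S (thV w) (push b x)).
  by apply: (le_trans (common_ler _ _ _ _)); rewrite tprob_off// => fy; exact: nf.
by apply: (le_trans (common_lel _ _ _ _)); rewrite tprob_off.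
Qed.

Lemma residual_off w b b' x y :
  ~ (fibre S (thV w) (push b x) /\ fibre S (thV w) (push b' y)) ->
  residual w b b' x y = 0%R.
Proof.
move=> nf; rewrite /residual; have [fx|fx] := pselect (fibre S (thV w) (push b x)).
  rewrite (@tprob_off w b') ?(@common_off w b') ?subrr ?mulr0 ?mul0r//.
    by case=> _ fy; exact: nf.
  by move=> fy; exact: nf.
by rewrite (@tprob_off w b)// (@common_off w b) ?subrr ?mul0r// => -[].
Qed.

Lemma transfer_ge0 w F x : (forall x, 0 <= F x) -> 0 <= transfer w F x.
Proof. by move=> F0; apply: nneseries_ge0 => b _ _; rewrite mule_ge0// lee_fin tprob_ge0. Qed.

Lemma couple_ge0 w F z : (forall z, 0 <= F z) -> 0 <= couple w F z.
Proof.
move=> F0; apply: nneseries_ge0 => b _ _; rewrite adde_ge0//.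
  by rewrite mule_ge0// lee_fin common_ge0.
by apply: nneseries_ge0 => b' _ _; rewrite mule_ge0// lee_fin residual_ge0.
Qed.

Lemma le_transfer w F G x : (forall x, 0 <= F x) ->
  (forall x, fibre S (thV w) x -> F x <= G x) -> transfer w F x <= transfer w G x.
Proof.
move=> F0 FG; apply: lee_nneseries => [b _ _|b _].
  by rewrite mule_ge0// lee_fin tprob_ge0.
have [fb|fb] := pselect (fibre S (thV w) (push b x)).
  by rewrite lee_wpmul2l ?lee_fin ?tprob_ge0//; exact: FG.
by rewrite tprob_off// !mul0e.
Qed.

Lemma le_couple w F G z : (forall z, 0 <= F z) ->
  (forall z, fibre S (thV w) z.1 -> fibre S (thV w) z.2 -> F z <= G z) ->
  couple w F z <= couple w G z.
Proof.
move=> F0 FG; apply: lee_nneseries => [b _ _|b _].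
  rewrite adde_ge0//; first by rewrite mule_ge0// lee_fin common_ge0.
  by apply: nneseries_ge0 => b' _ _; rewrite mule_ge0// lee_fin residual_ge0.
apply: leeD.
  have [[f1 f2]|fb] := pselect (fibre S (thV w) (push b z.1) /\ fibre S (thV w) (push b z.2)).
    by rewrite lee_wpmul2l ?lee_fin ?common_ge0//; exact: FG.
  by rewrite common_off// !mul0e.
apply: lee_nneseries => [b' _ _|b' _].
  by rewrite mule_ge0// lee_fin residual_ge0.
have [[f1 f2]|fb] := pselect (fibre S (thV w) (push b z.1) /\ fibre S (thV w) (push b' z.2)).
  by rewrite lee_wpmul2l ?lee_fin ?residual_ge0//; exact: FG.
by rewrite residual_off// !mul0e.
Qed.

Lemma coupleD w F G z : (forall z, 0 <= F z) -> (forall z, 0 <= G z) ->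
  couple w (F \+ G) z = couple w F z + couple w G z.
Proof.
move=> F0 G0; rewrite /couple -nneseriesD; last 2 first.
- move=> b _ _; rewrite adde_ge0//; first by rewrite mule_ge0// lee_fin common_ge0.
  by apply: nneseries_ge0 => b' _ _; rewrite mule_ge0// lee_fin residual_ge0.
- move=> b _ _; rewrite adde_ge0//; first by rewrite mule_ge0// lee_fin common_ge0.
  by apply: nneseries_ge0 => b' _ _; rewrite mule_ge0// lee_fin residual_ge0.
apply: eq_eseriesr => b _ /=; rewrite addeACA -nneseriesD; last 2 first.
- by move=> b' _ _; rewrite mule_ge0// lee_fin residual_ge0.
- by move=> b' _ _; rewrite mule_ge0// lee_fin residual_ge0.
rewrite ge0_muleDr//; congr (_ + _); apply: eq_eseriesr => b' _ /=.
by rewrite ge0_muleDr.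
Qed.

Lemma coupleZ w (k : R) F z : (0 <= k)%R -> (forall z, 0 <= F z) ->
  couple w (fun z => k%:E * F z) z = k%:E * couple w F z.
Proof.
move=> k0 F0; rewrite /couple -nneseriesZl; last first.
  move=> b _; rewrite adde_ge0//; first by rewrite mule_ge0// lee_fin common_ge0.
  by apply: nneseries_ge0 => b' _ _; rewrite mule_ge0// lee_fin residual_ge0.
apply: eq_eseriesr => b _; rewrite ge0_muleDr; last 2 first.
- by rewrite mule_ge0// lee_fin common_ge0.
- by apply: nneseries_ge0 => b' _ _; rewrite mule_ge0// lee_fin residual_ge0.
rewrite muleCA; congr (_ + _); rewrite -nneseriesZl; last first.
  by move=> b' _; rewrite mule_ge0// lee_fin residual_ge0.
by apply: eq_eseriesr => b' _; rewrite muleCA.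
Qed.

Lemma coupleE w F z : (forall z, 0 <= F z) -> couple w F z =
  \sum_(b <oo) (common w b z.1 z.2)%:E * F (push b z.1, push b z.2) +
  \sum_(b <oo) \sum_(b' <oo) (residual w b b' z.1 z.2)%:E * F (push b z.1, push b' z.2).
Proof.
move=> F0; rewrite /couple nneseriesD// => b _ _.
  by rewrite mule_ge0// lee_fin common_ge0.
by apply: nneseries_ge0 => b' _ _; rewrite mule_ge0// lee_fin residual_ge0.
Qed.

Lemma transferZ w (k : R) F x : (forall x, 0 <= F x) ->
  transfer w (fun x => k%:E * F x) x = k%:E * transfer w F x.
Proof.
move=> F0; rewrite /transfer -nneseriesZl; last first.
  by move=> b _; rewrite mule_ge0// lee_fin tprob_ge0.
by apply: eq_eseriesr => b _; rewrite muleCA.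
Qed.

End one_step.

(** * Marginals of the coupling for normalized weights *)

Section normalized_step.
Context (R : realType) (d : measure_display) (Omega : measurableType d)
  (P : probability Omega R) (S : random_tmc P) (phi : Omega * NN -> R).
Variable w : Omega.
Implicit Types (x y : NN) (b : nat).
Local Notation thV := (thetaV S).
Local Notation tprob := (tprob S phi).
Local Notation common := (common S phi).
Local Notation residual := (residual S phi).
Local Notation common_mass := (common_mass S phi).
Local Notation transfer := (transfer S phi).
Local Notation couple := (couple S phi).

Definition normalized_at v := forall x, fibre S v x -> transfer v (cst 1) x = 1.

Hypothesis Nw : normalized_at w.

Lemma sum_tprob x : fibre S w x -> \sum_(b <oo) (tprob w b x)%:E = 1.
Proof.
by move=> fx; rewrite -(Nw fx); apply: eq_eseriesr => b _; rewrite mule1.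
Qed.

Lemma sum_common x y : fibre S w x ->
  \sum_(b <oo) (common w b x y)%:E = (common_mass w x y)%:E.
Proof.
move=> fx; rewrite /common_mass fineK// ge0_fin_numE; last first.
  by apply: nneseries_ge0 => b _ _; rewrite lee_fin common_ge0.
apply: (@le_lt_trans _ _ 1); last exact: ltry.
rewrite -(sum_tprob fx); apply: lee_nneseries => b => [_ _|_].
  by rewrite lee_fin common_ge0.
by rewrite lee_fin common_lel.
Qed.

Lemma common_mass_le1 x y : fibre S w x -> (common_mass w x y <= 1)%R.
Proof.
move=> fx; rewrite -lee_fin -sum_common// -(sum_tprob fx).
apply: lee_nneseries => b => [_ _|_]; first by rewrite lee_fin common_ge0.
by rewrite lee_fin common_lel.
Qed.

Lemma commonC b x y : common w b x y = common w b y x.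
Proof. by rewrite /common eq_sym minC. Qed.

Lemma common_massC x y : common_mass w x y = common_mass w y x.
Proof.
by rewrite /common_mass; congr fine; apply: eq_eseriesr => b _; rewrite commonC.
Qed.

Lemma residualC b b' x y : residual w b b' x y = residual w b' b y x.
Proof.
rewrite /residual common_massC (commonC b) (commonC b').
by rewrite [X in (X / _)%R]mulrC.
Qed.

Lemma sum_tprobB x y : fibre S w x ->
  \sum_(b <oo) (tprob w b x - common w b x y)%:E = (1 - common_mass w x y)%:E.
Proof.
move=> fx; rewrite EFinB -(sum_tprob fx) -sum_common//; apply/esym.
rewrite [X in X - _](_ : _ = \sum_(b <oo) (tprob w b x - common w b x y)%:E +
    \sum_(b <oo) (common w b x y)%:E).
  by rewrite sum_common// addeK.
rewrite -nneseriesD; last 2 first.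
- by move=> b _ _; rewrite lee_fin subr_ge0 common_lel.
- by move=> b _ _; rewrite lee_fin common_ge0.
by apply: eq_eseriesr => b _; rewrite -EFinD subrK.
Qed.

(* When [common_mass = 1] the division is by zero, but then all excess
   probabilities vanish as well. *)
Lemma sum_residual b x y : fibre S w x -> fibre S w y ->
  \sum_(b' <oo) (residual w b b' x y)%:E = (tprob w b x - common w b x y)%:E.
Proof.
move=> fx fy.
have D0 z z' b' : (0 <= tprob w b' z - common w b' z z')%R.
  by rewrite subr_ge0 common_lel.
have M1 : (0 <= 1 - common_mass w x y)%R by rewrite subr_ge0 common_mass_le1.
have -> : \sum_(b' <oo) (residual w b b' x y)%:E =
   ((tprob w b x - common w b x y) / `|1 - common_mass w x y|)%:E *
   \sum_(b' <oo) (tprob w b' y - common w b' y x)%:E.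
  rewrite -nneseriesZl; last by move=> b' _; rewrite lee_fin.
  by apply: eq_eseriesr => b' _; rewrite -EFinM /residual (commonC b') mulrAC.
rewrite sum_tprobB// (common_massC y) -EFinM ger0_norm//; congr EFin.
have [M0|M0] := eqVneq (1 - common_mass w x y)%R 0%R; last by rewrite divfK.
rewrite M0 mulr0; apply/esym/eqP; rewrite eq_le D0 andbT -lee_fin.
have <- : \sum_(b <oo) (tprob w b x - common w b x y)%:E = 0%:E.
  by rewrite sum_tprobB// M0.
rewrite (@nneseriesD1 _ _ b)// ?leeDl//; first by apply: nneseries_ge0 => *; rewrite lee_fin.
by move=> k _; rewrite lee_fin.
Qed.

Lemma couple_fst F x y : (forall x, 0 <= F x) -> fibre S w x -> fibre S w y ->
  couple w (fun z => F z.1) (x, y) = transfer w F x.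
Proof.
move=> F0 fx fy; apply: eq_eseriesr => b _ /=.
have -> : \sum_(b' <oo) (residual w b b' x y)%:E * F (push b x) =
    (tprob w b x - common w b x y)%:E * F (push b x).
  (* The value [+oo] cannot be pulled out of the series by linearity; there both sides are 0 or
     [+oo] according to whether the excess probability of [b] vanishes. *)
  case: (F (push b x)) (F0 (push b x)) => [c c0| _|//]; last first.
    have [z|nz] := eqVneq (tprob w b x - common w b x y)%R 0%R.
      rewrite z mul0e eseries0// => b' _ _.
      by rewrite /residual z !mul0r mul0e.
    have pos : (0 < tprob w b x - common w b x y)%R.
      by rewrite lt_neqAle eq_sym nz subr_ge0 common_lel.
    rewrite [RHS]gt0_muley ?lte_fin//.
    have [b' rb'] : exists b', (0 < residual w b b' x y)%R.
      apply: contrapT => /forallNP nr; move: pos; rewrite -lte_fin -(sum_residual b fx fy).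
      rewrite eseries0 ?ltxx// => b' _ _; apply/eqP; rewrite eqe eq_le residual_ge0 andbT leNgt.
      exact/negP/nr.
    apply: (@nneseries_pinfty _ _ _ b') => // [k _|].
      by rewrite mule_ge0// lee_fin residual_ge0.
    by rewrite gt0_muley ?lte_fin.
  rewrite muleC -(sum_residual b fx fy) -nneseriesZl; last first.
    by move=> b' _; rewrite lee_fin residual_ge0.
  by apply: eq_eseriesr => b' _; rewrite muleC.
rewrite -ge0_muleDl ?lee_fin ?common_ge0 ?subr_ge0 ?common_lel//.
by rewrite -EFinD addrC subrK.
Qed.

(** The residual is symmetric under exchanging points together with letters, so only the order of
    the double series changes. The second marginal follows from the first in this way. *)
Lemma couple_swap F x y : (forall z, 0 <= F z) ->
  couple w F (x, y) = couple w (fun z => F (z.2, z.1)) (y, x).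
Proof.
move=> F0.
rewrite (coupleE _ _ _ _ F0) coupleE; last by move=> z; exact: F0.
refine (f_equal2 (fun a c => a + c) _ _) => /=.
  by apply: eq_eseriesr => b _ /=; rewrite commonC.
have res0 b b' : 0 <= (residual w b b' x y)%:E * F (push b x, push b' y).
  by rewrite mule_ge0// lee_fin residual_ge0.
refine (etrans (nneseries_interchange xpredT xpredT res0) _).
apply: eq_eseriesr => b _; apply: eq_eseriesr => b' _ /=.
by rewrite residualC.
Qed.

Lemma couple_snd F x y : (forall x, 0 <= F x) -> fibre S w x -> fibre S w y ->
  couple w (fun z => F z.2) (x, y) = transfer w F y.
Proof. by move=> F0 fx fy; rewrite couple_swap// couple_fst. Qed.

Lemma transfer1 x : fibre S w x -> transfer w (cst 1) x = 1.
Proof. exact: Nw. Qed.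

Lemma couple1 x y : fibre S w x -> fibre S w y -> couple w (cst 1) (x, y) = 1.
Proof. by move=> fx fy; rewrite (couple_fst (F := cst 1))// transfer1. Qed.

(** Off the fibres the kernel has mass 0 rather than 1. It is thus a subprobability kernel on the
    whole product space, as the Giry bind in [couple_measure] requires. *)
Lemma couple_off F z : ~ (fibre S w z.1 /\ fibre S w z.2) -> couple w F z = 0.
Proof.
move=> nf; have off b b' : ~ (fibre S (thV w) (push b z.1) /\ fibre S (thV w) (push b' z.2)).
  by move=> [/fibre_push[_ f1] /fibre_push[_ f2]]; exact: nf.
rewrite /couple eseries0// => b _ _; rewrite common_off// mul0e add0e.
by rewrite eseries0// => b' _ _; rewrite residual_off// mul0e.
Qed.

Lemma couple_ge_common F x y : (forall z, 0 <= F z) ->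
  \sum_(b <oo) (common w b x y)%:E * F (push b x, push b y) <= couple w F (x, y).
Proof.
move=> F0; apply: lee_nneseries => b _ => [_|]; first by rewrite mule_ge0// lee_fin common_ge0.
by rewrite leeDl//; apply: nneseries_ge0 => b' _ _; rewrite mule_ge0// lee_fin residual_ge0.
Qed.

(** With different first letters nothing is common, so the residual weights are products and the
    double series factors. The bounds by 1 keep the factors finite, so that they can be moved
    through the series. *)
Lemma couple_ge_product F G G' x y : (forall z, 0 <= F z) ->
  (forall x, 0 <= G x) -> (forall x, 0 <= G' x) ->
  fibre S w x -> fibre S w y -> x 0%N != y 0%N ->
  (forall x, fibre S (thV w) x -> G x <= 1) -> (forall x, fibre S (thV w) x -> G' x <= 1) ->
  (forall x y, fibre S (thV w) x -> fibre S (thV w) y -> G x * G' y <= F (x, y)) ->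
  transfer w G x * transfer w G' y <= couple w F (x, y).
Proof.
move=> F0 G0 G'0 fx fy xy G1 G'1 GF.
have c0 b : common w b x y = 0%R by rewrite /common (negbTE xy).
have m0 : common_mass w x y = 0%R.
  by rewrite /common_mass eseries0// => b _ _; rewrite c0.
have tG' : transfer w G' y \is a fin_num.
  rewrite ge0_fin_numE ?transfer_ge0//; apply: (@le_lt_trans _ _ 1); last exact: ltry.
  by rewrite -(Nw fy); apply: le_transfer.
rewrite -(fineK tG') muleC -nneseriesZl; last first.
  by move=> b _; rewrite mule_ge0// lee_fin tprob_ge0.
apply: lee_nneseries => b _ => [_|].
  by rewrite mule_ge0 ?fine_ge0 ?transfer_ge0// ?lee_fin ?fine_ge0 ?transfer_ge0// mule_ge0// lee_fin tprob_ge0.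
rewrite fineK// c0 mul0e add0e /=.
have [fb|fb] := pselect (fibre S (thV w) (push b x)); last first.
  rewrite tprob_off// mul0e mule0; apply: nneseries_ge0 => b' _ _.
  by rewrite mule_ge0// lee_fin residual_ge0.
have Gb : G (push b x) \is a fin_num.
  by rewrite ge0_fin_numE//; apply: (le_lt_trans (G1 _ fb)); exact: ltry.
rewrite -(fineK Gb) -EFinM muleC -nneseriesZl; last first.
  by move=> b' _; rewrite mule_ge0// lee_fin tprob_ge0.
apply: lee_nneseries => b' _ => [_|].
  by rewrite mule_ge0// ?mule_ge0// ?lee_fin ?mulr_ge0 ?tprob_ge0 ?fine_ge0.
have [fb'|fb'] := pselect (fibre S (thV w) (push b' y)); last first.
  by rewrite (tprob_off _ fb') mul0e mule0 mule_ge0// lee_fin residual_ge0.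
rewrite /residual !c0 m0 !subr0 normr1 divr1 !EFinM fineK//.
rewrite muleACA lee_wpmul2l ?mule_ge0 ?lee_fin ?tprob_ge0//.
exact: GF.
Qed.

End normalized_step.

(** * Iterated couplings and contraction *)

Section iterates.
Context (R : realType) (d : measure_display) (Omega : measurableType d)
  (P : probability Omega R) (S : random_tmc P) (phi : Omega * NN -> R).
Variables (r : R) (kappa s : Omega -> R) (A : set Omega).
Implicit Types (w : Omega) (x y : NN) (b : nat).
Local Notation thV := (thetaV S).
Local Notation tprob := (tprob S phi).
Local Notation common := (common S phi).
Local Notation transfer := (transfer S phi).
Local Notation couple := (couple S phi).

Fixpoint transfer_iter n w (F : NN -> \bar R) : NN -> \bar R :=
  if n is n'.+1 then transfer w (transfer_iter n' (thV w) F) else F.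

Fixpoint couple_iter n w (F : NN * NN -> \bar R) : NN * NN -> \bar R :=
  if n is n'.+1 then couple w (couple_iter n' (thV w) F) else F.

Lemma transfer_iter_ge0 n w F x : (forall x, 0 <= F x) -> 0 <= transfer_iter n w F x.
Proof. by elim: n w x => [|n IH] w x F0 //=; apply: transfer_ge0 => y; exact: IH. Qed.

Lemma couple_iter_ge0 n w F z : (forall z, 0 <= F z) -> 0 <= couple_iter n w F z.
Proof. by elim: n w z => [|n IH] w z F0 //=; apply: couple_ge0 => y; exact: IH. Qed.

Lemma couple_iterD n m w F :
  couple_iter (n + m) w F = couple_iter n w (couple_iter m (iter n thV w) F).
Proof. by elim: n w => [//|n IH] w; rewrite addSn /= IH -iterSr. Qed.

Lemma le_couple_iter n w F G z : (forall z, 0 <= F z) ->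
  (forall z, fibre S (iter n thV w) z.1 -> fibre S (iter n thV w) z.2 -> F z <= G z) ->
  fibre S w z.1 -> fibre S w z.2 ->
  couple_iter n w F z <= couple_iter n w G z.
Proof.
elim: n w z => [|n IH] w z F0 FG f1 f2 /=; first exact: FG.
apply: le_couple => [z'|z' g1 g2]; first exact: couple_iter_ge0.
by apply: IH => // z''; rewrite -iterSr; exact: FG.
Qed.

Lemma couple_iter_add n w F G z : (forall z, 0 <= F z) -> (forall z, 0 <= G z) ->
  couple_iter n w (F \+ G) z = couple_iter n w F z + couple_iter n w G z.
Proof.
elim: n w z => [//|n IH] w z F0 G0 /=.
rewrite -coupleD; last 2 first.
- by move=> ?; exact: couple_iter_ge0.
- by move=> ?; exact: couple_iter_ge0.
by congr (couple w _ z); apply/funext => z1 /=; exact: IH.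
Qed.

Lemma couple_iterZ n w (k : R) F z : (0 <= k)%R -> (forall z, 0 <= F z) ->
  couple_iter n w (fun z => k%:E * F z) z = k%:E * couple_iter n w F z.
Proof.
elim: n w z => [//|n IH] w z k0 F0 /=.
rewrite -coupleZ//; last by move=> ?; exact: couple_iter_ge0.
by congr (couple w _ z); apply/funext => z1 /=; exact: IH.
Qed.

Hypothesis r01 : (0 < r < 1)%R.
Hypothesis A_thV : forall w, A w -> A (thV w).
Hypothesis A_norm : forall w, A w -> normalized_at S phi w.
Hypothesis A_hoelder : forall w, A w -> forall n x y, (2 <= n)%N ->
  fibre S (thV w) x -> fibre S (thV w) y -> (forall i, (i < n)%N -> x i = y i) ->
  (`|phi (thV w, x) - phi (thV w, y)| <= kappa (thV w) * r ^+ n)%R.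
Hypothesis s_ge0 : forall w, (0 <= s w)%R.
Hypothesis kappa_ge0 : forall w, (0 <= kappa w)%R.
Hypothesis A_sum : forall w, A w -> s w = (kappa (thV w) * r + r * s (thV w))%R.

Local Notation dist := (word_dist r).

Let r_ge0 : (0 <= r)%R. Proof. by case/andP: r01 => /ltW. Qed.
Let r_le1 : (r <= 1)%R. Proof. by case/andP: r01 => _ /ltW. Qed.
Let dist0 x y : (0 <= dist x y)%R. Proof. exact: word_dist_ge0. Qed.

Lemma couple_iter1 n w x y : A w -> fibre S w x -> fibre S w y ->
  couple_iter n w (cst 1) (x, y) = 1.
Proof.
elim: n w x y => [//|n IH] w x y Aw fx fy /=.
(* The inner iterate is known only on the fibres, which is where [le_couple] compares; hence two
   inequalities instead of a rewriting. *)
rewrite -[RHS](couple1 (A_norm Aw) fx fy); apply/eqP; rewrite eq_le.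
apply/andP; split; apply: le_couple => //.
- by move=> z; exact: couple_iter_ge0.
- by case=> u v fu fv; rewrite (IH _ _ _ (A_thV Aw) fu fv).
- by case=> u v fu fv; rewrite (IH _ _ _ (A_thV Aw) fu fv).
Qed.

Lemma transfer_iter_le1 n w F x : A w -> (forall x, 0 <= F x) -> (forall x, F x <= 1) ->
  fibre S w x -> transfer_iter n w F x <= 1.
Proof.
elim: n w x => [|n IH] w x Aw F0 F1 fx /=; first exact: F1.
rewrite -(A_norm Aw fx); apply: le_transfer => [u|u fu].
  exact: transfer_iter_ge0.
by apply: IH => //; exact: A_thV.
Qed.

(** Points with a common head agree on [k >= 1] letters, hence on [k + 1 >= 2] letters after
    [push b]. So index 2 is enough, and [kappa r^(k+1)] is [kappa r d(x, y)]. *)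
Lemma hoelder_push w b x y : A w -> x 0%N = y 0%N ->
  fibre S (thV w) (push b x) -> fibre S (thV w) (push b y) ->
  (`|phi (thV w, push b x) - phi (thV w, push b y)| <= kappa (thV w) * r * dist x y)%R.
Proof.
move=> Aw xy0 fx fy; have [->|[[|k] [xy xyk ->]]] := word_dist_cases r x y => //.
  by rewrite subrr normr0 !mulr_ge0// word_dist_ge0.
by rewrite -mulrA -exprS; apply: A_hoelder => // -[|i]//=; exact: xy.
Qed.

Lemma common_ge w b x y : A w -> fibre S w x -> fibre S w y -> x 0%N = y 0%N ->
  (expR (- (kappa (thV w) * r * dist x y)) * tprob w b x <= common w b x y)%R.
Proof.
move=> Aw fx fy xy0; rewrite /common xy0 eqxx.
have [fbx|fbx] := pselect (fibre S (thV w) (push b x)); last first.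
  by rewrite tprob_off// mulr0 le_min lexx tprob_ge0.
have fby : fibre S (thV w) (push b y).
  by apply/fibre_push; split => //; rewrite -xy0; have /fibre_push[] := fbx.
rewrite !tprob_on// -expRD le_min !ler_expR.
have := hoelder_push Aw xy0 fbx fby; rewrite ler_distl => /andP[h1 h2].
have c0 : (0 <= kappa (thV w) * r * dist x y)%R by rewrite !mulr_ge0.
by apply/andP; split; lra.
Qed.

(** Bounded distortion. Branches with the same letter are compared: a step costs
    [kappa (thV w) * r * dist x y] in the exponent and multiplies the distance by [r]; by [A_sum]
    these costs add up to [s w * dist x y]. *)
Lemma transfer_iter_head n w F x y : A w -> fibre S w x -> fibre S w y ->
  x 0%N = y 0%N -> (forall x, 0 <= F x) ->
  (forall x y, x 0%N = y 0%N -> F x = F y) ->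
  (expR (- (s w * dist x y)))%:E * transfer_iter n w F x <= transfer_iter n w F y.
Proof.
elim: n w x y => [|n IH] w x y Aw fx fy xy0 F0 FE /=.
  rewrite (FE x y)// -[leRHS]mul1e lee_wpmul2r// lee_fin.
  by rewrite -expR0 ler_expR oppr_le0 mulr_ge0.
rewrite /transfer -nneseriesZl; last first.
  by move=> b _; rewrite mule_ge0 ?lee_fin ?tprob_ge0//; exact: transfer_iter_ge0.
apply: lee_nneseries => b _ => [_|].
  by rewrite !mule_ge0 ?lee_fin ?expR_ge0 ?tprob_ge0//; exact: transfer_iter_ge0.
have [fbx|fbx] := pselect (fibre S (thV w) (push b x)); last first.
  rewrite tprob_off// mul0e mule0 mule_ge0 ?lee_fin ?tprob_ge0//.
  exact: transfer_iter_ge0.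
have fby : fibre S (thV w) (push b y).
  by apply/fibre_push; split => //; rewrite -xy0; have /fibre_push[] := fbx.
have IHb := IH (thV w) (push b x) (push b y) (A_thV Aw) fbx fby erefl F0 FE.
have le1 := le_trans (common_ge b Aw fx fy xy0) (common_ler S phi w b x y).
apply: (le_trans _ (lee_wpmul2l _ IHb)); last by rewrite lee_fin tprob_ge0.
rewrite word_dist_push// !muleA -!EFinM.
apply: lee_wpmul2r; first exact: transfer_iter_ge0.
rewrite lee_fin; apply: (le_trans _ (ler_wpM2r (expR_ge0 _) le1)).
rewrite mulrAC -expRD (A_sum Aw).
by rewrite (_ : (- _ = - (kappa (thV w) * r * dist x y) - s (thV w) * (r * dist x y))%R)//; ring.
Qed.

Variable beta : R.
Hypothesis beta_ge1 : (1 <= beta)%R.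

Definition trunc_dist (z : NN * NN) : \bar R :=
  (Num.min 1 (beta * dist z.1 z.2))%:E.

(** This is [1 - trunc_dist]. Contraction is proved as a lower bound for it, because a lower bound
    persists when the residual part of the coupling is dropped or only one favourable event is
    kept. *)
Definition trunc_close (z : NN * NN) : \bar R :=
  (Num.max 0 (1 - beta * dist z.1 z.2))%:E.

Let beta_ge0 : (0 <= beta)%R. Proof. exact: le_trans beta_ge1. Qed.

Lemma trunc_dist_ge0 z : 0 <= trunc_dist z.
Proof. by rewrite lee_fin le_min ler01 mulr_ge0. Qed.

Lemma trunc_close_ge0 z : 0 <= trunc_close z.
Proof. by rewrite lee_fin le_max lexx. Qed.

Lemma couple_iter_trunc_dist n w x y : A w -> fibre S w x -> fibre S w y ->
  couple_iter n w trunc_dist (x, y) = 1 - couple_iter n w trunc_close (x, y).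
Proof.
move=> Aw fx fy; have H1 : couple_iter n w trunc_close (x, y) <= 1.
  rewrite -(couple_iter1 n Aw fx fy); apply: le_couple_iter => // [z|z _ _].
    exact: trunc_close_ge0.
  by rewrite lee_fin ge_max ler01/= gerBl mulr_ge0.
have <- : couple_iter n w trunc_dist (x, y) + couple_iter n w trunc_close (x, y) = 1.
  rewrite -couple_iter_add; [|exact: trunc_dist_ge0|exact: trunc_close_ge0].
  rewrite -(couple_iter1 n Aw fx fy); congr (couple_iter n w _ _).
  apply/funext => z /=; rewrite -EFinD; congr EFin.
  by case: (lerP 1 (beta * dist z.1 z.2)) => h; case: lerP => h' ; lra.
rewrite addeK// ge0_fin_numE; last exact: couple_iter_ge0 trunc_close_ge0.
by apply: (le_lt_trans H1); exact: ltry.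
Qed.

(** Only the diagonal part is kept: the letters stay equal for [n] steps with probability at least
    [expR (- (s w * dist x y))], by the telescoping of [transfer_iter_head], and the distance is
    then [r ^+ n * dist x y]. *)
Lemma couple_iter_close n w x y : A w -> fibre S w x -> fibre S w y ->
  x 0%N = y 0%N ->
  (expR (- (s w * dist x y)) * Num.max 0 (1 - beta * r ^+ n * dist x y))%:E <=
  couple_iter n w trunc_close (x, y).
Proof.
elim: n w x y => [|n IH] w x y Aw fx fy xy0.
  rewrite expr0 mulr1 lee_fin ler_piMl ?le_max ?lexx//.
  by rewrite -expR0 ler_expR oppr_le0 mulr_ge0.
apply: (le_trans _ (couple_ge_common S phi w x y (fun z => couple_iter_ge0 n (thV w) z trunc_close_ge0))).
set M := Num.max _ _; have M0 : (0 <= M)%R by rewrite le_max lexx.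
rewrite -[leLHS]mule1 -(sum_tprob (A_norm Aw) fx) -nneseriesZl; last first.
  by move=> b _; rewrite lee_fin tprob_ge0.
apply: lee_nneseries => b _ => [_|].
  by rewrite mule_ge0 ?lee_fin ?tprob_ge0// mulr_ge0// expR_ge0.
have [fbx|fbx] := pselect (fibre S (thV w) (push b x)); last first.
  rewrite tprob_off// mule0 mule_ge0 ?lee_fin ?common_ge0//.
  exact: couple_iter_ge0 trunc_close_ge0.
have fby : fibre S (thV w) (push b y).
  by apply/fibre_push; split => //; rewrite -xy0; have /fibre_push[] := fbx.
have IHb := IH (thV w) (push b x) (push b y) (A_thV Aw) fbx fby erefl.
apply: (le_trans _ (lee_wpmul2l _ IHb)); last by rewrite lee_fin common_ge0.
rewrite word_dist_push// -!EFinM lee_fin.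
rewrite (_ : beta * r ^+ n * (r * dist x y) = beta * r ^+ n.+1 * dist x y)%R; last first.
  by rewrite exprS; ring.
rewrite -/M mulrAC [leRHS]mulrA; apply: ler_wpM2r => //.
apply: (le_trans _ (ler_wpM2r (expR_ge0 _) (common_ge b Aw fx fy xy0))).
rewrite [leRHS]mulrAC -expRD (A_sum Aw).
by rewrite (_ : (- _ = - (kappa (thV w) * r * dist x y) - s (thV w) * (r * dist x y))%R)//; ring.
Qed.

Lemma s_thV w : A w -> (s (thV w) <= s w / r)%R.
Proof.
move=> Aw; rewrite ler_pdivlMr; last by case/andP: r01.
by rewrite (A_sum Aw) mulrC lerDr mulr_ge0.
Qed.

(** While the heads differ the points move independently, so the probabilities of showing [c] at
    time [N] multiply, and two points showing [c] share the head. A pair that meets earlier is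
    handed over to [couple_iter_close]. Each step may enlarge [s] by the factor [1 / r] ([s_thV]),
    whence the exponent. *)
Lemma couple_iter_far N n w c x y : A w -> fibre S w x -> fibre S w y ->
  (expR (- (s w / r ^+ N)) * Num.max 0 (1 - beta * r ^+ n))%:E *
    (transfer_iter N w (fun x => (\1_[set z : NN | z 0%N = c] x)%:E) x *
     transfer_iter N w (fun x => (\1_[set z : NN | z 0%N = c] x)%:E) y) <=
  couple_iter (N + n) w trunc_close (x, y).
Proof.
set F := (fun x : NN => _).
have F0 u : 0 <= F u by rewrite lee_fin.
have F1 u : F u <= 1 by rewrite lee_fin indicE; case: (_ \in _).
have r0 : (0 < r)%R by case/andP: r01.
have M0 : (0 <= Num.max 0 (1 - beta * r ^+ n))%R by rewrite le_max lexx.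
have M1 : (Num.max 0 (1 - beta * r ^+ n) <= 1)%R.
  by rewrite ge_max ler01/= gerBl mulr_ge0 ?exprn_ge0.
have T01 N' w' u : A w' -> fibre S w' u -> 0 <= transfer_iter N' w' F u <= 1.
  by move=> Aw' fu; rewrite transfer_iter_ge0//= transfer_iter_le1.
(* The pair has already met: at least [n] steps remain, and the probabilities [a] and [b] are
   bounded by 1. *)
have same_head N' m w' u v (a b : \bar R) : A w' -> fibre S w' u -> fibre S w' v ->
    u 0%N = v 0%N -> (n <= m)%N -> 0 <= a <= 1 -> 0 <= b <= 1 ->
    (expR (- (s w' / r ^+ N')) * Num.max 0 (1 - beta * r ^+ n))%:E * (a * b) <=
    couple_iter m w' trunc_close (u, v).
  move=> Aw' fu fv uv0 nm /andP[a0 a1] /andP[b0 b1].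
  have d1 := word_dist_le1 r01 u v.
  apply: (le_trans _ (couple_iter_close _ Aw' fu fv uv0)).
  rewrite -[leRHS]mule1; apply: lee_pmul.
  - by rewrite lee_fin mulr_ge0// expR_ge0.
  - exact: mule_ge0.
  - rewrite lee_fin ler_pM ?expR_ge0//.
      rewrite ler_expR lerN2 ler_wpM2l// (le_trans d1)// invf_ge1 ?exprn_gt0//.
      by rewrite exprn_ile1.
    rewrite ge_max !le_max lexx/=; apply/orP; right.
    rewrite lerD2l lerN2 -mulrA ler_wpM2l// (le_trans (ler_piMr _ d1)) ?exprn_ge0//.
    by rewrite ler_wiXn2l.
  - by rewrite -[1]mule1 lee_pmul.
elim: N w x y => [|N IH] w x y Aw fx fy; have [xy0|xy0] := eqVneq (x 0%N) (y 0%N).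
- by apply: (same_head 0%N) => //; rewrite F0 F1.
- rewrite (_ : transfer_iter 0 w F x * _ = 0) ?mule0 ?couple_iter_ge0//; first exact: trunc_close_ge0.
  rewrite /= /F !indicE -EFinM; congr EFin.
  case: (boolP (x \in _)) => [|_]; last by rewrite mul0r.
  rewrite inE/= => x0; rewrite [y \in _](_ : _ = false) ?mulr0//.
  by apply/negbTE; rewrite notin_setE/= => y0; rewrite x0 y0 eqxx in xy0.
- by apply: (same_head N.+1) => //; [rewrite leq_addl|exact: (T01 N.+1)|exact: (T01 N.+1)].
set K := (expR _ * _)%R.
have K0 : (0 <= K)%R by rewrite mulr_ge0 ?expR_ge0.
have K1 : (K <= 1)%R.
  rewrite -[1%R]mulr1 ler_pM ?expR_ge0// -expR0 ler_expR oppr_le0.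
  by rewrite mulr_ge0// invr_ge0 exprn_ge0.
pose G := transfer_iter N (thV w) F.
have G0 u : 0 <= G u by exact: transfer_iter_ge0.
have G1 u : fibre S (thV w) u -> G u <= 1.
  by move=> fu; apply: transfer_iter_le1 => //; exact: A_thV.
rewrite muleA -transferZ//.
apply: (couple_ge_product (A_norm Aw)) => // [z|u|u fu|u v fu fv].
- exact: couple_iter_ge0 trunc_close_ge0.
- by rewrite mule_ge0// G0.
- by rewrite -[1]mule1 lee_pmul ?lee_fin// ?G0// G1.
rewrite -muleA; apply: (le_trans _ (IH _ _ _ (A_thV Aw) fu fv)).
apply: lee_wpmul2r; first by rewrite mule_ge0 ?G0.
rewrite lee_fin ler_wpM2r// ler_expR lerN2 exprS invfM mulrA ler_wpM2r ?invr_ge0 ?exprn_ge0//.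
exact: s_thV.
Qed.

End iterates.

(** * One contraction stage *)

Section stage.
Context (R : realType) (d : measure_display) (Omega : measurableType d)
  (P : probability Omega R) (S : random_tmc P) (phi : Omega * NN -> R).
Variables (r : R) (kappa s : Omega -> R) (A : set Omega).
Implicit Types (w : Omega) (x y : NN) (b : nat).
Local Notation thV := (thetaV S).
Hypothesis r01 : (0 < r < 1)%R.
Hypothesis A_thV : forall w, A w -> A (thV w).
Hypothesis A_norm : forall w, A w -> normalized_at S phi w.
Hypothesis A_hoelder : forall w, A w -> forall n x y, (2 <= n)%N ->
  fibre S (thV w) x -> fibre S (thV w) y -> (forall i, (i < n)%N -> x i = y i) ->
  (`|phi (thV w, x) - phi (thV w, y)| <= kappa (thV w) * r ^+ n)%R.
Hypothesis s_ge0 : forall w, (0 <= s w)%R.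
Hypothesis kappa_ge0 : forall w, (0 <= kappa w)%R.
Hypothesis A_sum : forall w, A w -> s w = (kappa (thV w) * r + r * s (thV w))%R.
Local Notation dist := (word_dist r).
Local Notation couple_iter := (couple_iter S phi).
Local Notation transfer_iter := (transfer_iter S phi).
Variable beta : R.
Hypothesis beta_ge1 : (1 <= beta)%R.
Local Notation trunc_dist := (trunc_dist r beta).
Local Notation trunc_close := (trunc_close r beta).

Let r_ge0 : (0 <= r)%R. Proof. by case/andP: r01 => /ltW. Qed.
Let r_le1 : (r <= 1)%R. Proof. by case/andP: r01 => _ /ltW. Qed.
Let beta_ge0 : (0 <= beta)%R. Proof. exact: le_trans beta_ge1. Qed.
Let dist0 x y : (0 <= dist x y)%R. Proof. exact: word_dist_ge0. Qed.

Lemma couple_iter_trunc_dist_le (c : R) n w x y : A w -> fibre S w x -> fibre S w y ->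
  c%:E <= couple_iter n w trunc_close (x, y) ->
  couple_iter n w trunc_dist (x, y) <= (1 - c)%:E.
Proof.
move=> Aw fx fy hc.
by rewrite (couple_iter_trunc_dist r01 A_thV A_norm beta_ge1)// EFinB leeB.
Qed.

Lemma couple_iter_le1 n w x y : A w -> fibre S w x -> fibre S w y ->
  couple_iter n w trunc_dist (x, y) <= 1.
Proof.
move=> Aw fx fy; rewrite -(subr0 1%R); apply: couple_iter_trunc_dist_le => //.
exact/couple_iter_ge0/trunc_close_ge0.
Qed.

(** Combines [couple_iter_close] with [1 - exp(-a) max(0, 1 - q) <= a + q], a consequence of
    [exp(-a) >= 1 - a]. *)
Lemma couple_iter_near n w x y : A w -> fibre S w x -> fibre S w y -> x 0%N = y 0%N ->
  couple_iter n w trunc_dist (x, y) <= ((s w + beta * r ^+ n) * dist x y)%:E.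
Proof.
move=> Aw fx fy xy0.
have H := couple_iter_close r01 A_thV A_norm A_hoelder s_ge0 kappa_ge0 A_sum beta n Aw fx fy xy0.
apply: (le_trans (couple_iter_trunc_dist_le Aw fx fy H)).
rewrite lee_fin; set a := (s w * _)%R; set q := (beta * _ * _)%R.
have -> : ((s w + beta * r ^+ n) * dist x y = a + q)%R by rewrite /a /q; ring.
have a0 : (0 <= a)%R by rewrite mulr_ge0.
have q0 : (0 <= q)%R by rewrite !mulr_ge0// exprn_ge0.
have e1 := expR_ge1Dx (- a)%R.
have e0 := expR_ge0 (- a)%R.
clear H xy0; have [h|h] := lerP q 1.
  by rewrite max_r ?subr_ge0//; nra.
by rewrite max_l ?subr_le0 ?(ltW h)//; nra.
Qed.

(** Here [expR (s w)] is [B_w]. A common head uses [1 + s <= exp s]; otherwise [dist x y = 1] and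
    the total mass 1 is already a sufficient bound. *)
Lemma couple_iter_start n w x y : A w -> fibre S w x -> fibre S w y ->
  couple_iter n w trunc_dist (x, y) <= (beta * expR (s w) * dist x y)%:E.
Proof.
move=> Aw fx fy; have e1 := expR_ge1Dx (s w); have s0 := s_ge0 w.
have [xy0|xy0] := eqVneq (x 0%N) (y 0%N).
  apply: (le_trans (couple_iter_near n Aw fx fy xy0)); rewrite lee_fin ler_wpM2r//.
  have b1 : (beta * r ^+ n <= beta)%R by rewrite ler_piMr// exprn_ile1.
  have b2 : (s w <= beta * s w)%R by rewrite ler_peMl.
  have b3 := ler_wpM2l beta_ge0 e1.
  by rewrite (le_trans _ b3)// mulrDr mulr1 addrC lerD.
apply: (le_trans (couple_iter_le1 n Aw fx fy)).
rewrite lee_fin word_dist_head// mulr1 -[leLHS]mulr1 ler_pM//.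
by rewrite (le_trans _ e1)// lerDl.
Qed.

(** Put [eta = rho^2 exp(- M / r^N)]. If the heads differ or [beta d >= 1], then [trunc_dist] is 1
    and closeness of at least [3 eta / 4] is gained. For a common head and [beta d < 1], the factor
    is governed by [s + beta r^n <= beta / 4 + 1 / 4 <= beta / 2], and [1 / 2 <= 1 - eta / 2]. The
    conditions on [beta] and [n0] come from these two estimates. *)
Lemma stage_contraction (M rho : R) (N n0 n c : nat) w x y :
  A w -> (s w <= M)%R -> (4 * M <= beta)%R -> (beta * r ^+ n0 <= 4^-1)%R ->
  (0 < rho <= 1)%R ->
  (forall x, fibre S w x ->
     rho%:E <= transfer_iter N w (fun x => (\1_[set z : NN | z 0%N = c] x)%:E) x) ->
  (N + n0 <= n)%N -> fibre S w x -> fibre S w y ->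
  couple_iter n w trunc_dist (x, y) <=
    (1 - rho ^+ 2 * expR (- (M / r ^+ N)) / 2)%:E * trunc_dist (x, y).
Proof.
move=> Aw sM Mbeta br /andP[rho0 rho1] Hrho Nn fx fy.
set E := expR _.
have r0 : (0 < r)%R by case/andP: r01.
have rN0 : (0 < r ^+ N)%R by rewrite exprn_gt0.
have M0 : (0 <= M)%R by exact: le_trans sM.
have E0 : (0 <= E)%R by exact: expR_ge0.
have E1 : (E <= 1)%R by rewrite -expR0 ler_expR oppr_le0 divr_ge0// ltW.
have rho2 : (0 <= rho ^+ 2 <= 1)%R by rewrite exprn_ge0 ?exprn_ile1// ltW.
have brn m : (n0 <= m)%N -> (beta * r ^+ m <= 4^-1)%R.
  move=> n0m; apply: le_trans br; rewrite ler_wpM2l//.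
  by apply: ler_wiXn2l.
have n0n : (n0 <= n)%N by exact: leq_trans (leq_addl _ _) Nn.
have eta2 : (rho ^+ 2 * E <= 1)%R by move/andP: rho2 => [? ?]; rewrite -[1%R]mulr1 ler_pM.
have d1 : (0 <= dist x y <= 1)%R by rewrite word_dist_ge0// word_dist_le1.
have [xy0|xy0] := eqVneq (x 0%N) (y 0%N).
  have [bd|bd] := lerP 1 (beta * dist x y).
    have H := couple_iter_close r01 A_thV A_norm A_hoelder s_ge0 kappa_ge0 A_sum beta n Aw fx fy xy0.
    apply: (le_trans (couple_iter_trunc_dist_le Aw fx fy H)); clear H xy0.
    rewrite /trunc_dist/= min_l// -EFinM lee_fin mulr1 lerD2l lerN2.
    have q : (beta * r ^+ n * dist x y <= 4^-1)%R.
      apply: le_trans (brn _ n0n); case/andP: d1 => _ d1.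
      by rewrite ler_piMr// mulr_ge0// exprn_ge0.
    rewrite max_r; last by lra.
    have Es : (E <= expR (- (s w * dist x y)))%R.
      rewrite ler_expR lerN2; case/andP: d1 => d0 d1.
      apply: (@le_trans _ _ M); first by rewrite -[leRHS]mulr1 ler_pM.
      by rewrite ler_pdivlMr// ler_piMr// exprn_ile1.
    rewrite ler_pM//; first by rewrite mulr_ge0// exprn_ge0// ltW.
      by apply: le_trans Es; case/andP: rho2 => _ r2; rewrite ler_piMl.
    by lra.
  apply: (le_trans (couple_iter_near n Aw fx fy xy0)).
  rewrite /trunc_dist/= min_r ?(ltW bd)// -EFinM lee_fin mulrA ler_wpM2r ?(proj1 (andP d1))//.
  clear xy0; have q := brn _ n0n.
  have eb : (rho ^+ 2 * E * beta <= beta)%R by rewrite ler_piMl.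
  have -> : ((1 - rho ^+ 2 * E / 2) * beta = beta - rho ^+ 2 * E * beta / 2)%R by field.
  have b1 := beta_ge1; move: q eb; set q1 := (beta * r ^+ n)%R; set q2 := (rho ^+ 2 * E * beta)%R => q eb.
  clearbody q1 q2. lra.
have TD : trunc_dist (x, y) = 1.
  by rewrite /trunc_dist/= word_dist_head// mulr1 min_l.
rewrite TD mule1; apply: couple_iter_trunc_dist_le => //.
have H := couple_iter_far r01 A_thV A_norm A_hoelder s_ge0 kappa_ge0 A_sum beta_ge1 N (n - N) c Aw fx fy.
rewrite subnKC ?(leq_trans (leq_addr _ _) Nn)// in H; apply: le_trans H => {TD}.
have nN : (n0 <= n - N)%N by rewrite leq_subRL ?(leq_trans (leq_addr _ _) Nn).
have q := brn _ nN.
apply: (@le_trans _ _ ((expR (- (s w / r ^+ N)) * Num.max 0 (1 - beta * r ^+ (n - N)))%:E * (rho%:E * rho%:E))).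
  rewrite -!EFinM lee_fin max_r; last by lra.
  have Es : (E <= expR (- (s w / r ^+ N)))%R by rewrite ler_expR lerN2 ler_pM2r// invr_gt0.
  have := sqr_ge0 rho; rewrite expr2 => rr.
  rewrite [leRHS]mulrC -mulrA ler_wpM2l//.
  by nra.
apply: lee_wpmul2l; first by rewrite lee_fin mulr_ge0 ?expR_ge0// le_max lexx.
by rewrite lee_pmul ?lee_fin ?(ltW rho0)//; apply: Hrho.
Qed.

End stage.

(** * From the coupled chain to the Ruelle operator *)

Section ruelle_link.
Context (R : realType) (d : measure_display) (Omega : measurableType d)
  (P : probability Omega R) (S : random_tmc P) (phi : Omega * NN -> R).
Implicit Types (w : Omega) (x y : NN) (b : nat) (g : NN -> R).
Local Notation thV := (thetaV S).
Local Notation transfer := (transfer S phi).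
Local Notation couple := (couple S phi).
Local Notation couple_iter := (couple_iter S phi).
Local Notation transfer_iter := (transfer_iter S phi).

Lemma eq_transfer w (F G : NN -> \bar R) x :
  (forall y, fibre S (thV w) y -> F y = G y) -> transfer w F x = transfer w G x.
Proof.
move=> FG; apply: eq_eseriesr => b _.
have [fb|fb] := pselect (fibre S (thV w) (push b x)); first by rewrite FG.
by rewrite tprob_off// !mul0e.
Qed.

Lemma transfer0 w x : transfer w (cst 0) x = 0.
Proof. by rewrite /transfer eseries0// => b _ _; rewrite mule0. Qed.

(** A preimage of [x] is determined by its first letter; reindexing turns the unordered sum into the
    series over letters. *)
Lemma esum_preimages w x g :
  \esum_(y in [set y | fibre S (thV w) y /\ Defs.shift y = x])
    (Num.max (expR (on_fibre phi (thV w) y) * g y) 0)%:E =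
  transfer w (fun y => (Num.max (g y) 0)%:E) x.
Proof.
have bij : set_bij [set b | fibre S (thV w) (push b x)]
    [set y | fibre S (thV w) y /\ Defs.shift y = x] (push^~ x).
  split => [b fb//|b b' _ _ /(congr1 (fun y : NN => y 0%N))//|y [fy <-]].
  by exists (y 0%N); rewrite /= push_shift.
rewrite (@reindex_esum R _ _ _ _ (push^~ x) _ bij) esum_mkcond.
rewrite /transfer nneseries_esumT; last first.
  by move=> b; rewrite mule_ge0// lee_fin ?tprob_ge0// le_max lexx orbT.
apply: eq_esum => b _; have [fb|fb] := pselect (fibre S (thV w) (push b x)).
  rewrite mem_set// tprob_on// -EFinM; congr EFin.
  by rewrite maxr_pMr ?expR_ge0// mulr0.
by rewrite memNset// tprob_off// mul0e.
Qed.

Lemma ruelleE w g x : ruelle S phi (thV w) g x =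
  (fine (transfer w (fun y => (Num.max (g y) 0)%:E) x) -
   fine (transfer w (fun y => (Num.max (- g y) 0)%:E) x))%R.
Proof.
rewrite /ruelle /set_sum esum_preimages; congr (_ - fine _)%R.
by rewrite -esum_preimages; apply: eq_esum => y _; rewrite mulrN.
Qed.

Lemma normalized_of_ruelle w :
  (forall x, fibre S w x -> ruelle S phi (thV w) (cst 1%R) x = 1%R) ->
  normalized_at S phi w.
Proof.
move=> L1 x fx; have := L1 x fx; rewrite ruelleE.
rewrite (_ : (fun y => (Num.max (cst 1%R y) 0)%:E) = cst 1); last first.
  by apply/funext => y /=; rewrite max_l.
rewrite (_ : (fun y => (Num.max (- cst 1%R y) 0)%:E) = cst 0); last first.
  by apply/funext => y /=; rewrite max_r// oppr_le0.
(* [fine] sends infinite values to 0, so the value 1 also shows that the series converges. *)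
rewrite transfer0 subr0; case: (transfer w (cst 1) x) => [a /= ->//| |] /= /esym/eqP;
  by rewrite oner_eq0.
Qed.

Section at_w.
Variable w : Omega.
Hypothesis Nw : normalized_at S phi w.

Lemma transfer_bound g (B : R) x : (0 <= B)%R -> fibre S w x ->
  (forall y, fibre S (thV w) y -> (`|g y| <= B)%R) ->
  exists2 a : R, transfer w (fun y => (Num.max (g y) 0)%:E) x = a%:E & (0 <= a <= B)%R.
Proof.
move=> B0 fx gB.
have g0 y : 0 <= (Num.max (g y) 0)%:E by rewrite lee_fin le_max lexx orbT.
have t0 : 0 <= transfer w (fun y => (Num.max (g y) 0)%:E) x by exact: transfer_ge0.
have tB : transfer w (fun y => (Num.max (g y) 0)%:E) x <= B%:E.
  rewrite -[leRHS]mule1 -(Nw fx) -transferZ//; apply: le_transfer => // y fy.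
  by rewrite mule1 lee_fin ge_max B0 andbT (le_trans (ler_norm _))// gB.
move: t0 tB; case: (transfer w _ x) => [a| |]//.
by rewrite !lee_fin => a0 aB; exists a => //; rewrite a0.
Qed.

Lemma ruelle_bound g (B : R) x : (0 <= B)%R -> fibre S w x ->
  (forall y, fibre S (thV w) y -> (`|g y| <= B)%R) ->
  (`|ruelle S phi (thV w) g x| <= B)%R.
Proof.
move=> B0 fx gB; rewrite ruelleE.
have [a -> /andP[a0 aB]] := transfer_bound B0 fx gB.
have [|c -> /andP[c0 cB]] := @transfer_bound (fun y => - g y)%R B x B0 fx.
  by move=> y fy; rewrite normrN gB.
by rewrite /= ler_norml; apply/andP; split; lra.
Qed.

Lemma ruelle_couple_sub g (B : R) (F : NN * NN -> \bar R) x y :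
  (0 <= B)%R -> (forall y, fibre S (thV w) y -> (`|g y| <= B)%R) ->
  (forall z, 0 <= F z) ->
  (forall u v, fibre S (thV w) u -> fibre S (thV w) v -> (g u - g v)%:E <= F (u, v)) ->
  fibre S w x -> fibre S w y ->
  (ruelle S phi (thV w) g x - ruelle S phi (thV w) g y)%:E <= couple w F (x, y).
Proof.
move=> B0 gB F0 gF fx fy.
have gNB u : fibre S (thV w) u -> (`|- g u| <= B)%R by move=> fu; rewrite normrN gB.
pose gp u : \bar R := (Num.max (g u) 0)%:E.
pose gn u : \bar R := (Num.max (- g u) 0)%:E.
have gp0 u : 0 <= gp u by rewrite lee_fin le_max lexx orbT.
have gn0 u : 0 <= gn u by rewrite lee_fin le_max lexx orbT.
(* The inequality [g u - g v <= F (u, v)] in terms of positive and negative parts and without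
   subtraction, as [F] may be infinite; the coupling is applied to both sides and its marginals are
   read off. *)
have key : transfer w gp x + transfer w gn y <=
    transfer w gn x + transfer w gp y + couple w F (x, y).
  rewrite -(couple_fst Nw gp0 fx fy) -(couple_snd Nw gn0 fx fy).
  rewrite -(couple_fst Nw gn0 fx fy) -(couple_snd Nw gp0 fx fy).
  rewrite -!coupleD//; last by move=> z; rewrite /= adde_ge0.
  apply: le_couple => [z|[u v] /= fu fv]; first by rewrite /= adde_ge0.
  apply: (le_trans _ (leeD (lexx _) (gF u v fu fv))).
  rewrite -!EFinD lee_fin.
  by case: (lerP (g u) 0) => h1; case: (lerP (g v) 0) => h2;
    case: (lerP (- g u)%R 0) => h3; case: (lerP (- g v)%R 0) => h4; lra.
move: key; rewrite !ruelleE -/gp -/gn.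
have [a -> _] := transfer_bound B0 fx gB.
have [c -> _] := transfer_bound B0 fy gB.
have [a' -> _] := transfer_bound B0 fx gNB.
have [c' -> _] := transfer_bound B0 fy gNB.
rewrite /= -!EFinD => key.
have -> : (a - a' - (c - c') = (a + c') - (a' + c))%R by ring.
by rewrite EFinB leeBlDl.
Qed.

Lemma ruelle_couple g (B : R) (F : NN * NN -> \bar R) x y :
  (0 <= B)%R -> (forall y, fibre S (thV w) y -> (`|g y| <= B)%R) ->
  (forall z, 0 <= F z) ->
  (forall u v, fibre S (thV w) u -> fibre S (thV w) v -> `|g u - g v|%:E <= F (u, v)) ->
  fibre S w x -> fibre S w y ->
  `|ruelle S phi (thV w) g x - ruelle S phi (thV w) g y|%:E <= couple w F (x, y).
Proof.
move=> B0 gB F0 gF fx fy.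
(* Exchanging [x] and [y] would exchange the arguments of [F] as well; passing to the opposite of
   [g] reverses the difference and keeps the pair. *)
have ruelleN u : (- ruelle S phi (thV w) g u = ruelle S phi (thV w) (\- g) u)%R.
  rewrite !ruelleE opprB; congr (_ - fine _)%R; apply: eq_transfer => z _ /=.
  by rewrite opprK.
case: (leP (ruelle S phi (thV w) g y) (ruelle S phi (thV w) g x)) => h.
  rewrite ger0_norm ?subr_ge0//; apply: (ruelle_couple_sub B0) => // u v fu fv.
  by apply: le_trans (gF _ _ fu fv); rewrite lee_fin ler_norm.
rewrite ltr0_norm ?subr_lt0// opprB addrC -[X in (_ + X)%R]opprK !ruelleN.
apply: (ruelle_couple_sub B0) => // [u fu|u v fu fv]; first by rewrite normrN gB.
by apply: le_trans (gF _ _ fu fv); rewrite lee_fin -opprD -normrN ler_norm.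
Qed.

Lemma ruelle_transfer g (F : NN -> \bar R) x : fibre S w x ->
  (forall y, fibre S (thV w) y -> (g y)%:E = F y /\ 0 <= F y <= 1) ->
  (ruelle S phi (thV w) g x)%:E = transfer w F x.
Proof.
move=> fx gF.
have g01 y : fibre S (thV w) y -> (0 <= g y <= 1)%R.
  by move=> /gF[<-]; rewrite !lee_fin.
rewrite ruelleE (@eq_transfer _ (fun y => (Num.max (- g y) 0)%:E) (cst 0)); last first.
  by move=> y /g01/andP[g0 _]; rewrite max_r// oppr_le0.
rewrite transfer0.
have [|a Ea _] := @transfer_bound g 1%R x ler01 fx.
  by move=> y /g01/andP[g0 g1]; rewrite ger0_norm.
rewrite subr0 Ea /= -Ea; apply: eq_transfer => y fy.
by have /andP[g0 _] := g01 _ fy; rewrite max_l//; have [] := gF _ fy.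
Qed.

End at_w.

Variable A : set Omega.
Hypothesis A_thV : forall w, A w -> A (thV w).
Hypothesis A_norm : forall w, A w -> normalized_at S phi w.

Lemma ruelle_iter_couple n w g (B : R) (F : NN * NN -> \bar R) x y :
  A w -> (0 <= B)%R ->
  (forall y, fibre S (iter n thV w) y -> (`|g y| <= B)%R) ->
  (forall z, 0 <= F z) ->
  (forall u v, fibre S (iter n thV w) u -> fibre S (iter n thV w) v ->
     `|g u - g v|%:E <= F (u, v)) ->
  fibre S w x -> fibre S w y ->
  `|ruelle_iter S phi n (iter n thV w) g x -
    ruelle_iter S phi n (iter n thV w) g y|%:E <= couple_iter n w F (x, y).
Proof.
move=> Aw B0 gB F0 gF.
(* The bound [B] belongs to the induction: [ruelle] subtracts the [fine] parts of two sums, which is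
   meaningful when these are finite, and normalization preserves the bound. *)
suff [H _] : (forall u v, fibre S w u -> fibre S w v ->
    `|ruelle_iter S phi n (iter n thV w) g u -
      ruelle_iter S phi n (iter n thV w) g v|%:E <= couple_iter n w F (u, v)) /\
    (forall u, fibre S w u -> (`|ruelle_iter S phi n (iter n thV w) g u| <= B)%R).
  exact: H.
elim: n w Aw gB gF => [|n IH] w Aw gB gF; first by split.
rewrite iterSr in gB gF.
have [H1 H2] := IH (thV w) (A_thV Aw) gB gF.
split => [u v fu fv|u fu] /=; rewrite -/(iter n.+1 thV w) iterSr iter_thVK.
  apply: (ruelle_couple (A_norm Aw) B0) => //.
  by move=> z; exact: couple_iter_ge0.
exact: (ruelle_bound (A_norm Aw) B0).
Qed.

Lemma ruelle_iter_transfer n w (B : set NN) x : A w -> fibre S w x ->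
  (ruelle_iter S phi n (iter n thV w) (\1_B) x)%:E =
  transfer_iter n w (fun y => (\1_B y)%:E) x.
Proof.
elim: n w x => [//|n IH] w x Aw fx /=; rewrite -/(iter n.+1 thV w) iterSr iter_thVK.
apply: (ruelle_transfer (A_norm Aw)) => // y fy; split.
  by apply: IH => //; exact: A_thV.
apply/andP; split; first by apply: transfer_iter_ge0 => z; rewrite lee_fin.
apply: (transfer_iter_le1 A_thV A_norm) => //; first exact: A_thV.
by move=> z; rewrite lee_fin.
Qed.

Lemma couple_iter_fst n w (F : NN -> \bar R) x y : A w -> (forall x, 0 <= F x) ->
  fibre S w x -> fibre S w y ->
  couple_iter n w (fun z => F z.1) (x, y) = transfer_iter n w F x.
Proof.
elim: n w x y => [//|n IH] w x y Aw F0 fx fy /=.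
have T0 u : 0 <= transfer_iter n (thV w) F u by exact: transfer_iter_ge0.
rewrite -(couple_fst (A_norm Aw) T0 fx fy); apply/eqP; rewrite eq_le.
apply/andP; split; apply: le_couple.
- by move=> z; apply: couple_iter_ge0 => ?; exact: F0.
- by move=> [u v] fu fv; rewrite (IH _ _ _ (A_thV Aw) F0 fu fv).
- by move=> z; exact: T0.
- by move=> [u v] fu fv; rewrite (IH _ _ _ (A_thV Aw) F0 fu fv).
Qed.

Lemma couple_iter_snd n w (F : NN -> \bar R) x y : A w -> (forall x, 0 <= F x) ->
  fibre S w x -> fibre S w y ->
  couple_iter n w (fun z => F z.2) (x, y) = transfer_iter n w F y.
Proof.
elim: n w x y => [//|n IH] w x y Aw F0 fx fy /=.
have T0 u : 0 <= transfer_iter n (thV w) F u by exact: transfer_iter_ge0.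
rewrite -(couple_snd (A_norm Aw) T0 fx fy); apply/eqP; rewrite eq_le.
apply/andP; split; apply: le_couple.
- by move=> z; apply: couple_iter_ge0 => ?; exact: F0.
- by move=> [u v] fu fv; rewrite (IH _ _ _ (A_thV Aw) F0 fu fv).
- by move=> z; exact: T0.
- by move=> [u v] fu fv; rewrite (IH _ _ _ (A_thV Aw) F0 fu fv).
Qed.

End ruelle_link.

(** * Pushing coupling measures forward *)

Lemma measurable_inv (R : realType) : measurable_fun setT (@GRing.inv R).
Proof.
have mN0 : measurable (~` [set 0%R : R]) by exact: measurableC.
have oN0 : open (~` [set 0%R : R]).
  rewrite (_ : ~` _ = [set x : R | x != 0%R]); first exact: open_neq.
  by apply/seteqP; split => x /= /eqP.
rewrite -(setvU [set 0%R : R]); apply/measurable_funU => //; split.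
  apply: subspace_continuous_measurable_fun => //.
  rewrite continuous_open_subspace//.
  by move=> x; rewrite inE/= => /eqP x0; exact: inv_continuous.
exact: measurable_fun_set1.
Qed.

Section measure_packing.
Context (R : realType) (d : measure_display) (T : measurableType d).
Variable mu : {measure set T -> \bar R}.

(** An alias whose argument records the mass bound, so that the matching measure structure can be
    attached to it. *)
Definition as_subprobability (_ : mu setT <= 1) : set T -> \bar R := mu.

Definition as_probability (_ : mu setT = 1) : set T -> \bar R := mu.

Section subprobability.
Hypothesis mu1 : mu setT <= 1.
HB.instance Definition _ := isMeasure.Build _ _ _ (as_subprobability mu1)
  (measure0 mu) (measure_ge0 mu) (@measure_semi_sigma_additive _ _ _ mu).
HB.instance Definition _ :=
  Measure_isSubProbability.Build _ _ _ (as_subprobability mu1) mu1.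
End subprobability.

Section probability.
Hypothesis mu1 : mu setT = 1.
HB.instance Definition _ := isMeasure.Build _ _ _ (as_probability mu1)
  (measure0 mu) (measure_ge0 mu) (@measure_semi_sigma_additive _ _ _ mu).
HB.instance Definition _ :=
  Measure_isProbability.Build _ _ _ (as_probability mu1) mu1.
End probability.

End measure_packing.

Section coupled_measure.
Context (R : realType) (d : measure_display) (Omega : measurableType d)
  (P : probability Omega R) (S : random_tmc P) (phi : Omega * NN -> R).
Variable w : Omega.
Implicit Types (x y : NN) (b : nat).
Local Notation common := (common S phi).
Local Notation common_mass := (common_mass S phi).
Local Notation residual := (residual S phi).
Local Notation couple := (couple S phi).
Hypothesis phi_meas : measurable_fun (total_space S) phi.
Hypothesis Nw : normalized_at S phi w.

Let measurable_pair_push b b' :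
  measurable_fun setT (fun z : NN * NN => (push b z.1, push b' z.2) : NN * NN).
Proof.
apply: measurable_fun_pair.
  exact: (measurableT_comp (measurable_push b) measurable_fst).
exact: (measurableT_comp (measurable_push b') measurable_snd).
Qed.

Let m1 b : measurable_fun setT (fun z : NN * NN => tprob S phi w b z.1).
Proof. exact: (measurableT_comp (measurable_tprob w b phi_meas) measurable_fst). Qed.

Let m2 b : measurable_fun setT (fun z : NN * NN => tprob S phi w b z.2).
Proof. exact: (measurableT_comp (measurable_tprob w b phi_meas) measurable_snd). Qed.

Lemma measurable_common b : measurable_fun setT (fun z : NN * NN => common w b z.1 z.2).
Proof.
rewrite /common; apply: measurable_fun_ifT => //; last first.
  exact: measurable_minr.
apply: (measurable_fun_bool true); rewrite setTI.
rewrite (_ : _ @^-1` _ = [set z : NN * NN | exists k : nat, z.1 0%N = k /\ z.2 0%N = k]).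
  apply: measurable_set_ex => k; apply: measurable_set_and; apply: measurable_eq_nat.
    exact: (measurableT_comp (measurable_coord 0) measurable_fst).
  exact: (measurableT_comp (measurable_coord 0) measurable_snd).
apply/seteqP; split => [z /= /eqP zz|z /= [k [-> ->]]]; last by rewrite eqxx.
by exists (z.1 0%N).
Qed.

Lemma measurable_residual b b' :
  measurable_fun setT (fun z : NN * NN => residual w b b' z.1 z.2).
Proof.
have mcm : measurable_fun setT (fun z : NN * NN => common_mass w z.1 z.2).
  apply: (measurableT_comp (fine_measurable measurableT)).
  apply: ge0_emeasurable_sum => [b0 z _ _|b0 _]; first by rewrite lee_fin common_ge0.
  by apply/measurable_EFinP; exact: measurable_common.
apply: measurable_funM.
  by apply: measurable_funM; apply: measurable_funB => //; exact: measurable_common.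
apply: (measurableT_comp (@measurable_inv R)).
by apply: measurableT_comp => //; apply: measurable_funB.
Qed.

Lemma measurable_couple F : (forall z, 0 <= F z) -> measurable_fun setT F ->
  measurable_fun setT (couple w F).
Proof.
move=> F0 mF; apply: ge0_emeasurable_sum => [b z _ _|b _].
  rewrite adde_ge0//; first by rewrite mule_ge0// lee_fin common_ge0.
  by apply: nneseries_ge0 => b' _ _; rewrite mule_ge0// lee_fin residual_ge0.
apply: emeasurable_funD.
  apply: emeasurable_funM; first by apply/measurable_EFinP; exact: measurable_common.
  exact: (measurableT_comp mF (measurable_pair_push b b)).
apply: ge0_emeasurable_sum => [b' z _ _|b' _].
  by rewrite mule_ge0// lee_fin residual_ge0.
apply: emeasurable_funM; first by apply/measurable_EFinP; exact: measurable_residual.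
exact: (measurableT_comp mF (measurable_pair_push b b')).
Qed.

Let kernel_at (z : NN * NN) : {measure set (NN * NN) -> \bar R} :=
  mseries (fun b => measure_add
    (mscale (NngNum (common_ge0 S phi w b z.1 z.2)) (\d_ (push b z.1, push b z.2)))
    (mseries (fun b' => mscale (NngNum (residual_ge0 S phi w b b' z.1 z.2))
       (\d_ (push b z.1, push b' z.2))) 0)) 0.

Let kernel_atE z F : (forall z, 0 <= F z) -> measurable_fun setT F ->
  \int[kernel_at z]_u F u = couple w F z.
Proof.
move=> F0 mF; rewrite ge0_integral_measure_series//; apply: eq_eseriesr => b _.
rewrite ge0_integral_measure_add//; refine (f_equal2 (fun a c => a + c) _ _).
  by rewrite ge0_integral_mscale// integral_dirac//= diracT mul1e.
rewrite ge0_integral_measure_series//; apply: eq_eseriesr => b' _.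
by rewrite ge0_integral_mscale// integral_dirac//= diracT mul1e.
Qed.

Let kernel_atT z : kernel_at z setT <= 1.
Proof.
have -> : kernel_at z setT = couple w (cst 1) z.
  by rewrite -[LHS]mul1e -(integral_cst (kernel_at z) measurableT) kernel_atE.
have [[f1 f2]|nf] := pselect (fibre S w z.1 /\ fibre S w z.2).
  by case: z f1 f2 => x y f1 f2; rewrite couple1.
by rewrite couple_off.
Qed.

(** [m'] is the Giry bind of [m] with the kernel. A priori it is a subprobability; it has mass 1
    because the kernel has mass 1 over pairs in the fibre and [m] is concentrated on these. *)
Lemma couple_measure (m : probability (NN * NN)%type R) :
  m (fibre S w `*` fibre S w) = 1 ->
  exists m' : probability (NN * NN)%type R,
    forall F, (forall z, 0 <= F z) -> measurable_fun setT F ->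
      \int[m']_z F z = \int[m]_z couple w F z.
Proof.
move=> mX; pose k z : giry (NN * NN)%type R := as_subprobability (kernel_atT z).
have kE z F : (forall z, 0 <= F z) -> measurable_fun setT F ->
    giry_int (k z) F = couple w F z.
  move=> F0 mF; by rewrite -kernel_atE//; apply: eq_measure_integral.
have mk : measurable_fun setT k.
  apply: measurable_giry_codensity => // B mB.
  have mI : measurable_fun setT (fun z : NN * NN => (\1_B z)%:E : \bar R).
    by apply/measurable_EFinP.
  rewrite (_ : k^~ B = couple w (fun z => (\1_B z)%:E)).
    by apply: measurable_couple => // z; rewrite lee_fin.
  apply/funext => z; rewrite -kE//.
  by rewrite /giry_int integral_indic// setIT.
pose mm : giry (NN * NN)%type R := giry_bind m mk.
have mmE F : (forall z, 0 <= F z) -> measurable_fun setT F ->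
    \int[mm]_z F z = \int[m]_z couple w F z.
  move=> F0 mF; have := giry_int_bind m mk mF F0; rewrite /giry_int => ->.
  by apply: eq_integral => z _; rewrite -[LHS]/(giry_int (k z) F) kE.
have mmT : mm setT = 1.
  rewrite -[LHS]mul1e -(integral_cst mm measurableT) mmE//.
  rewrite -[RHS]mX -[in RHS](setIT (_ `*` _)) -integral_indic//.
    apply: eq_integral => -[x y] _; rewrite indicE.
    have [[f1 f2]|nf] := pselect (fibre S w x /\ fibre S w y).
      by rewrite couple1// mem_set.
    by rewrite couple_off//= memNset.
  by apply: measurableX; exact: measurable_fibre.
by exists (as_probability mmT) => F F0 mF; rewrite -mmE.
Qed.

End coupled_measure.

(** * Ergodicity *)

Section ergodic.
Context (R : realType) (d : measure_display) (Omega : measurableType d)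
  (P : probability Omega R).

Lemma ae_mp2 (Q1 Q2 Q3 : Omega -> Prop) : (forall w, Q1 w -> Q2 w -> Q3 w) ->
  {ae P, forall w, Q1 w} -> {ae P, forall w, Q2 w} -> {ae P, forall w, Q3 w}.
Proof.
move=> Q123 ae1 ae2; apply: negligibleS (negligibleU ae1 ae2).
move=> w /= nQ3; have [q1|nq1] := pselect (Q1 w); last by left.
by right => q2; apply: nQ3; exact: Q123.
Qed.

Lemma ergodic_automorphism_inv (T TV : Omega -> Omega) :
  ergodic_automorphism P T TV -> ergodic_automorphism P TV T.
Proof.
move=> [mT mTV TK TVK pres erg]; split => // B mB.
  have mB' : measurable (TV @^-1` B) by rewrite -[X in measurable X]setTI; exact: mTV.
  rewrite -(pres _ mB'); congr (P _).
  by apply/seteqP; split => w /=; rewrite TK.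
move=> TB; apply: erg => //; rewrite -[in LHS]TB.
by apply/seteqP; split => w /=; rewrite TK.
Qed.

Lemma measurable_preimage_iter (T : Omega -> Omega) n (B : set Omega) :
  measurable_fun setT T -> measurable B -> measurable (iter n T @^-1` B).
Proof.
move=> mT mB; rewrite -[X in measurable X]setTI.
exact: (measurable_fun_iter n mT).
Qed.

Lemma preserving_iter (T TV : Omega -> Omega) n (B : set Omega) :
  ergodic_automorphism P T TV -> measurable B -> P (iter n T @^-1` B) = P B.
Proof.
move=> ET mB; elim: n => [//|n IH].
rewrite (_ : iter n.+1 T @^-1` B = T @^-1` (iter n T @^-1` B)); last first.
  by apply/seteqP; split => w; rewrite /preimage /= -iterSr.
rewrite (auto_preserving ET) ?IH//.
exact: measurable_preimage_iter (auto_measurable ET) mB.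
Qed.

Lemma ae_iter (T TV : Omega -> Omega) (Q : Omega -> Prop) :
  ergodic_automorphism P T TV -> {ae P, forall w, Q w} ->
  {ae P, forall w, forall k, Q (iter k T w)}.
Proof.
move=> ET [N [mN N0 QN]]; apply/ae_foralln => k.
exists (iter k T @^-1` N); split.
- exact: measurable_preimage_iter (auto_measurable ET) mN.
- exact: etrans (preserving_iter k ET mN) N0.
- by move=> w /= nQ; apply: QN.
Qed.

(** The set of points with infinitely many visits is strictly invariant and, by invariance of [P]
    and continuity from above, has measure at least [P G]; ergodicity makes it full. So almost every
    starting point is covered, inside [G] or not. *)
Lemma ergodic_recurrence (T TV : Omega -> Omega) (G : set Omega) :
  ergodic_automorphism P T TV -> measurable G -> 0 < P G ->
  {ae P, forall w, forall N, exists j, (N <= j)%N /\ G (iter j T w)}.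
Proof.
move=> ET mG G0.
pose F j := iter j T @^-1` G.
have mF j : measurable (F j).
  exact: measurable_preimage_iter (auto_measurable ET) mG.
have mL : measurable (lim_sup_set F).
  apply: bigcapT_measurable => n; apply: bigcup_measurable => k _; exact: mF.
have Linv : T @^-1` lim_sup_set F = lim_sup_set F.
  apply/seteqP; split => w Lw n _.
    have [j /= nj Fj] := Lw n I; exists j.+1; first by rewrite /= leqW.
    by rewrite /F /= -iterS iterSr.
  have [j /= nj Fj] := Lw n.+1 I; exists j.-1; first by rewrite /= -ltnS prednK// (leq_trans _ nj).
  by move: Fj; rewrite /F /= -iterSr prednK// (leq_trans _ nj).
have L0 : P G <= P (lim_sup_set F).
  have cv := @lim_sup_set_cvg _ _ _ P F mF _.
  rewrite -(cvg_lim _ (cv _))//; last first.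
    by apply: (le_lt_trans (probability_le1 _ _)); [exact: bigcup_measurable|exact: ltry].
  apply: lime_ge; first by apply/cvg_ex; eexists; apply: cv;
    apply: (le_lt_trans (probability_le1 _ _)); [exact: bigcup_measurable|exact: ltry].
  apply: nearW => n; rewrite -(preserving_iter n ET mG).
  apply: le_measure; rewrite ?inE//; first exact: (mF n).
    exact: bigcup_measurable.
  by move=> w Fw; exists n => /=.
have L1 : P (lim_sup_set F) = 1.
  have [L00|//] := auto_ergodic ET mL Linv.
  by move: (lt_le_trans G0 L0); rewrite L00 ltxx.
exists (~` lim_sup_set F); split; first exact: measurableC.
  by have := probability_setC P mL; rewrite L1 subee.
move=> w nQ Lw; apply: nQ => N; have [j /= Nj Fj] := Lw N I.
by exists j.
Qed.

End ergodic.

(** * Lipschitz and Vasershtein estimates from the coupling *)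

Section contraction_transfer.
Context (R : realType) (d : measure_display) (Omega : measurableType d)
  (P : probability Omega R) (S : random_tmc P) (phi : Omega * NN -> R).
Variables (r : R) (kappa s : Omega -> R) (A : set Omega).
Implicit Types (w : Omega) (x y : NN) (b : nat).
Local Notation thV := (thetaV S).
Hypothesis r01 : (0 < r < 1)%R.
Hypothesis A_thV : forall w, A w -> A (thV w).
Hypothesis A_norm : forall w, A w -> normalized_at S phi w.
Hypothesis A_hoelder : forall w, A w -> forall n x y, (2 <= n)%N ->
  fibre S (thV w) x -> fibre S (thV w) y -> (forall i, (i < n)%N -> x i = y i) ->
  (`|phi (thV w, x) - phi (thV w, y)| <= kappa (thV w) * r ^+ n)%R.
Hypothesis s_ge0 : forall w, (0 <= s w)%R.
Hypothesis kappa_ge0 : forall w, (0 <= kappa w)%R.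
Hypothesis A_sum : forall w, A w -> s w = (kappa (thV w) * r + r * s (thV w))%R.
Local Notation dist := (word_dist r).

Local Notation couple_iter := (couple_iter S phi).
Local Notation transfer_iter := (transfer_iter S phi).
Hypothesis phi_meas : measurable_fun (total_space S) phi.

Let edist (z : NN * NN) : \bar R := (dist z.1 z.2)%:E.

Let edist_ge0 z : 0 <= edist z.
Proof. by rewrite lee_fin word_dist_ge0. Qed.

Let medist : measurable_fun setT edist.
Proof. apply/measurable_EFinP; exact: measurable_word_dist. Qed.

Lemma measurable_transfer w (F : NN -> \bar R) : (forall x, 0 <= F x) ->
  measurable_fun setT F -> measurable_fun setT (transfer S phi w F).
Proof.
move=> F0 mF; apply: ge0_emeasurable_sum => [b z _ _|b _].
  by rewrite mule_ge0// lee_fin tprob_ge0.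
apply: emeasurable_funM; last exact: (measurableT_comp mF (measurable_push b)).
by apply/measurable_EFinP; exact: measurable_tprob.
Qed.

Lemma measurable_transfer_iter n w (F : NN -> \bar R) : (forall x, 0 <= F x) ->
  measurable_fun setT F -> measurable_fun setT (transfer_iter n w F).
Proof.
elim: n w => [//|n IH] w F0 mF; apply: measurable_transfer; last exact: IH.
by move=> x; exact: transfer_iter_ge0.
Qed.

Lemma measurable_couple_iter n w F : (forall z, 0 <= F z) ->
  measurable_fun setT F -> measurable_fun setT (couple_iter n w F).
Proof.
elim: n w => [//|n IH] w F0 mF; apply: measurable_couple => //; last exact: IH.
by move=> x; exact: couple_iter_ge0.
Qed.

Let mX w : measurable (fibre S w `*` fibre S w).
Proof. by apply: measurableX; exact: measurable_fibre. Qed.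

Lemma couple_iter_measure n w (m : probability (NN * NN)%type R) :
  A w -> m (fibre S w `*` fibre S w) = 1 ->
  exists2 m' : probability (NN * NN)%type R,
    m' (fibre S (iter n thV w) `*` fibre S (iter n thV w)) = 1 &
    forall F, (forall z, 0 <= F z) -> measurable_fun setT F ->
      \int[m']_z F z = \int[m]_z couple_iter n w F z.
Proof.
elim: n w m => [|n IH] w m Aw mw1; first by exists m.
have [m1 m1E] := couple_measure phi_meas (A_norm Aw) mw1.
have I0 v (z : NN * NN) : 0 <= (\1_(fibre S v `*` fibre S v) z)%:E :> \bar R by rewrite lee_fin.
have m1X : m1 (fibre S (thV w) `*` fibre S (thV w)) = 1.
  rewrite -[X in m1 X](setIT (_ `*` _)) -integral_indic// m1E//; last first.
    by apply/measurable_EFinP; exact: measurable_indic.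
  rewrite -[RHS]mw1 -[in RHS](setIT (_ `*` _)) -integral_indic//.
  apply: eq_integral => -[x y] _; rewrite [in RHS]indicE.
  have [[f1 f2]|nf] := pselect (fibre S w x /\ fibre S w y).
    rewrite mem_set//= -[RHS](couple1 (A_norm Aw) f1 f2).
    apply/eqP; rewrite eq_le; apply/andP; split; apply: le_couple => //.
      by move=> z _ _; rewrite lee_fin indicE; case: (_ \in _).
    by move=> [u v] fu fv; rewrite lee_fin indicE mem_set.
  by rewrite couple_off//= memNset.
have [m' m'X m'E] := IH (thV w) m1 (A_thV Aw) m1X; exists m'.
  by rewrite iterSr.
move=> F F0 mF; rewrite m'E// m1E//; first by move=> z; exact: couple_iter_ge0.
exact: measurable_couple_iter.
Qed.

Let full_integral w (m : probability (NN * NN)%type R) F G :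
  m (fibre S w `*` fibre S w) = 1 ->
  (forall z, 0 <= F z) -> measurable_fun setT F ->
  (forall z, 0 <= G z) -> measurable_fun setT G ->
  (forall x y, fibre S w x -> fibre S w y -> F (x, y) <= G (x, y)) ->
  \int[m]_z F z <= \int[m]_z G z.
Proof.
move=> m1 F0 mF G0 mG FG; apply: ae_ge0_le_integral => //.
exists (~` (fibre S w `*` fibre S w)); split; first exact: measurableC.
  by have := probability_setC m (mX w); rewrite m1 subee.
move=> [x y] /= nFG [fx fy]; apply: nFG => _; exact: FG.
Qed.

(** [p] stands for either projection, so that both marginals of the pushed coupling are identified
    at once. *)
Lemma integral_ruelle_dual n w (mu : {measure set NN -> \bar R})
    (m : probability (NN * NN)%type R) (p : NN * NN -> NN) (B : set NN) :
  A w -> m (fibre S w `*` fibre S w) = 1 -> measurable B ->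
  measurable_fun setT p -> (forall C, measurable C -> m (p @^-1` C) = mu C) ->
  (forall x y, fibre S w x -> fibre S w y -> fibre S w (p (x, y)) /\
     couple_iter n w (fun z => (\1_B (p z))%:E) (x, y) =
     transfer_iter n w (fun x => (\1_B x)%:E) (p (x, y))) ->
  \int[m]_z couple_iter n w (fun z => (\1_B (p z))%:E) z =
  ruelle_dual S phi n (iter n thV w) mu B.
Proof.
move=> Aw m1 mB mp pmu pE; pose T := transfer_iter n w (fun x => (\1_B x)%:E).
have mI : measurable_fun setT (fun x : NN => (\1_B x)%:E : \bar R).
  by apply/measurable_EFinP; exact: measurable_indic.
have I0 (x : NN) : 0 <= (\1_B x)%:E :> \bar R by rewrite lee_fin.
have T0 x : 0 <= T x by exact: transfer_iter_ge0.
have mT : measurable_fun setT T by exact: measurable_transfer_iter.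
rewrite /ruelle_dual iter_thVK.
transitivity (\int[mu]_(x in fibre S w) T x); last first.
  apply: eq_integral => x; rewrite inE => fx.
  by rewrite (ruelle_iter_transfer A_thV A_norm).
rewrite [RHS]integral_mkcond; set TX := T \_ (fibre S w).
have TX0 x : 0 <= TX x by exact: erestrict_ge0.
have mTX : measurable_fun setT TX.
  apply/(measurable_restrictT _ (measurable_fibre S w)); exact: measurable_funTS.
transitivity (\int[m]_z TX (p z)).
  have eqX x y : fibre S w x -> fibre S w y ->
     couple_iter n w (fun z => (\1_B (p z))%:E) (x, y) = TX (p (x, y)).
    by move=> fx fy; have [fp ->] := pE x y fx fy; rewrite /TX patchE mem_set.
  have c0 z : 0 <= couple_iter n w (fun z => (\1_B (p z))%:E) z.
    by apply: couple_iter_ge0 => ?; rewrite lee_fin.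
  have mc : measurable_fun setT (couple_iter n w (fun z => (\1_B (p z))%:E)).
    apply: measurable_couple_iter => [z|]; first by rewrite lee_fin.
    exact: (measurableT_comp mI mp).
  have mTp : measurable_fun setT (TX \o p) by exact: measurableT_comp.
  apply/eqP; rewrite eq_le; apply/andP; split; apply: (full_integral m1) => //.
    by move=> x y fx fy; rewrite eqX.
  by move=> x y fx fy; rewrite eqX.
rewrite -[LHS](@ge0_integral_pushforward _ _ _ _ _ p mp m setT TX)//.
by apply: eq_measure_integral => C mC _; exact: pmu.
Qed.

(** Each coupling of [mu] and [nu] is pushed to a coupling of the dual measures whose cost is at
    most [K] times the original one, so no optimal coupling has to exist. Dividing by [K > 0] first
    isolates the infimum, which may be over the empty set. *)
Lemma vasershtein_contraction n w (K : R) (mu nu : {measure set NN -> \bar R}) :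
  A w -> (0 < K)%R ->
  (forall x y, fibre S w x -> fibre S w y ->
    couple_iter n w edist (x, y) <= K%:E * edist (x, y)) ->
  vasershtein r (fibre S (iter n thV w))
    (ruelle_dual S phi n (iter n thV w) mu) (ruelle_dual S phi n (iter n thV w) nu) <=
  K%:E * vasershtein r (fibre S w) mu nu.
Proof.
move=> Aw K0 cK; rewrite -lee_pdivrMl//; apply: le_ereal_inf_tmp => _ [m [m1 mmu mnu] <-].
rewrite lee_pdivrMl//.
have [m' m'X m'E] := couple_iter_measure n Aw m1.
have m1E B (p : NN * NN -> NN) : measurable B -> measurable_fun setT p ->
    m' (p @^-1` B) = \int[m]_z couple_iter n w (fun z => (\1_B (p z))%:E) z.
  move=> mB mp; have mpB : measurable (p @^-1` B).
    by rewrite -[X in measurable X]setTI; exact: mp.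
  rewrite -m'E; last 2 first.
  - by move=> z; rewrite lee_fin.
  - by apply/measurable_EFinP; apply: (measurableT_comp _ mp).
  by rewrite (integral_indic m' measurableT mpB) setIT.
have coup : is_coupling (fibre S (iter n thV w))
    (ruelle_dual S phi n (iter n thV w) mu) (ruelle_dual S phi n (iter n thV w) nu) m'.
  split => [//|B mB|B mB].
    rewrite (_ : B `*` setT = fst @^-1` B); last first.
      by apply/seteqP; split => [[x y] [] //|[x y] ].
    rewrite m1E//; apply: integral_ruelle_dual => //.
      move=> C mC; rewrite -mmu//; congr (m _).
      by apply/seteqP; split => [[x y] |[x y] [] //].
    move=> x y fx fy; split => //=.
    by apply: (couple_iter_fst A_thV A_norm n (F := fun x => (\1_B x)%:E)) => // ?; rewrite lee_fin.
  rewrite (_ : setT `*` B = snd @^-1` B); last first.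
    by apply/seteqP; split => [[x y] [] //|[x y] ].
  rewrite m1E//; apply: integral_ruelle_dual => //.
    move=> C mC; rewrite -mnu//; congr (m _).
    by apply/seteqP; split => [[x y] |[x y] [] //].
  move=> x y fx fy; split => //=.
  by apply: (couple_iter_snd A_thV A_norm n (F := fun x => (\1_B x)%:E)) => // ?; rewrite lee_fin.
apply: (@le_trans _ _ (\int[m']_z edist z)).
  by apply: ereal_inf_lbound; exists m'.
rewrite m'E// -ge0_integralZl//; last by rewrite lee_fin ltW.
apply: (full_integral m1) => //.
- by move=> z; exact: couple_iter_ge0.
- exact: measurable_couple_iter.
- by move=> z; rewrite mule_ge0 ?edist_ge0// lee_fin ltW.
- exact: measurable_funeM.
by move=> z _; exact: edist_ge0.
Qed.

Lemma lip_const_ge0 (X : set NN) (g : NN -> R) : 0 <= lip_const r X g.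
Proof. by apply: ereal_sup_ubound; left. Qed.

Lemma lip_contraction n w (K : R) (g : NN -> R) :
  A w -> (0 < K)%R ->
  (forall x y, fibre S w x -> fibre S w y ->
    couple_iter n w edist (x, y) <= K%:E * edist (x, y)) ->
  lip_const r (fibre S w) (ruelle_iter S phi n (iter n thV w) g) <=
  K%:E * lip_const r (fibre S (iter n thV w)) g.
Proof.
move=> Aw K0 cK; set X := fibre S (iter n thV w).
(* An infinite Lipschitz constant makes the right side infinite, as [K > 0]. A finite one makes [g]
   bounded on the fibre, whose diameter is at most 1, as [ruelle_iter_couple] demands. *)
have := lip_const_ge0 X g; case E : (lip_const r X g) => [L| |]//; last first.
  by rewrite gt0_muley ?leey.
rewrite lee_fin => L0.
have gL u v : X u -> X v -> (`|g u - g v| <= L * dist u v)%R.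
  move=> Xu Xv; have [->|uv] := pselect (u = v).
    by rewrite subrr normr0 mulr_ge0// word_dist_ge0.
  rewrite -ler_pdivrMr ?word_dist_gt0// -lee_fin -E.
  by apply: ereal_sup_ubound; right; exists u, v.
have [B B0 gB] : exists2 B : R, (0 <= B)%R & forall y, X y -> (`|g y| <= B)%R.
  have [[u0 Xu0]|nX] := pselect (exists u0, X u0); last first.
    by exists 0%R => // y Xy; exfalso; apply: nX; exists y.
  exists (`|g u0| + L)%R; first by rewrite addr_ge0.
  move=> y Xy; rewrite -[X in (`|X| <= _)%R](subrK (g u0)) addrC.
  rewrite (le_trans (ler_normD _ _))// lerD2l (le_trans (gL _ _ Xy Xu0))//.
  by rewrite ler_piMr// word_dist_le1.
apply: ge_ereal_sup => _ [->|[x [y [fx fy xy ->]]]].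
  by rewrite mule_ge0// lee_fin// ltW.
rewrite -EFinM lee_fin ler_pdivrMr ?word_dist_gt0// -lee_fin.
apply: (le_trans (ruelle_iter_couple A_thV A_norm (F := fun z => L%:E * edist z) Aw B0 gB _ _ fx fy)).
- by move=> z; rewrite mule_ge0// lee_fin.
- by move=> u v Xu Xv; rewrite -EFinM lee_fin gL.
rewrite couple_iterZ// (mulrC K) !EFinM -muleA.
by apply: lee_wpmul2l; [rewrite lee_fin|exact: cK].
Qed.

End contraction_transfer.

(** * Reaching a fixed letter *)

Section greedy_points.
Context (R : realType) (d : measure_display) (Omega : measurableType d)
  (P : probability Omega R) (S : random_tmc P).
Implicit Types (w : Omega) (i j n : nat).
Local Notation th := (theta S).
Local Notation thV := (thetaV S).

Definition least_successor w i : nat := first_nat (transition S w i).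

Fixpoint greedy_letter w i n : nat :=
  if n is n'.+1 then least_successor (iter n' th w) (greedy_letter w i n') else i.

(* A measurable selection of a point in each 1-cylinder. *)
Definition greedy w i : NN := greedy_letter w i.

Lemma measurable_greedy i : measurable_fun setT (greedy^~ i).
Proof.
apply: measurable_funNN => n; rewrite /greedy; elim: n => [|n IH] /=.
  exact: measurable_cst.
apply: (measurable_fun_countable_case
  (g := fun k w => least_successor (iter n th w) k)) => // k.
apply: (measurableT_comp (f := least_successor^~ k)).
  by apply: measurable_first_nat => l; exact: alpha_measurable.
exact: measurable_fun_iter (auto_measurable (theta_auto S)).
Qed.

Definition row_positive w := forall i, alphabet S w i ->
  exists2 j, alphabet S (th w) j & alpha S w i j.

Lemma greedy_fibre w i : (forall k, row_positive (iter k th w)) -> alphabet S w i ->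
  fibre S w (greedy w i).
Proof.
move=> row wi.
have tr v j : row_positive v -> alphabet S v j -> transition S v j (least_successor v j).
  by move=> rv vj; apply: first_natP; have [k k1 k2] := rv j vj; exists k; split.
have al n : alphabet S (iter n th w) (greedy_letter w i n).
  by elim: n => [//|n IH] /=; have [] := tr _ _ (row n) IH.
by move=> n; exact: tr (row n) (al n).
Qed.

Context (phi : Omega * NN -> R).
Hypothesis phi_meas : measurable_fun (total_space S) phi.

(** Joint measurability is called for because the function will be evaluated at the random point
    [greedy w i]. *)
Lemma measurable_transfer_iter_prod n (F : NN -> \bar R) :
  (forall x, 0 <= F x) -> measurable_fun setT F ->
  measurable_fun setT (fun z : Omega * NN => transfer_iter S phi n z.1 F z.2).
Proof.
move=> F0 mF; elim: n => [|n IH] /=; first exact: (measurableT_comp mF measurable_snd).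
apply: ge0_emeasurable_sum => [b z _ _|b _].
  by rewrite mule_ge0 ?lee_fin ?tprob_ge0//; exact: transfer_iter_ge0.
apply: emeasurable_funM.
  by apply/measurable_EFinP; exact: measurable_tprob_prod.
have mg : measurable_fun setT (fun z : Omega * NN => (thV z.1, push b z.2)).
  apply: measurable_fun_pair.
    exact: (measurableT_comp (auto_measurableV (theta_auto S)) measurable_fst).
  exact: (measurableT_comp (measurable_push b) measurable_snd).
exact: (measurableT_comp IH mg).
Qed.

Lemma measurable_transfer_iter_greedy n i (F : NN -> \bar R) :
  (forall x, 0 <= F x) -> measurable_fun setT F ->
  measurable_fun setT (fun w => transfer_iter S phi n w F (greedy w i)).
Proof.
move=> F0 mF; have mg : measurable_fun setT (fun w => (w, greedy w i)).
  by apply: measurable_fun_pair => //; exact: measurable_greedy.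
exact: (measurableT_comp (measurable_transfer_iter_prod n F0 mF) mg).
Qed.

End greedy_points.

Lemma lower_bound_nat (R : realType) (eta : nat -> R) M : (forall b, (0 < eta b)%R) ->
  exists rho : R, (0 < rho <= 1)%R /\ forall b, (b < M)%N -> (rho <= eta b)%R.
Proof.
move=> eta0; elim: M => [|M [rho [/andP[r0 r1] rM]]].
  by exists 1%R; rewrite ltr01 lexx.
exists (Num.min rho (eta M)); rewrite lt_min r0 eta0 ge_min r1; split => // b.
rewrite ltnS leq_eqVlt => /predU1P[->|/rM rb]; first by rewrite ge_min lexx orbT.
by rewrite ge_min rb.
Qed.

Lemma finite_set_nat_bounded (I : set nat) : finite_set I ->
  exists M, forall b, I b -> (b < M)%N.
Proof.
move=> /finite_fsetP[X ->]; exists (\max_(k <- finmap.enum_fset X) k).+1 => b /= bX.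
by rewrite ltnS; apply: (@leq_bigmax_seq _ _ xpredT id).
Qed.

Section reach.
Context (R : realType) (d : measure_display) (Omega : measurableType d)
  (P : probability Omega R) (S : random_tmc P) (phi : Omega * NN -> R).
Variables (r : R) (kappa s : Omega -> R) (A : set Omega).
Implicit Types (w : Omega) (x y : NN) (b : nat).
Local Notation thV := (thetaV S).
Hypothesis r01 : (0 < r < 1)%R.
Hypothesis A_thV : forall w, A w -> A (thV w).
Hypothesis A_norm : forall w, A w -> normalized_at S phi w.
Hypothesis A_hoelder : forall w, A w -> forall n x y, (2 <= n)%N ->
  fibre S (thV w) x -> fibre S (thV w) y -> (forall i, (i < n)%N -> x i = y i) ->
  (`|phi (thV w, x) - phi (thV w, y)| <= kappa (thV w) * r ^+ n)%R.
Hypothesis s_ge0 : forall w, (0 <= s w)%R.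
Hypothesis kappa_ge0 : forall w, (0 <= kappa w)%R.
Hypothesis A_sum : forall w, A w -> s w = (kappa (thV w) * r + r * s (thV w))%R.
Local Notation transfer_iter := (transfer_iter S phi).

Let first_is (c : nat) : NN -> \bar R := fun x => (\1_[set z : NN | z 0%N = c] x)%:E.

Let first_is_ge0 c x : 0 <= first_is c x.
Proof. by rewrite lee_fin. Qed.

Lemma transfer_ge_term w b F x : (forall x, 0 <= F x) ->
  (tprob S phi w b x)%:E * F (push b x) <= transfer S phi w F x.
Proof.
move=> F0; rewrite /transfer (@nneseriesD1 _ _ b)//; last first.
  by move=> k _; rewrite mule_ge0// lee_fin tprob_ge0.
rewrite leeDl//; apply: nneseries_ge0 => k _ _.
by rewrite mule_ge0// lee_fin tprob_ge0.
Qed.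

Lemma fibre_iter_shift n w z : fibre S (iter n thV w) z -> fibre S w (iter n Defs.shift z).
Proof.
elim: n w => [//|n IH] w; rewrite iterSr => /IH/fibre_shift.
by rewrite thVK.
Qed.

Lemma iter_shiftE n (z : NN) k : iter n Defs.shift z k = z (n + k)%N.
Proof. by elim: n k => [//|n IH] k; rewrite iterS /Defs.shift IH addnS. Qed.

(** The branch through [z] alone contributes a positive product of exponentials. *)
Lemma transfer_iter_gt0 n w c z : fibre S (iter n thV w) z -> z 0%N = c ->
  0 < transfer_iter n w (first_is c) (iter n Defs.shift z).
Proof.
elim: n w => [|n IH] w fz z0 /=.
  by rewrite lte_fin indicE mem_set.
rewrite iterSr in fz; have T0 := IH (thV w) fz z0.
set y := iter n Defs.shift z in T0 *.
have fy : fibre S (thV w) y by exact: fibre_iter_shift.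
apply: (lt_le_trans _ (transfer_ge_term w (y 0%N) (Defs.shift y) _)); last first.
  by move=> u; exact: transfer_iter_ge0.
by rewrite push_shift mule_gt0// lte_fin tprob_on push_shift// expR_gt0.
Qed.

(** Some letter [b] of [I] can precede any given point of the fibre, with a weight controlled
    uniformly by [V]. One path [z] joining [c] and [b] gives a positive probability at one point of
    the cylinder of [b], and distortion extends it to the cylinder. Finiteness of [I] yields a
    minimum. *)
Lemma transfer_iter_reach w n c (V : R) (I : set nat) :
  A w -> finite_set I ->
  (forall a, alphabet S w a -> exists2 b, I b & transition S (thV w) b a) ->
  (forall x y, fibre S (thV w) x -> fibre S (thV w) y -> x 0%N = y 0%N ->
     (`|phi (thV w, x) - phi (thV w, y)| <= V)%R) ->
  (forall b x, I b -> fibre S (thV w) x -> x 0%N = b ->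
     exists z, [/\ fibre S (iter n.+1 thV w) z, z 0%N = c & z n = b]) ->
  exists rho : R, (0 < rho <= 1)%R /\ forall x, fibre S w x ->
    rho%:E <= transfer_iter n.+1 w (first_is c) x.
Proof.
move=> Aw finI Ibp phiV mix.
have T1 u : fibre S (thV w) u -> transfer_iter n (thV w) (first_is c) u <= 1.
  move=> fu; apply: (transfer_iter_le1 A_thV A_norm) => //; first exact: A_thV.
  by move=> x; rewrite lee_fin indicE; case: (_ \in _).
have /choice[eta eta_spec] : forall b, exists e : R, (0 < e)%R /\
    (I b -> forall x, fibre S (thV w) (push b x) -> fibre S w x ->
      e%:E <= (tprob S phi w b x)%:E * transfer_iter n (thV w) (first_is c) (push b x)).
  move=> b; have [[x0 fx0]|nx0] := pselect (exists x0, fibre S (thV w) (push b x0)); last first.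
    by exists 1%R; split => // _ x fx _; exfalso; apply: nx0; exists x.
  have [Ib|nIb] := pselect (I b); last by exists 1%R.
  have [z [fz z0 zn]] := mix b (push b x0) Ib fx0 erefl.
  rewrite iterSr in fz; have := transfer_iter_gt0 fz z0.
  have fzn := fibre_iter_shift fz.
  have := T1 _ fzn; set y := iter n Defs.shift z in fzn *.
  case E : (transfer_iter n (thV w) (first_is c) y) => [t| |]//.
  rewrite lee_fin lte_fin => t1 t0.
  (* The first factor bounds the weight of [b] by comparison with the reference point [push b x0];
     the second is the distortion loss at distance at most 1, times the probability [t] at [y]. *)
  exists (expR (phi (thV w, push b x0) - V) * (expR (- s (thV w)) * t))%R.
  split; first by rewrite !mulr_gt0// expR_gt0.
  move=> _ x fbx fx; rewrite EFinM; apply: lee_pmul.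
  - by rewrite lee_fin expR_ge0.
  - by rewrite lee_fin mulr_ge0 ?expR_ge0// ltW.
  - rewrite tprob_on// lee_fin ler_expR.
    by have := phiV _ _ fbx fx0 erefl; rewrite ler_distl => /andP[+ _].
  have y0 : y 0%N = push b x 0%N by rewrite /y iter_shiftE addn0.
  have FE (u v : NN) : u 0%N = v 0%N -> first_is c u = first_is c v.
    move=> uv; rewrite /first_is !indicE.
    have [uc|uc] := pselect (u 0%N = c); first by rewrite !mem_set//= -uv.
    by rewrite !memNset//= -uv.
  have := transfer_iter_head r01 A_thV A_hoelder s_ge0 kappa_ge0 A_sum n
    (A_thV Aw) fzn fbx y0 (first_is_ge0 c) FE.
  apply: le_trans; rewrite E EFinM lee_wpmul2r ?lee_fin ?(ltW t0)//.
  by rewrite ler_expR lerN2 ler_piMr// word_dist_le1.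
have [M IM] := finite_set_nat_bounded finI.
have [rho [rho01 rhoM]] := lower_bound_nat M (fun b => proj1 (eta_spec b)).
exists rho; split => // x fx.
have wx0 : alphabet S w (x 0%N) by have [] := fx 0%N.
have [b Ib tb] := Ibp _ wx0.
have fbx : fibre S (thV w) (push b x) by apply/fibre_push.
apply: (le_trans _ (transfer_ge_term w b x _)); last first.
  by move=> u; exact: transfer_iter_ge0.
apply: (le_trans _ ((proj2 (eta_spec b)) Ib x fbx fx)).
by rewrite lee_fin rhoM// IM.
Qed.

End reach.

(** * Finiteness of the distortion constant *)

Section log_integrable_series.
Context (R : realType).

Lemma geometric_sum_le (q : R) n : (0 <= q < 1)%R ->
  (\sum_(0 <= k < n) q ^+ k <= (1 - q)^-1)%R.
Proof.
move=> /andP[q0 q1]; have q1' : (0 < 1 - q)%R by rewrite subr_gt0.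
suff -> : (\sum_(0 <= k < n) q ^+ k = (1 - q ^+ n) / (1 - q))%R.
  by rewrite -[leRHS]mul1r ler_pM2r ?invr_gt0// gerBl exprn_ge0.
elim: n => [|n IH]; first by rewrite big_nil expr0 subrr mul0r.
rewrite big_nat_recr//= IH exprS; field; exact: lt0r_neq0.
Qed.

Lemma geometric_nneseries_lty (q : R) N : (0 <= q < 1)%R ->
  \sum_(N <= k <oo) (q ^+ k)%:E < +oo.
Proof.
move=> q01; have /andP[q0 q1] := q01.
have qk0 k : 0 <= (q ^+ k)%:E by rewrite lee_fin exprn_ge0.
apply: (@le_lt_trans _ _ ((1 - q)^-1)%:E); last exact: ltry.
apply: lime_le; first by apply: is_cvg_nneseries => k _ _; exact: qk0.
apply: nearW => n; apply: (@le_trans _ _ (\sum_(0 <= k < n) (q ^+ k)%:E)).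
  have [Nn|nN] := leqP N n; last by rewrite big_geq ?(ltnW nN)// sume_ge0.
  by rewrite (@big_cat_nat _ _ _ N 0 n)//= leeDr// sume_ge0.
by rewrite sumEFin lee_fin geometric_sum_le.
Qed.

Lemma count_lt_le (a : R) n : (0 <= a)%R ->
  (\sum_(0 <= k < n) (k%:R < a)%R%:R <= a + 1)%R.
Proof.
(* The trivial bound [n] is carried along for the induction step in the case [n < a]. *)
move=> a0; suff [] : (\sum_(0 <= k < n) (k%:R < a)%R%:R <= n%:R :> R)%R /\
  (\sum_(0 <= k < n) (k%:R < a)%R%:R <= a + 1)%R by [].
elim: n => [|n [IH1 IH2]]; first by rewrite !big_nil; split => //; rewrite addr_ge0.
rewrite !big_nat_recr//=; case: ltP => na /=.
  by rewrite -[n.+1%:R]natr1 !lerD2r; split => //; rewrite (le_trans IH1)// ltW.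
by rewrite addr0; split => //; rewrite (le_trans IH1)// ler_nat.
Qed.

Context (d : measure_display) (Omega : measurableType d) (P : probability Omega R).
Variables (T TV : Omega -> Omega) (kappa : Omega -> R) (r : R).
Hypothesis ET : ergodic_automorphism P T TV.
Hypothesis r01 : (0 < r < 1)%R.
Hypothesis kappa_meas : measurable_fun setT kappa.
Hypothesis kappa_ge0 : forall w, (0 <= kappa w)%R.
Hypothesis kappa_log : \int[P]_w maxe (lne (kappa w)%:E) 0 < +oo.

(** Half the exponential rate of [r]: where [kappa (theta^-k w) <= exp(eps k)], the [k]-th term of
    the series is at most [exp(- eps k)]. *)
Let eps : R := (- ln r / 2)%R.

Let eps_gt0 : (0 < eps)%R.
Proof. by rewrite divr_gt0// oppr_gt0 ln_lt0. Qed.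

Let h w : \bar R := maxe (lne (kappa w)%:E) 0.

Let h_ge0 w : 0 <= h w.
Proof. by rewrite /h le_max lexx orbT. Qed.

Let h_le w k : h w <= (eps * k%:R)%:E -> (kappa w <= expR (eps * k%:R))%R.
Proof.
rewrite /h ge_max => /andP[+ _].
have [->|k0] := eqVneq (kappa w) 0%R; first by rewrite expR_ge0.
have kp : (0 < kappa w)%R by rewrite lt_neqAle eq_sym k0 kappa_ge0.
rewrite lne_EFin// lee_fin => lk.
by rewrite -(lnK (x := kappa w)) ?ler_expR// posrE.
Qed.

Let measurable_h : measurable_fun setT h.
Proof.
rewrite (_ : h = fun w => if (kappa w == 0%R) then 0 else (Num.max (ln (kappa w)) 0)%:E).
  apply: measurable_fun_ifT => //.
    apply: (measurable_fun_bool true); rewrite setTI.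
    rewrite (_ : _ @^-1` _ = kappa @^-1` [set 0%R]).
      by rewrite -[X in measurable X]setTI; exact: kappa_meas.
    by apply/seteqP; split => w /= /eqP.
  apply/measurable_EFinP; apply: measurable_maxr => //.
  exact: (measurableT_comp (@measurable_ln R) kappa_meas).
apply/funext => w; rewrite /h; case: eqVneq => [->|k0].
  by rewrite le0_lneNy// max_r// leNye.
have kp : (0 < kappa w)%R by rewrite lt_neqAle eq_sym k0 kappa_ge0.
by rewrite lne_EFin// EFin_max.
Qed.

Let E (k : nat) : set Omega := [set w | (eps * k%:R)%:E < h w].

Let mE k : measurable (E k).
Proof.
rewrite -[X in measurable X]setTI; exact: emeasurable_fun_o_infty.
Qed.

Let sum_E : \sum_(k <oo) P (E k) < +oo.
Proof.
have I0 k w : 0 <= (\1_(E k) w)%:E :> \bar R by rewrite lee_fin.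
have mI k : measurable_fun setT (fun w => (\1_(E k) w)%:E : \bar R).
  by apply/measurable_EFinP; exact: measurable_indic.
rewrite (eq_eseriesr (g := fun k => \int[P]_w (\1_(E k) w)%:E)); last first.
  by move=> k _; rewrite integral_indic// setIT.
rewrite -integral_nneseries//.
(* Pointwise, the sum of the indicators counts the [k < h w / eps], hence is at most
   [h w / eps + 1]. *)
apply: (@le_lt_trans _ _ (\int[P]_w ((eps^-1)%:E * h w + cst 1 w))).
  apply: ge0_le_integral => //.
  - by move=> w _; apply: nneseries_ge0.
  - by apply: ge0_emeasurable_sum.
  - by apply: emeasurable_funD => //; exact: measurable_funeM.
  move=> w _; have := h_ge0 w; case hw : (h w) => [a| |]//; last first.
    by rewrite gt0_muley ?lte_fin ?invr_gt0// addye ?leey.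
  rewrite lee_fin => a0; apply: lime_le; first exact: is_cvg_nneseries.
  apply: nearW => n; rewrite sumEFin -EFinM -EFinD lee_fin.
  apply: le_trans (count_lt_le n _); last by rewrite mulr_ge0// invr_ge0 ltW.
  apply: ler_sum => k _; rewrite indicE; case: (boolP (w \in E k)) => // wE.
  rewrite (_ : (k%:R < eps^-1 * a)%R)//.
  by move: wE; rewrite inE /E/= hw lte_fin mulrC ltr_pdivlMl// mulrC.
rewrite ge0_integralD//; last 2 first.
- by move=> w _; rewrite mule_ge0// lee_fin invr_ge0 ltW.
- exact: measurable_funeM.
rewrite ge0_integralZl//; last by rewrite lee_fin invr_ge0 ltW.
have -> : \int[P]_w (cst 1 w : \bar R) = 1.
  by rewrite integral_cst// mul1e; exact: probability_setT.
rewrite lte_add_pinfty ?ltry//.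
by rewrite lte_mul_pinfty// lee_fin invr_ge0 ltW.
Qed.

(** Borel-Cantelli: by invariance the events [kappa (theta^-k w) > exp(eps k)] have the
    probabilities summed in [sum_E], so almost surely only finitely many occur and a geometric
    series bounds the tail. *)
Lemma kappa_series_lty :
  {ae P, forall w, \sum_(1 <= k <oo) (kappa (iter k TV w) * r ^+ k)%:E < +oo}.
Proof.
have ETV := ergodic_automorphism_inv ET.
pose F k := iter k TV @^-1` E k.
have mF k : measurable (F k).
  exact: measurable_preimage_iter (auto_measurableV ET) (mE k).
have F0 : P (lim_sup_set F) = 0.
  apply: lim_sup_set_cvg0 => //; apply: le_lt_trans sum_E.
  apply: lee_nneseries => [k _ _|k _]; first exact: measure_ge0.
  have PF := preserving_iter k ETV (mE k).
  by rewrite le_eqVlt; apply/orP; left; apply/eqP; exact: PF.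
exists (lim_sup_set F); split => //.
  by apply: bigcapT_measurable => n; apply: bigcup_measurable => k _; exact: mF.
move=> w /= nfin; apply: contrapT => nF; apply: nfin.
have [n Hn] : exists n, forall k, (n <= k)%N -> ~ F k w.
  apply: contrapT => /forallNP nn; apply: nF => n _.
  have := nn n; move=> /existsNP[k] /not_implyP[nk /contrapT Fk].
  by exists k.
have r0 : (0 < r)%R by case/andP: r01.
have kr0 k : 0 <= (kappa (iter k TV w) * r ^+ k)%:E.
  by rewrite lee_fin mulr_ge0// exprn_ge0// ltW.
rewrite (nneseries_split 1 n)//.
rewrite lte_add_pinfty//; first by rewrite sumEFin ltry.
pose q := expR (- eps).
have q01 : (0 <= q < 1)%R by rewrite expR_ge0 -expR0 ltr_expR oppr_lt0.
apply: (le_lt_trans _ (geometric_nneseries_lty (1 + n) q01)).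
rewrite eseries_cond [leRHS]eseries_cond.
apply: lee_nneseries => [k _ _|k /= nk]; first exact: kr0.
rewrite lee_fin.
have hk : h (iter k TV w) <= (eps * k%:R)%:E.
  rewrite leNgt; apply/negP => hF; apply: (Hn k) => //.
  by move: nk; rewrite add1n => /ltnW.
apply: (le_trans (ler_wpM2r (exprn_ge0 _ (ltW r0)) (h_le hk))).
rewrite -(lnK (x := r)) ?posrE// -!expRM_natr -expRD ler_expR /eps.
by rewrite -mulrDl; apply: ler_wpM2r => //; lra.
Qed.

End log_integrable_series.

(** * The logarithm of the distortion constant *)

Section log_sum.
Context (R : realType) (d : measure_display) (Omega : measurableType d)
  (P : probability Omega R) (S : random_tmc P) (r : R) (kappa : Omega -> R).
Hypothesis r01 : (0 < r < 1)%R.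
Hypothesis kappa_ge0 : forall w, (0 <= kappa w)%R.
Hypothesis kappa_meas : measurable_fun setT kappa.
Local Notation thV := (thetaV S).

(** This is [log B_w]. Its real value is the [s] of the coupling estimates, and [log_sum_rec]
    supplies their hypothesis [A_sum]. *)
Definition log_sum (w : Omega) : \bar R :=
  \sum_(1 <= k <oo) (kappa (iter k thV w) * r ^+ k)%:E.

Let term_ge0 w k : 0 <= (kappa (iter k thV w) * r ^+ k)%:E.
Proof. by rewrite lee_fin mulr_ge0// exprn_ge0//; case/andP: r01 => /ltW. Qed.

Lemma log_sum_ge0 w : 0 <= log_sum w.
Proof. by apply: nneseries_ge0 => k _ _; exact: term_ge0. Qed.

Lemma log_sum_shift w :
  log_sum w = \sum_(0 <= k <oo) (kappa (iter k.+1 thV w) * r ^+ k.+1)%:E.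
Proof.
rewrite /log_sum -nneseries_addn; last exact: term_ge0.
by apply: eq_eseriesr => k _; rewrite addn1.
Qed.

Lemma log_sum_rec w :
  log_sum w = (kappa (thV w) * r)%:E + r%:E * log_sum (thV w).
Proof.
rewrite log_sum_shift nneseries_recl//.
rewrite expr1 -nneseriesZl; last by move=> k _; exact: term_ge0.
congr (_ + _); apply: eq_eseriesr => k _.
by rewrite iterSr -EFinM exprS mulrCA.
Qed.

Lemma fine_log_sum_rec w : log_sum w < +oo ->
  fine (log_sum w) = (kappa (thV w) * r + r * fine (log_sum (thV w)))%R.
Proof.
have r0 : (0 < r)%R by case/andP: r01.
rewrite log_sum_rec; have := log_sum_ge0 (thV w).
case: (log_sum (thV w)) => [a _ _| |]//.
by rewrite gt0_muley ?lte_fin// addey.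
Qed.

Lemma BsumE w : log_sum w < +oo -> Bsum S r kappa w = (expR (fine (log_sum w)))%:E.
Proof.
move=> fw; rewrite /Bsum -/(log_sum w) -[in LHS](fineK (x := log_sum w))//.
by rewrite ge0_fin_numE// log_sum_ge0.
Qed.

Lemma Bsum_ge1 w : 1 <= Bsum S r kappa w.
Proof. by rewrite /Bsum -/(log_sum w) -expeR0 lee_expeR log_sum_ge0. Qed.

Lemma measurable_log_sum : measurable_fun setT log_sum.
Proof.
rewrite (_ : log_sum = fun w =>
  \sum_(0 <= k <oo) (kappa (iter k.+1 thV w) * r ^+ k.+1)%:E); last first.
  by apply/funext => w; exact: log_sum_shift.
apply: ge0_emeasurable_sum => [k w _ _|k _]; first exact: term_ge0.
apply/measurable_EFinP; apply: measurable_funM => //.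
apply: (measurableT_comp kappa_meas).
exact: measurable_fun_iter (auto_measurableV (theta_auto S)).
Qed.

End log_sum.

(** * Return times *)

Section return_times.
Context (d : measure_display) (Omega : measurableType d).
Variables (T : Omega -> Omega) (G : set Omega) (N0 : nat).

(** [N0] is the length that a block must have for one contraction stage to take effect, so earlier
    visits to [G] are ignored. *)
Definition return_time w : nat :=
  first_nat (fun j => (N0 <= j)%N /\ G (iter j T w)).

Definition return_map w : Omega := iter (return_time w) T w.

Fixpoint return_sum n w : nat :=
  if n is n'.+1 then (return_time w + return_sum n' (return_map w))%N else 0%N.

Lemma return_timeP w : (exists j, (N0 <= j)%N /\ G (iter j T w)) ->
  (N0 <= return_time w)%N /\ G (return_map w).
Proof. by move=> /first_natP. Qed.

Hypotheses (mT : measurable_fun setT T) (mG : measurable G).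

Lemma measurable_return_time : measurable_fun setT return_time.
Proof.
apply: measurable_first_nat => j; apply: measurable_set_and.
  exact: measurable_set_cst.
by rewrite -[X in measurable X]setTI; exact: (measurable_fun_iter j mT).
Qed.

Lemma measurable_return_sum n : measurable_fun setT (return_sum n).
Proof.
elim: n => [|n IH] /=; first exact: measurable_cst.
have mR : measurable_fun setT return_map.
  apply: (measurable_fun_countable_case (g := fun k => iter k T)) => [|k].
    exact: measurable_return_time.
  exact: measurable_fun_iter.
have mS : measurable_fun setT (fun w => return_sum n (return_map w)).
  exact: measurableT_comp.
apply: (measurable_fun_countable_case
  (g := fun k w => (k + return_sum n (return_map w))%N)) => [|k].
  exact: measurable_return_time.
apply: (measurable_fun_countable_case (g := fun l _ => (k + l)%N)) => //.
Qed.

End return_times.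

(** * Contraction along successive returns *)

Section contraction_along_returns.
Context (R : realType) (d : measure_display) (Omega : measurableType d)
  (P : probability Omega R) (S : random_tmc P) (phi : Omega * NN -> R).
Variables (r : R) (kappa s : Omega -> R) (A : set Omega).
Implicit Types (w : Omega) (x y : NN) (b : nat).
Local Notation th := (theta S).
Local Notation thV := (thetaV S).
Hypothesis r01 : (0 < r < 1)%R.
Hypothesis A_thV : forall w, A w -> A (thV w).
Hypothesis A_norm : forall w, A w -> normalized_at S phi w.
Hypothesis A_hoelder : forall w, A w -> forall n x y, (2 <= n)%N ->
  fibre S (thV w) x -> fibre S (thV w) y -> (forall i, (i < n)%N -> x i = y i) ->
  (`|phi (thV w, x) - phi (thV w, y)| <= kappa (thV w) * r ^+ n)%R.
Hypothesis s_ge0 : forall w, (0 <= s w)%R.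
Hypothesis kappa_ge0 : forall w, (0 <= kappa w)%R.
Hypothesis A_sum : forall w, A w -> s w = (kappa (thV w) * r + r * s (thV w))%R.
Local Notation dist := (word_dist r).
Local Notation couple_iter := (couple_iter S phi).
Variables (beta t : R) (G : set Omega) (N0 : nat).
Hypothesis A_th : forall w, A w -> A (th w).
Hypothesis beta_ge1 : (1 <= beta)%R.
Hypothesis t01 : (0 < t < 1)%R.
Local Notation trunc_dist := (trunc_dist r beta).
Hypothesis stage : forall w n x y, A w -> G w -> (N0 <= n)%N ->
  fibre S w x -> fibre S w y ->
  couple_iter n w trunc_dist (x, y) <= t%:E * trunc_dist (x, y).
Hypothesis visit_past : forall w, A w -> exists j, (N0 <= j)%N /\ G (iter j thV w).
Hypothesis visit_future : forall w, A w -> exists j, (N0 <= j)%N /\ G (iter j th w).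

Let edist (z : NN * NN) : \bar R := (dist z.1 z.2)%:E.

Let edist_ge0 z : 0 <= edist z.
Proof. by rewrite lee_fin word_dist_ge0. Qed.

Let t_ge0 : (0 <= t)%R. Proof. by case/andP: t01 => /ltW. Qed.

Let A_iter_thV n w : A w -> A (iter n thV w).
Proof. by move=> Aw; elim: n => [//|n IH]; exact: A_thV. Qed.

Let A_iter_th n w : A w -> A (iter n th w).
Proof. by move=> Aw; elim: n => [//|n IH]; exact: A_th. Qed.

Let trunc_ge0 z : 0 <= trunc_dist z.
Proof. exact: trunc_dist_ge0. Qed.

Let edist_le_trunc z : edist z <= trunc_dist z.
Proof.
rewrite lee_fin le_min word_dist_le1//=.
by rewrite ler_peMl// word_dist_ge0.
Qed.

Let couple_iter_edist n w x y : fibre S w x -> fibre S w y ->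
  couple_iter n w edist (x, y) <= couple_iter n w trunc_dist (x, y).
Proof. by move=> fx fy; apply: le_couple_iter => // z _ _; exact: edist_le_trunc. Qed.

Let couple_iter_scale n w F (k : R) x y : (0 <= k)%R -> (forall z, 0 <= F z) ->
  (forall u v, fibre S (iter n thV w) u -> fibre S (iter n thV w) v ->
     F (u, v) <= k%:E * trunc_dist (u, v)) ->
  fibre S w x -> fibre S w y ->
  couple_iter n w F (x, y) <= k%:E * couple_iter n w trunc_dist (x, y).
Proof.
move=> k0 F0 Fk fx fy; rewrite -couple_iterZ//.
by apply: le_couple_iter => // -[u v] /=; exact: Fk.
Qed.

Lemma couple_iter_past n w x y : A w -> G w -> fibre S w x -> fibre S w y ->
  couple_iter (return_sum thV G N0 n w) w trunc_dist (x, y) <=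
  (t ^+ n)%:E * trunc_dist (x, y).
Proof.
elim: n w x y => [|n IH] w x y Aw Gw fx fy /=; first by rewrite expr0 mul1e.
have [Nj Gj] := return_timeP (visit_past Aw).
rewrite couple_iterD exprSr EFinM -muleA.
apply: (le_trans (couple_iter_scale (k := t ^+ n) _ _ _ fx fy)).
- exact: exprn_ge0.
- by move=> z; exact: couple_iter_ge0.
- by move=> u v fu fv; apply: IH => //; exact: A_iter_thV.
by apply: lee_wpmul2l; [rewrite lee_fin exprn_ge0|exact: stage].
Qed.

(** There are [n.+1] blocks for the power [n], because the first one leads from [w] into [G] and is
    not a contraction stage. *)
Lemma couple_iter_past_start n w x y : A w -> fibre S w x -> fibre S w y ->
  couple_iter (return_sum thV G N0 n.+1 w) w edist (x, y) <=
  (t ^+ n * (beta * expR (s w)))%:E * edist (x, y).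
Proof.
move=> Aw fx fy; apply: (le_trans (couple_iter_edist _ fx fy)) => /=.
have [Nj Gj] := return_timeP (visit_past Aw).
rewrite couple_iterD EFinM -muleA.
apply: (le_trans (couple_iter_scale (k := t ^+ n) _ _ _ fx fy)).
- exact: exprn_ge0.
- by move=> z; exact: couple_iter_ge0.
- by move=> u v fu fv; apply: couple_iter_past => //; exact: A_iter_thV.
apply: lee_wpmul2l; first by rewrite lee_fin exprn_ge0.
rewrite -EFinM.
exact: (couple_iter_start r01 A_thV A_norm A_hoelder s_ge0 kappa_ge0 A_sum beta_ge1).
Qed.

(** The operator runs back from the last return to [w], so each of the [n] blocks starts in [G] even
    if [w] is outside. Therefore no initial block and no factor [B_w] appear. *)
Lemma couple_iter_future n w x y : A w ->
  let z := iter (return_sum th G N0 n w) th w in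
  fibre S z x -> fibre S z y ->
  couple_iter (return_sum th G N0 n w) z trunc_dist (x, y) <=
  (t ^+ n)%:E * trunc_dist (x, y).
Proof.
elim: n w x y => [|n IH] w x y Aw z fx fy /=; first by rewrite expr0 mul1e.
have [Nj Gj] := return_timeP (visit_future Aw).
have Aw' : A (return_map th G N0 w) by exact: A_iter_th.
set w' := return_map th G N0 w in Gj Aw' *.
have zE : z = iter (return_sum th G N0 n w') th w'.
  by rewrite /z /= addnC iterD.
rewrite zE in fx fy *; set l := return_sum th G N0 n w' in fx fy *.
rewrite addnC couple_iterD iter_thK exprS EFinM -muleA.
apply: (le_trans (couple_iter_scale (k := t) _ _ _ fx fy)) => //.
- by move=> u; exact: couple_iter_ge0.
- by move=> u v; rewrite iter_thK => fu fv; exact: stage.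
by apply: lee_wpmul2l; [rewrite lee_fin|exact: IH].
Qed.

Lemma couple_iter_future_start n w x y : A w ->
  let z := iter (return_sum th G N0 n w) th w in
  fibre S z x -> fibre S z y ->
  couple_iter (return_sum th G N0 n w) z edist (x, y) <=
  (t ^+ n * beta)%:E * edist (x, y).
Proof.
move=> Aw z fx fy; apply: (le_trans (couple_iter_edist _ fx fy)).
apply: (le_trans (couple_iter_future Aw fx fy)).
rewrite EFinM -muleA; apply: lee_wpmul2l; first by rewrite lee_fin exprn_ge0.
by rewrite -EFinM lee_fin ge_min lexx orbT.
Qed.

End contraction_along_returns.

(** * Good points and the theorem *)

Section good_points.
Context (R : realType) (d : measure_display) (Omega : measurableType d)
  (P : probability Omega R) (S : random_tmc P) (phi : Omega * NN -> R).
Variables (r : R) (kappa : Omega -> R) (Obi Obp : set Omega).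
Hypothesis r01 : (0 < r < 1)%R.
Hypothesis phi_meas : measurable_fun (total_space S) phi.
Hypothesis hL1 : ruelle_normalized S phi.
Hypothesis hH : locally_hoelder S phi r kappa 2.
Hypothesis hV : {ae P, forall w, (theta S @^-1` (Obi `|` Obp)) w ->
  Defs.variation S phi w 1 < +oo}.
Hypothesis hbip : bip S Obi Obp.
Local Notation th := (theta S).
Local Notation thV := (thetaV S).
Local Notation log_sum := (log_sum S r kappa).
Let s w : R := fine (log_sum w).

Let kappa_ge0 w : (0 <= kappa w)%R. Proof. by case: hH. Qed.

Let kappa_meas : measurable_fun setT kappa. Proof. by case: hH. Qed.

(** The last condition excludes letters whose cylinders are nonempty only on a null set, since
    topological mixing says nothing about them. *)
Definition regular_point w : Prop :=
  [/\ row_positive S w,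
      forall x, fibre S (th w) x -> ruelle S phi w (cst 1%R) x = 1%R,
      forall n, (2 <= n)%N -> Defs.variation S phi w n <= (kappa w * r ^+ n)%:E,
      log_sum w < +oo &
      ((th @^-1` (Obi `|` Obp)) w -> Defs.variation S phi w 1 < +oo) /\
      forall b, Omega_word S [:: b] w -> possible_word S [:: b]].

Lemma ae_regular_point : {ae P, forall w, regular_point w}.
Proof.
have ae_letters : {ae P, forall w, forall b, Omega_word S [:: b] w -> possible_word S [:: b]}.
  apply/ae_foralln => b; have [pb|npb] := pselect (possible_word S [:: b]).
    by apply: aeW => w.
  have [N [mN N0 bN]] : P.-negligible (Omega_word S [:: b]) by exact: contrapT.
  by exists N; split => // w /= /not_implyP[/bN].
have [_ _ _ ae_h] := hH.
have kl : \int[P]_w maxe (lne (kappa w)%:E) 0 < +oo by case: hH.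
have ae_log := kappa_series_lty (theta_auto S) r01 kappa_meas kappa_ge0 kl.
have ae1 := ae_mp2 (fun w => @conj _ _) ae_letters ae_h.
have ae2 := ae_mp2 (fun w => @conj _ _) (alpha_row S) hL1.
have ae3 := ae_mp2 (fun w => @conj _ _) ae_log hV.
have ae12 := ae_mp2 (fun w => @conj _ _) ae1 ae2.
by apply: ae_mp2 ae12 ae3 => w [[l h] [a n]] [g v].
Qed.

(** Imposing the conditions along the two-sided orbit makes the set strictly invariant, so that
    inductions along the orbit meet no further null set. *)
Definition good_point w : Prop :=
  forall k, regular_point (iter k th w) /\ regular_point (iter k thV w).

Lemma ae_good_point : {ae P, forall w, good_point w}.
Proof.
have E := theta_auto S; have EV := ergodic_automorphism_inv E.
have H1 := ae_iter E ae_regular_point; have H2 := ae_iter EV ae_regular_point.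
by apply: ae_mp2 H1 H2 => w h1 h2 k.
Qed.

Lemma good_point_th w : good_point w -> good_point (th w).
Proof.
move=> gw k; split; first by rewrite -iterSr; exact: (gw k.+1).1.
case: k => [|k]; first exact: (gw 1%N).1.
by rewrite iterSr thK; exact: (gw k).2.
Qed.

Lemma good_point_thV w : good_point w -> good_point (thV w).
Proof.
move=> gw k; split; last by rewrite -iterSr; exact: (gw k.+1).2.
case: k => [|k]; first exact: (gw 1%N).2.
by rewrite iterSr thVK; exact: (gw k).1.
Qed.

Lemma good_point_regular w : good_point w -> regular_point w.
Proof. by move=> /(_ 0%N)[]. Qed.

Lemma good_point_row w k : good_point w -> row_positive S (iter k th w).
Proof. by move=> /(_ k)[[]]. Qed.

Lemma good_point_normalized w : good_point w -> normalized_at S phi w.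
Proof.
move=> /good_point_thV/good_point_regular[_ L1 _ _ _].
by apply: normalized_of_ruelle => x fx; apply: L1; rewrite thVK.
Qed.

Lemma variation_le w n (c : R) x y : Defs.variation S phi w n <= c%:E ->
  fibre S w x -> fibre S w y -> (forall i, (i < n)%N -> x i = y i) ->
  (`|phi (w, x) - phi (w, y)| <= c)%R.
Proof.
move=> vc fx fy xy; rewrite -lee_fin; apply: le_trans vc.
by apply: ereal_sup_ubound; exists x, y.
Qed.

Lemma good_point_hoelder w : good_point w -> forall n x y, (2 <= n)%N ->
  fibre S (thV w) x -> fibre S (thV w) y -> (forall i, (i < n)%N -> x i = y i) ->
  (`|phi (thV w, x) - phi (thV w, y)| <= kappa (thV w) * r ^+ n)%R.
Proof.
move=> /good_point_thV/good_point_regular[_ _ h _ _] n x y n2 fx fy xy.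
exact: variation_le (h n n2) fx fy xy.
Qed.

Let s_ge0 w : (0 <= s w)%R.
Proof. by rewrite fine_ge0// log_sum_ge0. Qed.

Lemma good_point_sum w : good_point w -> s w = (kappa (thV w) * r + r * s (thV w))%R.
Proof. by move=> /good_point_regular[_ _ _ ls _]; exact: fine_log_sum_rec. Qed.

Lemma log_sum_fine w : good_point w -> log_sum w = (s w)%:E.
Proof.
move=> /good_point_regular[_ _ _ ls _].
by rewrite fineK// ge0_fin_numE// log_sum_ge0.
Qed.

Definition reach_prob N c w x : \bar R :=
  transfer_iter S phi N w (fun x => (\1_[set z : NN | z 0%N = c] x)%:E) x.

(* By distortion a lower bound at one point of each cylinder suffices; testing it
   only at the greedy points makes this set measurable. *)
Definition control_set c N j : set Omega := [set w | log_sum w <= j%:R%:E /\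
  forall i, alphabet S w i -> (j.+1%:R^-1)%:E <= reach_prob N c w (greedy S w i)].

Lemma measurable_control_set c N j : measurable (control_set c N j).
Proof.
apply: measurable_set_and.
  rewrite -[X in measurable X]setTI; apply: measurable_lee => //.
  exact: measurable_log_sum.
apply: measurable_set_all => i; apply: measurable_set_imply.
  exact: alphabet_measurable.
rewrite -[X in measurable X]setTI; apply: measurable_lee => //.
apply: measurable_transfer_iter_greedy => //.
apply/measurable_EFinP/measurable_indic.
exact: (measurable_eq_nat c (measurable_coord 0)).
Qed.

Lemma exists_nat_above (a rho : R) : (0 < rho)%R ->
  exists j : nat, (a <= j%:R)%R /\ (j.+1%:R^-1 <= rho)%R.
Proof.
move=> rho0; exists (maxn (Num.truncn `|a|).+1 (Num.truncn rho^-1).+1).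
have le_trunc (b : R) m : (0 <= b)%R -> ((Num.truncn b).+1 <= m)%N -> (b <= m%:R)%R.
  move=> b0 bm; apply/ltW; apply: (@lt_le_trans _ _ (Num.truncn b).+1%:R).
    by have /andP[] := truncn_itv b0.
  by rewrite ler_nat.
split.
  by apply: (le_trans (ler_norm a)); apply: le_trunc => //; rewrite leq_maxl.
rewrite invf_ple ?posrE ?ltr0n//.
by apply: le_trunc; [rewrite invr_ge0 ltW|rewrite leqW// leq_maxr].
Qed.

Let Nbip : exists I : set nat, finite_set I /\
  forall w a, Obp w -> alphabet S w a -> exists2 b, I b & transition S (thV w) b a.
Proof.
have [_ _ _ [I finI [_ bp]]] := hbip; exists I; split => // w a ow wa.
have [b Ib [al ad]] := bp w a ow wa; exists b => //.
by split; [exact: (al 0%N)|exact: (al 1%N)|exact: (ad 0%N)].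
Qed.

Lemma control_of_reach c N (rho : R) w : good_point w -> (0 < rho)%R ->
  (forall x, fibre S w x -> rho%:E <= reach_prob N c w x) ->
  exists j, control_set c N j w.
Proof.
move=> gw rho0 reach; have [j [sj rj]] := exists_nat_above (s w) rho0.
exists j; split; first by rewrite log_sum_fine// lee_fin.
move=> i wi; apply: (@le_trans _ _ rho%:E); first by rewrite lee_fin.
by apply: reach; apply: greedy_fibre => // k; exact: good_point_row.
Qed.

Lemma mixing_reach c w n I (Nm : nat -> Omega -> nat) : good_point w -> Obp w ->
  finite_set I ->
  (forall w a, Obp w -> alphabet S w a -> exists2 b, I b & transition S (thV w) b a) ->
  alphabet S (iter n.+1 thV w) c ->
  (forall b, I b -> (Nm b (iter n.+1 thV w) <= n)%N) ->
  (forall b, possible_word S [:: b] -> forall m,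
     (Nm b (iter n.+1 thV w) <= m)%N -> alphabet S (iter n.+1 thV w) c ->
     Omega_word S [:: b] (iter m th (iter n.+1 thV w)) ->
     (cylinder S (iter n.+1 thV w) [:: c] `&`
       iter m Defs.shift @^-1` cylinder S (iter m th (iter n.+1 thV w)) [:: b]) !=set0) ->
  exists rho : R, (0 < rho <= 1)%R /\ forall x, fibre S w x ->
    rho%:E <= reach_prob n.+1 c w x.
Proof.
move=> gw ow finI Ibp wc Nn mix.
have gv := good_point_thV gw.
have [V phiV] : exists V : R, forall x y, fibre S (thV w) x -> fibre S (thV w) y ->
    x 0%N = y 0%N -> (`|phi (thV w, x) - phi (thV w, y)| <= V)%R.
  have [_ _ _ _ [v1 _]] := good_point_regular gv.
  have {v1} : Defs.variation S phi (thV w) 1 < +oo.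
    by apply: v1; right; rewrite thVK.
  case E : (Defs.variation S phi (thV w) 1) => [V| |]// _.
    exists V => x y fx fy xy0; apply: (@variation_le (thV w) 1) => //.
      by rewrite E.
    by case.
  (* The supremum is [-oo] only for an empty fibre. *)
  exists 0%R => x y fx fy xy0; apply: (@variation_le (thV w) 1) => //.
    by rewrite E leNye.
  by case.
apply: (transfer_iter_reach r01 good_point_thV good_point_normalized
  good_point_hoelder s_ge0 kappa_ge0 good_point_sum gw finI (Ibp w ^~ ow) phiV).
move=> b x Ib fx x0; have iterE : iter n th (iter n.+1 thV w) = thV w.
  by rewrite iterSr iter_thVK.
have cyl : Omega_word S [:: b] (thV w).
  by exists x; split => // -[|i].
have [_ _ _ _ [_ letters]] := good_point_regular gv.
have := mix b (letters b cyl) n (Nn b Ib) wc; rewrite iterE => /(_ cyl)[z [[fz zc] [_ zb]]].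
exists z; split => //; first exact: (zc 0%N).
by have := zb 0%N erefl; rewrite iter_shiftE addn0.
Qed.

(** The path from [c] starts at [theta^-(n+1) w], where the mixing time is evaluated too. Recurrence
    of [thV] to a set [Y n0], on which all mixing times towards letters of [I] are at most [n0],
    provides a suitable [n]. *)
Lemma ae_control : exists c,
  {ae P, forall w, Obp w -> exists N j, control_set c N j w}.
Proof.
have [[c wc]|nc] := pselect (exists c, 0 < P [set w | alphabet S w c]); last first.
  (* Degenerate case: almost every alphabet is empty, and only the bound on [log_sum] remains to be
     met. *)
  exists 0%N; have ae0 : {ae P, forall w, forall i, ~ alphabet S w i}.
    apply/ae_foralln => i; exists [set w | alphabet S w i]; split.
    - exact: alphabet_measurable.
    - apply/eqP; rewrite eq_le measure_ge0 andbT leNgt; apply/negP => ?.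
      by apply: nc; exists i.
    - by move=> w /= /contrapT.
  apply: ae_mp2 ae_good_point ae0 => w gw nw _; exists 0%N.
  have [j [sj _]] := exists_nat_above (s w) (@ltr01 R).
  by exists j; split => [|i /nw//]; rewrite log_sum_fine// lee_fin.
exists c; have [mixing _ _ _] := hbip; have [I [finI Ibp]] := Nbip.
(* [possible_word] speaks of nonempty cylinders; at a good point whose alphabet contains [c], the
   greedy point lies in the cylinder. *)
have pc : possible_word S [:: c].
  move=> neg; have : P.-negligible [set w | alphabet S w c].
    have : {ae P, forall w, good_point w -> ~ alphabet S w c}.
      case: neg => M [mM M0 cM]; exists M; split => // w /= /not_implyP[gw /contrapT wa].
      apply: cM; exists (greedy S w c); split; last by case.
      by apply: greedy_fibre => // k; exact: good_point_row.
    move=> aec; have : {ae P, forall w, ~ alphabet S w c}.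
      by apply: ae_mp2 ae_good_point aec => w gw; exact.
    by apply: negligibleS => w /= wa; exact.
  move=> /negligibleP; rewrite -/(alphabet S) => /(_ (alphabet_measurable S c)) => H.
  by move: wc; rewrite H ltxx.
have /choice[Nm NmP] : forall b, exists N : Omega -> nat, measurable_fun setT N /\
    (possible_word S [:: b] -> {ae P, forall w, forall n, (N w <= n)%N -> alphabet S w c ->
    Omega_word S [:: b] (iter n th w) ->
    (cylinder S w [:: c] `&`
       iter n Defs.shift @^-1` cylinder S (iter n th w) [:: b]) !=set0}).
  move=> b; have [pb|npb] := pselect (possible_word S [:: b]).
    by have [N [mN HN]] := mixing c b pc pb; exists N.
  by exists (fun=> 0%N); split => //; exact: measurable_cst.
have ae_mix : {ae P, forall w, forall b, possible_word S [:: b] ->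
    forall n, (Nm b w <= n)%N -> alphabet S w c ->
    Omega_word S [:: b] (iter n th w) ->
    (cylinder S w [:: c] `&`
       iter n Defs.shift @^-1` cylinder S (iter n th w) [:: b]) !=set0}.
  apply/ae_foralln => b; have [pb|npb] := pselect (possible_word S [:: b]).
    have := (NmP b).2 pb; apply: negligibleS => w /= nw H; apply: nw => _; exact: H.
  by apply: aeW => w.
have EV := ergodic_automorphism_inv (theta_auto S).
have ae_mix_orbit := ae_iter EV ae_mix.
pose Y n := [set w | alphabet S w c /\ forall b, I b -> (Nm b w <= n)%N].
have mY n : measurable (Y n).
  apply: measurable_set_and; first exact: alphabet_measurable.
  apply: measurable_set_all => b; apply: measurable_set_imply.
    exact: measurable_set_cst.
  rewrite -[X in measurable X]setTI.
  by have := (NmP b).1 measurableT [set k | (k <= n)%N]; apply.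
have [n0 Y0] : exists n, 0 < P (Y n).
  apply: contrapT => /forallNP nY.
  have nullY : P.-negligible (\bigcup_n Y n).
    apply: negligible_bigcup => n; apply/negligibleP => //.
    by apply/eqP; rewrite eq_le measure_ge0 andbT leNgt; apply/negP/nY.
  have sub : [set w | alphabet S w c] `<=` \bigcup_n Y n.
    move=> w /= wa; have [M IM] := finite_set_nat_bounded finI.
    exists (\max_(b < M) Nm b w)%N => //; split => // b Ib.
    by have := @leq_bigmax _ (fun b : 'I_M => Nm b w) (Ordinal (IM b Ib)).
  have /negligibleP H := negligibleS sub nullY.
  by move: wc; rewrite H ?ltxx//; exact: alphabet_measurable.
have rec := ergodic_recurrence EV (mY n0) Y0.
apply: ae_mp2 (ae_mp2 (fun w => @conj _ _) ae_good_point ae_mix_orbit) rec.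
(* One step is reserved for the passage between [theta^-1 w] and [w] through [I]; at least [n0]
   steps are left for mixing. *)
move=> w [gw mix] /(_ n0.+1)[[|n] [//nn [wa Nn]]] ow.
have [rho [/andP[rho0 _] reach]] := @mixing_reach c w n I Nm gw ow finI Ibp wa
  (fun b Ib => leq_trans (Nn b Ib) nn) (mix n.+1).
have [j jw] := control_of_reach gw rho0 reach.
by exists n.+1, j.
Qed.

(** Otherwise [Obp] would be covered, up to a null set, by countably many null sets. *)
Lemma positive_control : exists c N j, 0 < P (control_set c N j).
Proof.
have [c aec] := ae_control; exists c; apply: contrapT => nex.
have null N j : P.-negligible (control_set c N j).
  apply/negligibleP; first exact: measurable_control_set.
  apply/eqP; rewrite eq_le measure_ge0 andbT leNgt; apply/negP => ?.
  by apply: nex; exists N, j.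
have nullU : P.-negligible (\bigcup_N \bigcup_j control_set c N j).
  by apply: negligible_bigcup => N; apply: negligible_bigcup => j.
have [_ _ [mbp bp0] _] := hbip.
have : P.-negligible Obp.
  apply: negligibleS (negligibleU aec nullU) => w ow.
  have [H|H] := pselect (exists N j, control_set c N j w).
    by right; have [N [j wj]] := H; exists N => //; exists j.
  by left => /= /(_ ow).
by move=> /negligibleP => /(_ mbp) H; move: bp0; rewrite H ltxx.
Qed.

End good_points.

(** * The random sequences *)

Section contracting_sequences.
Context (R : realType) (d : measure_display) (Omega : measurableType d)
  (P : probability Omega R) (S : random_tmc P) (phi : Omega * NN -> R).
Variables (r : R) (kappa : Omega -> R) (Obi Obp : set Omega).
Hypothesis r01 : (0 < r < 1)%R.
Hypothesis phi_meas : measurable_fun (total_space S) phi.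
Hypothesis hL1 : ruelle_normalized S phi.
Hypothesis hH : locally_hoelder S phi r kappa 2.
Hypothesis hV : {ae P, forall w, (theta S @^-1` (Obi `|` Obp)) w ->
  Defs.variation S phi w 1 < +oo}.
Hypothesis hbip : bip S Obi Obp.
Local Notation th := (theta S).
Local Notation thV := (thetaV S).
Local Notation log_sum := (log_sum S r kappa).
Local Notation dist := (word_dist r).
Local Notation couple_iter := (couple_iter S phi).
Local Notation good_point := (good_point S phi r kappa Obi Obp).
Local Notation control_set := (control_set S phi r kappa).
Let s w : R := fine (log_sum w).
Let edist (z : NN * NN) : \bar R := (dist z.1 z.2)%:E.

Let kappa_ge0 w : (0 <= kappa w)%R. Proof. by case: hH. Qed.

Let kappa_meas : measurable_fun setT kappa. Proof. by case: hH. Qed.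

Let s_ge0 w : (0 <= s w)%R.
Proof. by rewrite fine_ge0// log_sum_ge0. Qed.

Let sum_rec w : good_point w -> s w = (kappa (thV w) * r + r * s (thV w))%R.
Proof. exact: good_point_sum. Qed.

(** Distortion carries the bound from the greedy point of a cylinder to all its points, at the price
    of the factor [exp(-j)]. *)
Lemma control_reach (c N j : nat) w (x : NN) : good_point w -> control_set c N j w -> fibre S w x ->
  (expR (- j%:R) / j.+1%:R)%:E <= reach_prob S phi N c w x.
Proof.
move=> gw [sj reach] fx.
have wx : alphabet S w (x 0%N) by have [] := fx 0%N.
have fg : fibre S w (greedy S w (x 0%N)).
  by apply: greedy_fibre => // k; exact: good_point_row gw.
have F0 (u : NN) : 0 <= (\1_[set z : NN | z 0%N = c] u)%:E :> \bar R by rewrite lee_fin.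
have FE (u v : NN) : u 0%N = v 0%N ->
    (\1_[set z : NN | z 0%N = c] u)%:E = (\1_[set z : NN | z 0%N = c] v)%:E :> \bar R.
  move=> uv; rewrite !indicE.
  have [uc|uc] := pselect (u 0%N = c); first by rewrite !mem_set//= -uv.
  by rewrite !memNset//= -uv.
have := transfer_iter_head r01 (@good_point_thV _ _ _ _ _ _ _ _ _ _)
  (@good_point_hoelder _ _ _ _ _ _ _ _ _ _) s_ge0 kappa_ge0 sum_rec N gw fg fx erefl F0 FE.
apply: le_trans; rewrite EFinM; apply: lee_pmul.
- by rewrite lee_fin expR_ge0.
- by rewrite lee_fin invr_ge0.
- rewrite lee_fin ler_expR lerN2.
  have sw : (s w <= j%:R)%R by rewrite -lee_fin -(log_sum_fine r01 hH gw).
  apply: le_trans sw; rewrite ler_piMr//; exact: word_dist_le1.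
- exact: reach.
Qed.

Let recurrent (T : Omega -> Omega) (G : set Omega) w :=
  forall N, exists j, (N <= j)%N /\ G (iter j T w).

Let recurrent_fwd T G w : recurrent T G w -> recurrent T G (T w).
Proof.
by move=> rw N; have [[|j] [//nj Gj]] := rw N.+1; exists j; rewrite -iterSr.
Qed.

Let recurrent_bwd T TV G w : cancel TV T -> recurrent T G w -> recurrent T G (TV w).
Proof.
move=> TVK rw N; have [j [nj Gj]] := rw N; exists j.+1.
by rewrite iterSr TVK; split => //; exact: leqW.
Qed.

Lemma pow_small (q b : R) (e : R) : (0 < q < 1)%R -> (0 <= b)%R -> (0 < e)%R ->
  exists n, (b * q ^+ n <= e)%R.
Proof.
move=> /andP[q0 q1] b0 e0.
have cv : (b * q ^+ n @[n --> \oo] --> (b * 0 : R))%R.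
  by apply: cvgMr; apply: cvg_expr; rewrite ger0_norm// ltW.
rewrite mulr0 in cv.
have [n _ Hn] : \forall n \near \oo, (b * q ^+ n < e)%R by exact: (cvgr_lt _ cv).
by exists n; apply/ltW/Hn => /=.
Qed.

Lemma contracting_sequences : exists (t : R) (k l : nat -> Omega -> nat),
  [/\ (0 < t < 1)%R, random_sequence k, random_sequence l &
    {ae P, forall w, good_point w /\ forall n,
      (forall x y, fibre S w x -> fibre S w y ->
         couple_iter (k n w) w edist (x, y) <=
           (t ^+ n * expR (s w))%:E * edist (x, y)) /\
      (forall x y, fibre S (iter (l n w) th w) x -> fibre S (iter (l n w) th w) y ->
         couple_iter (l n w) (iter (l n w) th w) edist (x, y) <=
           (t ^+ n)%:E * edist (x, y))}].
Proof.
have [c [N [j G0]]] := positive_control r01 phi_meas hL1 hH hV hbip.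
set G := control_set c N j in G0.
have mG : measurable G by exact: measurable_control_set.
have E := theta_auto S; have EV := ergodic_automorphism_inv E.
(* On [G] the level [j] bounds [s], so it takes the role of [M] in [stage_contraction]. *)
pose beta : R := (Num.max 1 (4 * j%:R))%R.
have beta1 : (1 <= beta)%R by rewrite le_max lexx.
have beta0 : (0 <= beta)%R by exact: le_trans beta1.
have jbeta : (4 * j%:R <= beta)%R by rewrite le_max lexx orbT.
have [n0 Hn0] : exists n, (beta * r ^+ n <= 4^-1)%R by apply: pow_small.
pose rho : R := (expR (- j%:R) / j.+1%:R)%R.
have rho01 : (0 < rho <= 1)%R.
  rewrite divr_gt0 ?expR_gt0//= ler_pdivrMr// mul1r.
  by apply: (@le_trans _ _ 1%R); rewrite ?ler1n// -expR0 ler_expR oppr_le0.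
pose t : R := (1 - rho ^+ 2 * expR (- (j%:R / r ^+ N)) / 2)%R.
have r0 : (0 < r)%R by case/andP: r01.
have t01 : (0 < t < 1)%R.
  have /andP[rho0 rho1] := rho01.
  have e0 : (0 < expR (- (j%:R / r ^+ N)) :> R)%R by exact: expR_gt0.
  have e1 : (expR (- (j%:R / r ^+ N)) <= 1 :> R)%R.
    by rewrite -expR0 ler_expR oppr_le0 divr_ge0// exprn_ge0// ltW.
  have a0 : (0 < rho ^+ 2 * expR (- (j%:R / r ^+ N)))%R by rewrite mulr_gt0// exprn_gt0.
  have a1 : (rho ^+ 2 * expR (- (j%:R / r ^+ N)) <= 1)%R.
    by rewrite -[leRHS]mulr1 ler_pM// ?exprn_ge0 ?exprn_ile1// ltW.
  by rewrite /t; apply/andP; split; lra.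
have [q Hq] : exists q, (beta * t ^+ q <= 1)%R by apply: pow_small.
(* Recurrence in both directions is part of [A], as the return times are iterated along the
   orbit. *)
pose A w := [/\ good_point w, recurrent thV G w & recurrent th G w].
have A_thV w : A w -> A (thV w).
  move=> [gw rp rf]; split; [exact: good_point_thV|exact: recurrent_fwd|].
  exact: recurrent_bwd (@thVK _ _ _ _ S) rf.
have A_th w : A w -> A (th w).
  move=> [gw rp rf]; split; [exact: good_point_th| |exact: recurrent_fwd].
  exact: recurrent_bwd (@thK _ _ _ _ S) rp.
have A_norm w : A w -> normalized_at S phi w by move=> [/good_point_normalized].
have A_hoelder w : A w -> forall n x y, (2 <= n)%N ->
    fibre S (thV w) x -> fibre S (thV w) y -> (forall i, (i < n)%N -> x i = y i) ->
    (`|phi (thV w, x) - phi (thV w, y)| <= kappa (thV w) * r ^+ n)%R.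
  by move=> [/good_point_hoelder].
have A_sum w : A w -> s w = (kappa (thV w) * r + r * s (thV w))%R.
  by move=> [/sum_rec].
have stage w n x y : A w -> G w -> (N + n0 <= n)%N -> fibre S w x -> fibre S w y ->
    couple_iter n w (trunc_dist r beta) (x, y) <= t%:E * trunc_dist r beta (x, y).
  move=> Aw Gw Nn fx fy; have [gw _ _] := Aw.
  apply: (stage_contraction r01 A_thV A_norm A_hoelder s_ge0 kappa_ge0 A_sum beta1
    (c := c) Aw _ jbeta Hn0 rho01 _ Nn fx fy).
    by rewrite -lee_fin -(log_sum_fine r01 hH gw); exact: Gw.1.
  by move=> u fu; exact: control_reach.
have past w : A w -> exists i, (N + n0 <= i)%N /\ G (iter i thV w) by move=> [_ + _]; exact.
have future w : A w -> exists i, (N + n0 <= i)%N /\ G (iter i th w) by move=> [_ _]; exact.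
(* The [q] additional returns compensate [beta] on both sides; the successor accounts for the first
   passage into [G] in the past. *)
exists t, (fun n => return_sum thV G (N + n0) (n + q).+1),
  (fun n => return_sum th G (N + n0) (n + q)); split => //.
- by move=> n; apply: measurable_return_sum => //; exact: auto_measurableV E.
- by move=> n; apply: measurable_return_sum => //; exact: auto_measurable E.
have ae_rec := ae_mp2 (fun w => @conj _ _) (ergodic_recurrence EV mG G0) (ergodic_recurrence E mG G0).
apply: ae_mp2 (ae_good_point r01 hL1 hH hV) ae_rec => w gw [rp rf].
have Aw : A w by split.
have t0 : (0 <= t)%R by case/andP: t01 => /ltW.
have ed0 z : 0 <= edist z by rewrite lee_fin word_dist_ge0.
split => // n; split => x y fx fy.
  apply: (le_trans (couple_iter_past_start r01 A_thV A_norm A_hoelder s_ge0 kappa_ge0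
    A_sum beta1 t01 stage past (n + q) Aw fx fy)).
  apply: lee_wpmul2r; first by rewrite lee_fin word_dist_ge0.
  rewrite lee_fin exprD -mulrA ler_wpM2l ?exprn_ge0//.
  by rewrite mulrA (mulrC (t ^+ q)%R) ler_piMl// expR_ge0.
have F := couple_iter_future_start r01 A_th beta1 t01 stage future (n := n + q) Aw fx fy.
apply: (le_trans F); clear F.
apply: lee_wpmul2r; first by rewrite lee_fin word_dist_ge0.
rewrite lee_fin exprD -mulrA ler_piMr ?exprn_ge0//.
by rewrite mulrC.
Qed.

End contracting_sequences.

Lemma vasershtein_ge0 (R : realType) (r : R) (A : set NN) (mu nu : set NN -> \bar R) :
  (0 < r < 1)%R -> 0 <= vasershtein r A mu nu.
Proof.
move=> r01; apply: le_ereal_inf_tmp => _ [m _ <-].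
by apply: integral_ge0 => z _; rewrite lee_fin word_dist_ge0.
Qed.

Lemma ess_sup_ge1 (R : realType) (d : measure_display) (Omega : measurableType d)
    (P : probability Omega R) (f : Omega -> \bar R) :
  (forall w, 1 <= f w) -> 1 <= ess_sup P f.
Proof.
move=> f1; have P0 : 0 < P setT by rewrite probability_setT lte01.
exact: (ess_sup_gee P0 (aeW P f1)).
Qed.

(** The coupling estimates have the constants [B_w t^n] and [t^n]; those claimed are weaker because
    [2 >= 1] and [c >= 1]. *)
Lemma contraction_at (R : realType) (d : measure_display)
    (Omega : measurableType d) (P : probability Omega R) (S : random_tmc P)
    (Obi Obp : set Omega) (phi : Omega * NN -> R) (r : R) (kappa : Omega -> R)
    (t : R) (c : \bar R) (k l : nat -> Omega -> nat) (w : Omega) :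
  (0 < r < 1)%R -> measurable_fun (total_space S) phi ->
  (forall w, (0 <= kappa w)%R) -> (0 < t)%R -> 1 <= c ->
  good_point S phi r kappa Obi Obp w ->
  (forall n,
    (forall x y, fibre S w x -> fibre S w y ->
       couple_iter S phi (k n w) w (fun z => (word_dist r z.1 z.2)%:E) (x, y) <=
         (t ^+ n * expR (fine (log_sum S r kappa w)))%:E * (word_dist r x y)%:E) /\
    (forall x y, fibre S (iter (l n w) (theta S) w) x ->
       fibre S (iter (l n w) (theta S) w) y ->
       couple_iter S phi (l n w) (iter (l n w) (theta S) w)
         (fun z => (word_dist r z.1 z.2)%:E) (x, y) <=
         (t ^+ n)%:E * (word_dist r x y)%:E)) ->
  measure_contraction S phi r kappa t c k l w /\
  lipschitz_contraction S phi r kappa t c k l w.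
Proof.
move=> r01 phi_meas kappa_ge0 t0 c1 gw H.
have gthV := @good_point_thV _ _ _ _ S phi r kappa Obi Obp.
have gnorm := @good_point_normalized _ _ _ _ S phi r kappa Obi Obp.
have lw : log_sum S r kappa w < +oo by have [] := good_point_regular gw.
have giter n : good_point S phi r kappa Obi Obp (iter n (theta S) w).
  by elim: n => [//|n IH]; exact: good_point_th.
have tn0 n : (0 < t ^+ n)%R by rewrite exprn_gt0.
have K0 n : (0 < t ^+ n * expR (fine (log_sum S r kappa w)))%R.
  by rewrite mulr_gt0// expR_gt0.
have le1 n (a : \bar R) : 0 <= a ->
    (t ^+ n * expR (fine (log_sum S r kappa w)))%:E * a <=
    2%:E * Bsum S r kappa w * (t ^+ n)%:E * a.
  move=> a0; apply: lee_wpmul2r => //.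
  rewrite BsumE// -!EFinM lee_fin mulrC -mulrA ler_peMl ?ler1n//.
  by rewrite mulr_ge0// ?expR_ge0// ltW.
have le2 n (a : \bar R) : 0 <= a -> (t ^+ n)%:E * a <= c * (t ^+ n)%:E * a.
  move=> a0; apply: lee_wpmul2r => //; rewrite -[leLHS]mul1e.
  by apply: lee_wpmul2r => //; rewrite lee_fin ltW.
split=> [w_ w' mu nu _ _ n|w_ w' f _ n]; rewrite {}/w_ {}/w'; split.
- apply: le_trans (le1 n _ (vasershtein_ge0 _ _ _ r01)).
  rewrite /vas /pullback iter_thVK.
  exact: (vasershtein_contraction r01 gthV gnorm phi_meas (mu w) (nu w) gw (K0 n) (H n).1).
- apply: le_trans (le2 n _ (vasershtein_ge0 _ _ _ r01)).
  have := vasershtein_contraction r01 gthV gnorm phi_meas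
    (mu (iter (l n w) (theta S) w)) (nu (iter (l n w) (theta S) w))
    (giter (l n w)) (tn0 n) (H n).2.
  by rewrite iter_thK.
- apply: le_trans (le1 n _ (lip_const_ge0 _ _ _)).
  exact: (lip_contraction r01 gthV gnorm _ gw (K0 n) (H n).1).
- apply: le_trans (le2 n _ (lip_const_ge0 _ _ _)).
  have := lip_contraction r01 gthV gnorm (on_fibre f w) (giter (l n w)) (tn0 n) (H n).2.
  by rewrite iter_thK.
Qed.

Theorem corollary3p1 (R : realType) (d : measure_display)
    (Omega : measurableType d) (P : probability Omega R) (S : random_tmc P)
    (Obi Obp : set Omega) (phi : Omega * NN -> R) (r : R) (kappa : Omega -> R)
    (hbip : bip S Obi Obp)
    (phi_meas : measurable_fun (total_space S) phi)
    (hH : hypothesis_H S phi r kappa Obi Obp)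
    (hL1 : ruelle_normalized S phi) :
  (exists (t c : R) (k l : nat -> Omega -> nat),
    [/\ (0 < t < 1)%R, (0 < c)%R, random_sequence k, random_sequence l &
      {ae P, forall w,
        measure_contraction S phi r kappa t c%:E k l w /\
        lipschitz_contraction S phi r kappa t c%:E k l w}]) /\
  (ess_sup P (Bsum S r kappa) < +oo ->
   exists (t : R) (k l : nat -> Omega -> nat),
    [/\ (0 < t < 1)%R, random_sequence k, random_sequence l &
      {ae P, forall w,
        let c := 2%:E * ess_sup P (Bsum S r kappa) in
        measure_contraction S phi r kappa t c k l w /\
        lipschitz_contraction S phi r kappa t c k l w}]).
Proof.
have [r01 hoelder hV] := hH.
have kappa_ge0 : forall w, (0 <= kappa w)%R by case: hoelder.
have [t [k [l [t01 mk ml contr]]]] := contracting_sequences r01 phi_meas hL1 hoelder hV hbip.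
have t0 : (0 < t)%R by case/andP: t01.
have key c : 1 <= c -> {ae P, forall w, measure_contraction S phi r kappa t c k l w /\
    lipschitz_contraction S phi r kappa t c k l w}.
  move=> c1; apply: (ae_mp2 _ contr contr) => w [gw H] _.
  exact: (contraction_at r01 phi_meas kappa_ge0 t0 c1 gw H).
(* The constant 1 is admissible since [beta] has been compensated by the choice of [l]. The same
   sequences serve the second half, where [B_w >= 1] makes the prescribed [c] at least 1. *)
split; first by exists t, 1%R, k, l; split => //; exact: key.
move=> _; exists t, k, l; split => //; apply: key.
have e1 := ess_sup_ge1 P (Bsum_ge1 S r01 kappa_ge0).
rewrite -[leLHS]mul1e; apply: lee_pmul => //.
by rewrite lee_fin ler1n.
Qed.
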